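(* Let $L>0$ and $L\mathbb{Z}:=\{Ln: n\in\mathbb{Z}\}$. Assume further that $$\sum_{n\in\mathbb{Z}}\left|\frac{1}{q+\Psi(\frac{2n\pi}{L})}\right|<\infty\qquad\text{for } q>0.$$ Define $$\varphi_{L\mathbb{Z}}(x):=\sum_{n\in\mathbb{Z}\setminus\{0\}}\frac{1-e^{\frac{2n\pi x}{L}i}}{\Psi(\frac{2n\pi}{L})},\qquad x\in\mathbb{R}.$$ Then for every $t\ge0$, every bounded $\mathcal{F}_t$-measurable functional $F_t$, and every $x\in\mathbb{R}$ with $\varphi_{L\mathbb{Z}}(x)\neq0$, $$\lim_{q\to0+}\mathbb{P}_x[F_t,\ t<\boldsymbol{e}_q\mid\boldsymbol{e}_q<T_{L\mathbb{Z}}]=\mathbb{P}_x\left[F_t\cdot\frac{\varphi_{L\mathbb{Z}}(X_t)}{\varphi_{L\mathbb{Z}}(x)}1_{\{T_{L\mathbb{Z}}>t\}}\right].$$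
   Context: $((X_t)_{t\ge0},(\mathbb{P}_x)_{x\in\mathbb{R}})$ is the canonical representation of a one-dimensional Lévy process with $X_0=x$, $\mathbb{P}_x$-a.s.; $\mathbb{P}_x[\cdot]$ also denotes expectation, $\mathbb{P}_x[F\mid B]=\mathbb{P}_x[F;B]/\mathbb{P}_x(B)$ and $\mathbb{P}_x[F,\,C\mid B]=\mathbb{P}_x[F1_C\mid B]$. Put $\mathcal{F}^X_t=\sigma(X_s,0\le s\le t)$ and $\mathcal{F}_t=\bigcap_{s>t}\mathcal{F}^X_s$. The characteristic exponent $\Psi$ is given by $\mathbb{P}_0[e^{i\lambda X_t}]=e^{-t\Psi(\lambda)}$. Standing assumptions: $X$ is recurrent, every point is regular for itself, and (A) $\int_0^\infty\left|\frac{1}{q+\Psi(\lambda)}\right|d\lambda<\infty$ for all $q>0$. Under these assumptions $\Psi(u)=0$ if and only if $u=0$. For $A\subset\mathbb{R}$, $T_A:=\inf\{t\ge0: X_t\in A\}$, and $\boldsymbol{e}_q$ is an exponential random variable with parameter $q>0$ independent of $X$. *)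

(* Defs.v *)
From HB Require Import structures.
From mathcomp Require Import all_boot all_order all_algebra.
From mathcomp Require Import all_classical all_reals all_analysis.
From mathcomp Require Export complex.
Set Implicit Arguments.
Unset Strict Implicit.
Unset Printing Implicit Defensive.
Import Order.TTheory GRing.Theory Num.Theory.
Import numFieldNormedType.Exports.
Local Open Scope classical_set_scope.
Local Open Scope ring_scope.
Local Open Scope complex_scope.

(* the components of [Complex], not the generic ones of a [numClosedFieldType] *)
Local Notation Re := complex.Re.
Local Notation Im := complex.Im.

Section complex_valued.
Context {R : realType}.

Definition cexp (z : R[i]) : R[i] :=
  (expR (Re z))%:C * (cos (Im z) +i* sin (Im z)).

(* [`|z|] lives in [R[i]]; this is its value as a real number *)
Definition cmod (z : R[i]) : R := Re `|z|.

(* Sum of an absolutely convergent family of complex numbers, componentwise: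
   the sum of the positive parts minus the sum of the negative parts. *)
Definition csum (I : choiceType) (D : set I) (f : I -> R[i]) : R[i] :=
  let rsum (g : I -> R) :=
    fine (\esum_(i in D) (Num.max (g i) 0)%:E
          - \esum_(i in D) (Num.max (- g i) 0)%:E) in
  rsum (fun i => Re (f i)) +i* rsum (fun i => Im (f i)).

Definition cexpectation d (T : measurableType d)
    (mu : {measure set T -> \bar R}) (f : T -> R[i]) : R[i] :=
  (\int[mu]_w Re (f w)) +i* (\int[mu]_w Im (f w)).

End complex_valued.

(* [E[G | B] = E[G; B] / P(B)].  Both terms are written as integrals because
   [B] may involve a hitting time, and such events belong in general only to
   the completion of the sigma-algebra.  The integral of a nonnegative function
   is the supremum of the integrals of the simple functions below it, so it
   takes the right value on such events, whereas the values of [mu] outside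
   the sigma-algebra are unconstrained. *)
Definition cond_expectation d (T : measurableType d) (R : realType)
    (mu : {measure set T -> \bar R}) (G : T -> R) (B : set T) : R :=
  (\int[mu]_z (G z * \1_B z)) / (\int[mu]_z \1_B z).

(* Cadlag paths on [0, +oo[, extended to negative times by their value at 0 so
   that two paths are equal as soon as they agree on [0, +oo[. *)
Section path_space.
Context {R : realType}.

Record cadlag (f : R -> R) : Prop := Cadlag {
  cadlag_right : forall t, 0 <= t -> f x @[x --> t^'+] --> f t ;
  cadlag_left : forall t, 0 < t -> cvg (f x @[x --> t^'-]) ;
  cadlag_neg : forall t, t < 0 -> f t = f 0 }.

Record path := Path { path_fun :> R -> R ; pathP : cadlag path_fun }.

HB.instance Definition _ := gen_eqMixin path.
HB.instance Definition _ := gen_choiceMixin path.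

Lemma cadlag_cst (c : R) : cadlag (fun=> c).
Proof. by split => // t _; [exact: cvg_cst|exact: is_cvg_cst]. Qed.

HB.instance Definition _ := isPointed.Build path (Path (cadlag_cst 0)).

Lemma cadlag_translate (x : R) (w : path) : cadlag (fun t => x + w t).
Proof.
case: w => f [fr fl fn]; split => /= t t0.
- by apply: cvgD; [exact: cvg_cst|exact: fr].
- by apply: is_cvgD; [exact: is_cvg_cst|exact: fl].
- by rewrite fn.
Qed.

Definition translate (x : R) (w : path) : path := Path (cadlag_translate x w).

Definition events_on (I : set R) : set (set path) :=
  [set A | exists s (B : set R), [/\ I s, 0 <= s, measurable B &
             A = [set w : path | B (w s)]]].

End path_space.
Arguments path : clear implicits.

Definition pathspace (R : realType) :=
  g_sigma_algebraType (@events_on R [set: R]).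

HB.instance Definition _ (R : realType) := Measurable.on (pathspace R).

Section levy.
Context {R : realType}.

Definition X (t : R) (w : pathspace R) : R := (w : path R) t.

Definition natural_filtration (t : R) : set (set (pathspace R)) :=
  <<s @events_on R [set s | s <= t] >>.

Definition rc_filtration (t : R) : set (set (pathspace R)) :=
  \bigcap_(s in [set s | t < s]) natural_filtration s.

Definition measurable_wrt (G : set (set (pathspace R)))
    (F : pathspace R -> R) : Prop :=
  forall B : set R, measurable B -> G (F @^-1` B).

Definition hitting_time (A : set R) (w : pathspace R) : \bar R :=
  ereal_inf [set t%:E | t in [set t | 0 <= t /\ A (X t w)]].

Record levy_law (P0 : probability (pathspace R) R) : Prop := LevyLaw {
  levy_start : P0 [set w | X 0 w = 0] = 1%E ;
  levy_indep : forall (s t : R) (A : set (pathspace R)) (B : set R),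
    0 <= s -> s <= t -> natural_filtration s A -> measurable B ->
    P0 (A `&` [set w | B (X t w - X s w)]) =
    (P0 A * P0 [set w | B (X t w - X s w)%R])%E ;
  levy_stationary : forall (s t : R) (B : set R), 0 <= s -> s <= t -> measurable B ->
    P0 [set w | B (X t w - X s w)] = P0 [set w | B (X (t - s) w)] }.

(* [P x] is the law of [x + X] under [P 0] *)
Definition levy_process (P : R -> probability (pathspace R) R) : Prop :=
  levy_law (P 0) /\
  forall x (A : set (pathspace R)), measurable A ->
    P x A = P 0 [set w | A (translate x w)].

Definition characteristic_exponent (P0 : probability (pathspace R) R)
    (Psi : R -> R[i]) : Prop :=
  forall t l : R, 0 <= t ->
    cexpectation P0 (fun w => cexp ('i%C * (l * X t w)%:C)) =
    cexp (- (t%:C * Psi l)).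

Definition recurrent (P : R -> probability (pathspace R) R) : Prop :=
  {ae P 0, forall w,
     limf_einf (fun t : R => `|X t w|%:E) (pinfty_nbhs R) = 0%E}.

(* the first return time is an infimum over [t > 0], unlike [hitting_time] *)
Definition regular_for_itself (P : R -> probability (pathspace R) R)
    (a : R) : Prop :=
  {ae P a, forall w,
     ereal_inf [set t%:E | t in [set t : R | 0 < t /\ X t w = a]] = 0%E}.

Definition resolvent_integrable (Psi : R -> R[i]) : Prop :=
  forall q : R, 0 < q ->
    (\int[lebesgue_measure]_(l in `[0%R, +oo[)
       (cmod (q%:C + Psi l)^-1)%:E < +oo)%E.

Definition lattice (L : R) : set R := [set L * n%:~R | n in [set: int]].

Definition dual_point (L : R) (n : int) : R := 2 * n%:~R * pi / L.

Definition lattice_summable (L : R) (Psi : R -> R[i]) : Prop :=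
  forall q : R, 0 < q ->
    (\esum_(n in [set: int]) (cmod (q%:C + Psi (dual_point L n))^-1)%:E
       < +oo)%E.

Definition phi_lattice (L : R) (Psi : R -> R[i]) (x : R) : R[i] :=
  csum [set n : int | n != 0]
    (fun n => (1 - cexp ('i%C * (dual_point L n * x)%:C)) / Psi (dual_point L n)).

End levy.

(* [e q] is exponential with parameter [q] for every [q > 0]; it will be made
   independent of [X] by working on a product space. *)
Definition exponential_clocks (R : realType) d (S : measurableType d)
    (Q : probability S R) (e : R -> {RV Q >-> R}) : Prop :=
  forall q : R, 0 < q -> forall A : set R, measurable A ->
    distribution Q (e q) A = exponential_prob q A.

(* Main.v *)
(* Modulo L, the process X is a process on a circle, and the lattice becomes a
   single point.  Summability of 1 / (q + Psi) over the dual lattice makes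
     r_q(y) = sum_n e^(2 i pi n y / L) / (q + Psi(2 pi n / L))
   a bounded continuous function, the q-resolvent density of the circle
   process (up to a reflection and a constant), and e^(-qt) r_q(X_t) is a
   martingale up to the hitting time T of the lattice.  Since r_q(X_T) = r_q(0),
     r_q(0) E_x[F_t 1_(t < T) e^(-qT)] = e^(-qt) E_x[F_t 1_(t < T) r_q(X_t)].
   Integrating out the exponential clock, the conditional expectation equals
     e^(-qt) E_x[F_t 1_(t < T) (r_q(0) - r_q(X_t))] / (r_q(0) - r_q(x)),
   and r_q(0) - r_q(y) tends boundedly to phi(y) as q tends to 0.

   No strong Markov property is used: the martingale identity is an exact
   telescoping sum along a time grid, for the Fejer means of r_q, stopped when
   the grid enters a neighbourhood of the lattice; the Fejer kernel is small
   outside that neighbourhood.  Then the mesh, the Fejer order and the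
   neighbourhood go to their limits in turn.  The limit of the entrance times is
   almost surely T by quasi-left-continuity. *)
From HB Require Import structures.
Require Import Defs.
From mathcomp Require Import all_boot all_order all_algebra.
From mathcomp Require Import all_classical all_reals all_analysis.
From mathcomp Require Import measurable_realfun ring lra.
Import Order.TTheory GRing.Theory Num.Theory.
Import numFieldNormedType.Exports.
Local Open Scope classical_set_scope.
Local Open Scope ring_scope.
Local Open Scope complex_scope.
Set Implicit Arguments.
Unset Strict Implicit.
Unset Printing Implicit Defensive.

Local Notation Re := complex.Re.
Local Notation Im := complex.Im.

(** The resolvent density lies outside the domain of the generator: on the circle
    [(q - generator) r_q] is, up to a constant, the point mass at the lattice. Cesaro weights turn
    this mass into the Fejer kernel, of size [1/N] at a fixed distance from the lattice; plain
    partial sums would give the Dirichlet kernel, which does not decay there. This forces the order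
    of the limits. For fixed [N] only finitely many modes occur and each grid step errs by [o(h)],
    against a discounted number of steps of order [1/(q h)]; [N] then grows with the neighbourhood
    fixed, and shrinking the neighbourhood costs a modulus of continuity uniform in [N].

    The mode [n = 0] contributes [1/q] to [r_q] and cancels in [r_q(0) - r_q(y)]; hence a bound by
    the summable [1/Psi], uniform in [q].

    Measurability shapes the rest. The hitting time of the lattice is replaced by a limit of
    entrance times into open sets, which right continuity makes measurable. [F] belongs to the
    right-continuous filtration, the Markov property to the natural one: identities are proved at
    times slightly after [t] and passed to the limit. *)

Section bounded_measurable.
Context d (T : measurableType d) (R : realType).
Implicit Types f g : T -> R.

(** Every such function is integrable under a probability, and the class is stable under the ring
    operations: this one predicate carries all the integrability side conditions. *)
Definition bmfun f :=
  measurable_fun [set: T] f /\ exists M : R, forall w, `|f w| <= M.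

Lemma bmfunP f (M : R) : measurable_fun [set: T] f ->
  (forall w, `|f w| <= M) -> bmfun f.
Proof. by move=> mf fM; split => //; exists M. Qed.

Lemma bmfun_cst (c : R) : bmfun (cst c).
Proof. by apply: (@bmfunP _ `|c|) => //; exact: measurable_cst. Qed.

Lemma bmfunD f g : bmfun f -> bmfun g -> bmfun (fun w => f w + g w).
Proof.
move=> [mf [M fM]] [mg [N gN]]; apply: (@bmfunP _ (M + N)).
  exact: measurable_funD.
by move=> w; rewrite (le_trans (ler_normD _ _))// lerD.
Qed.

Lemma bmfunM f g : bmfun f -> bmfun g -> bmfun (fun w => f w * g w).
Proof.
move=> [mf [M fM]] [mg [N gN]]; apply: (@bmfunP _ (M * N)).
  exact: measurable_funM.
by move=> w; rewrite normrM ler_pM.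
Qed.

Lemma bmfunZ (c : R) f : bmfun f -> bmfun (fun w => c * f w).
Proof. exact: (bmfunM (bmfun_cst c)). Qed.

Lemma bmfunN f : bmfun f -> bmfun (fun w => - f w).
Proof. by move=> /(bmfunZ (-1)); under eq_fun do rewrite mulN1r. Qed.

Lemma bmfunB f g : bmfun f -> bmfun g -> bmfun (fun w => f w - g w).
Proof. by move=> bf /bmfunN; exact: bmfunD. Qed.

Lemma bmfun_sum (I : Type) (s : seq I) (h : I -> T -> R) :
  (forall i, bmfun (h i)) -> bmfun (fun w => \sum_(i <- s) h i w).
Proof.
move=> bh; elim: s => [|i s ih].
  by under eq_fun do rewrite big_nil; exact: bmfun_cst.
by under eq_fun do rewrite big_cons; exact: bmfunD.
Qed.

Lemma bmfun_indic (A : set T) : measurable A -> bmfun \1_A.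
Proof.
move=> mA; apply: (@bmfunP _ 1); first exact: measurable_indic.
by move=> w; rewrite ger0_norm// indicE; case: (_ \in _).
Qed.

End bounded_measurable.
Arguments bmfun_cst {d T R} c.

Section expectation.
Context d (T : measurableType d) (R : realType) (P : probability T R).
Implicit Types f g : T -> R.

Lemma bmfun_integrable f : bmfun f -> P.-integrable setT (EFin \o f).
Proof.
move=> [mf [M fM]]; apply: measurable_bounded_integrable => //.
  by rewrite [ltLHS]probability_setT ltry.
exists M; split; first exact: num_real.
by move=> N MN w _; apply: le_trans (fM w) _; exact: ltW.
Qed.

Lemma ExpD f g : bmfun f -> bmfun g ->
  \int[P]_w (f w + g w) = \int[P]_w f w + \int[P]_w g w.
Proof. by move=> bf bg; rewrite RintegralD//; exact: bmfun_integrable. Qed.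

Lemma ExpB f g : bmfun f -> bmfun g ->
  \int[P]_w (f w - g w) = \int[P]_w f w - \int[P]_w g w.
Proof. by move=> bf bg; rewrite RintegralB//; exact: bmfun_integrable. Qed.

Lemma ExpZ (c : R) f : bmfun f -> \int[P]_w (c * f w) = c * \int[P]_w f w.
Proof. by move=> bf; rewrite RintegralZl//; exact: bmfun_integrable. Qed.

Lemma Exp_cst (c : R) : \int[P]_w c = c.
Proof. by rewrite Rintegral_cst// [X in fine X]probability_setT mulr1. Qed.

Lemma Exp_sum (I : Type) (s : seq I) (h : I -> T -> R) :
  (forall i, bmfun (h i)) ->
  \int[P]_w (\sum_(i <- s) h i w) = \sum_(i <- s) \int[P]_w h i w.
Proof.
move=> bh; elim: s => [|i s ih].
  by rewrite big_nil; under eq_Rintegral do rewrite big_nil; exact: Exp_cst.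
rewrite big_cons -ih -ExpD//; last exact: bmfun_sum.
by apply: eq_Rintegral => w _; rewrite big_cons.
Qed.

Lemma le_Exp f g : bmfun f -> bmfun g -> (forall w, f w <= g w) ->
  \int[P]_w f w <= \int[P]_w g w.
Proof. by move=> bf bg fg; apply: le_Rintegral => //; exact: bmfun_integrable. Qed.

Lemma Exp_norm_le f (M : R) : bmfun f -> (forall w, `|f w| <= M) ->
  `|\int[P]_w f w| <= M.
Proof.
move=> bf fM; rewrite -[leRHS]Exp_cst ler_norml; apply/andP; split.
  rewrite -mulN1r -ExpZ; last exact: bmfun_cst.
  by apply: le_Exp => //[|w]; [exact: bmfun_cst|have:= fM w; rewrite ler_norml mulN1r => /andP[]].
apply: le_Exp => //[|w]; first exact: bmfun_cst.
exact: le_trans (ler_norm _) (fM w).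
Qed.

Lemma EFin_Exp f : bmfun f -> (\int[P]_w f w)%:E = (\int[P]_w (f w)%:E)%E.
Proof.
by move=> /bmfun_integrable bf; rewrite /Rintegral fineK//; exact: integrable_fin_num.
Qed.

(** Bounded convergence. The pointwise limit inherits measurability and the bound, so both are
    returned rather than asked for. *)
Lemma Exp_cvg (f_ : nat -> T -> R) f (M : R) :
  (forall n, measurable_fun setT (f_ n)) -> (forall n w, `|f_ n w| <= M) ->
  (forall w, f_ n w @[n --> \oo] --> f w) ->
  bmfun f /\ \int[P]_w f_ n w @[n --> \oo] --> \int[P]_w f w.
Proof.
move=> mf fM ff.
have mlim : measurable_fun setT f.
  by apply: (measurable_fun_cvg mf) => w _; exact: ff.
have bf : bmfun f.
  apply: (bmfunP mlim) => w.
  have /cvg_norm/(@cvg_lim _ _) <- // := ff w.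
  by apply: limr_le; [apply: is_cvg_norm; apply/cvg_ex; exists (f w); exact: ff|exact: nearW].
split=> //; have [|||||_ _] := @dominated_convergence _ T R P setT measurableT
  (fun n => EFin \o f_ n) (EFin \o f) (EFin \o cst M).
- by move=> n; exact/measurable_EFinP.
- exact/measurable_EFinP.
- by apply: aeW => w _; apply: cvg_EFin; [exact: nearW|exact: ff].
- by apply: bmfun_integrable; exact: bmfun_cst.
- by apply: aeW => w n _ /=; rewrite lee_fin.
- by move=> h; apply: fine_cvg; rewrite EFin_Exp.
Qed.

Lemma Exp_indic (A : set T) : measurable A -> \int[P]_w \1_A w = fine (P A).
Proof. by move=> mA; rewrite /Rintegral integral_indic// setIT. Qed.

End expectation.

(** * Null sets, Fatou's lemma and independence *)

Section almost_everywhere.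
Context d (T : measurableType d) (R : realType)
  (mu : {measure set T -> \bar R}).
Import HBNNSimple.

(** The integral of a nonnegative function is a supremum over the simple functions below it. Cutting
    such a function to 0 on [N] keeps its integral and puts it below [g]; measurability of [f] and
    [g] never enters. *)
Lemma ge0_integral_eq_off_null (N : set T) (f g : T -> \bar R) :
  measurable N -> mu N = 0%E ->
  (forall w, 0 <= f w)%E -> (forall w, 0 <= g w)%E ->
  (forall w, ~ N w -> f w = g w) ->
  (\int[mu]_w f w <= \int[mu]_w g w)%E.
Proof.
move=> mN N0 f0 g0 fg; rewrite !ge0_integralTE//.
apply: ge_ereal_sup => _ [h /= hf <-].
have mNC : measurable (~` N) by exact: measurableC.
pose k := mul_nnsfun h (indic_nnsfun R mNC).
have -> : sintegral mu h = sintegral mu k.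
  rewrite -!integralT_nnsfun; apply: ae_eq_integral => //.
  - by apply/measurable_EFinP.
  - by apply/measurable_EFinP.
  - exists N; split=> // w /= /not_implyP[_ hk]; apply: contrapT => Nw; apply: hk.
    by rewrite /= [in RHS]/mindic indicE mem_set// mulr1.
apply: ereal_sup_ubound; exists k => //= w.
rewrite /mindic indicE; have [Nw|Nw] := boolP (w \in ~` N); last first.
  by rewrite mulr0.
by rewrite mulr1 -fg//; exact/set_mem.
Qed.

(* Unlike in [ae_eq_integral], [f] may fail to be measurable: the events defined
   by the hitting time of the lattice belong only to the completion. *)
Lemma Rintegral_eq_off_null (N : set T) (f g : T -> R) :
  measurable N -> mu N = 0%E -> (forall w, ~ N w -> f w = g w) ->
  \int[mu]_w f w = \int[mu]_w g w.
Proof.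
move=> mN N0 fg; rewrite /Rintegral; congr fine.
rewrite integralE [RHS]integralE; congr (_ - _)%E; apply/eqP; rewrite eq_le;
  apply/andP; split; apply: (ge0_integral_eq_off_null mN N0) => // w Nw;
  by rewrite !(funeposE, funenegE)/= fg.
Qed.

(** Fatou's lemma in a form that can be iterated: the bound obtained for one lower limit serves as
    the sequence [c] of the next. *)
Lemma fatou_le (f : (T -> \bar R)^nat) (c : R ^nat) (l : R) :
  (forall n, measurable_fun setT (f n)) -> (forall n w, 0 <= f n w)%E ->
  (forall n, \int[mu]_w f n w <= (c n)%:E)%E -> c n @[n --> \oo] --> l ->
  (\int[mu]_w limn_einf (f ^~ w) <= l%:E)%E.
Proof.
move=> mf f0 fc cl; apply: le_trans (fatou _ _ _ _) _ => //.
rewrite limn_einf_lim; apply: lime_le; first exact: is_cvg_einfs.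
apply: nearW => n.
have h : (c k)%:E @[k --> \oo] --> l%:E by apply: cvg_EFin => //; exact: nearW.
apply: (cvge_ge _ h); near=> k; apply: le_trans (fc k); apply: ereal_inf_lbound.
by exists k => //=; near: k; exists n.
Unshelve. all: by end_near. Qed.
End almost_everywhere.

Section independence.
Context d (T : measurableType d) (R : realType) (P : probability T R).

(** The joint law of [U] and [V] agrees with the product of their laws on rectangles, hence
    everywhere, and Fubini separates the integral. [V] itself may be unbounded: it will be an
    increment of the process. *)
Lemma Exp_indep (U V : T -> R) (f : R -> R) :
  bmfun U -> measurable_fun setT V -> bmfun f ->
  (forall A B, measurable A -> measurable B ->
    P (U @^-1` A `&` V @^-1` B) = (P (U @^-1` A) * P (V @^-1` B))%E) ->
  \int[P]_w (U w * f (V w)) = \int[P]_w U w * \int[P]_w f (V w).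
Proof.
move=> bU mV bf ind.
have mU := bU.1; have mf := bf.1.
pose U' : {RV P >-> R} := mfun_Sub (mem_set mU).
pose V' : {RV P >-> R} := mfun_Sub (mem_set mV).
pose mW : measurable_fun setT (fun w => (U w, V w)) := measurable_fun_pair mU mV.
pose W' : {RV P >-> (R * R)%type} := mfun_Sub (mem_set mW).
pose mUV := (distribution P U' \x distribution P V')%E.
have muE A : measurable A -> mUV A = distribution P W' A.
  apply: product_measure_unique => B C mB mC.
  by rewrite -ind.
pose phi (z : R * R) : R := z.1 * f z.2.
have mphi : measurable_fun setT phi.
  by apply: measurable_funM; [exact: measurable_fst|exact: measurableT_comp].
have bphi : bmfun (phi \o W') by apply: bmfunM => //; split; [exact: measurableT_comp|case: bf.2 => N fN; exists N].
have iphi : (distribution P W').-integrable setT (EFin \o phi).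
  apply: integrable_pushforward => //; first exact/measurable_EFinP.
  exact: (bmfun_integrable P bphi).
have iphi' : mUV.-integrable setT (EFin \o phi).
  apply/integrableP; split; first exact/measurable_EFinP.
  rewrite (@eq_measure_integral _ _ _ _ (distribution P W')) => [|A mA _].
    by case/integrableP : iphi.
  exact: muE.
have bfV : bmfun (fun w => f (V w)).
  by split; [exact: measurableT_comp|case: bf.2 => N fN; exists N].
transitivity (fine (\int[distribution P W']_z (phi z)%:E)).
  rewrite integral_distribution //; first exact/measurable_EFinP.
  exact: (bmfun_integrable P bphi).
transitivity (fine (\int[mUV]_z (phi z)%:E)).
  congr fine; apply: eq_measure_integral => A mA _; exact/esym/muE.
rewrite -integral12_prod_meas1//= /fubini_F/=.
have EV : (\int[distribution P V']_y (f y)%:E = (\int[P]_w f (V w))%:E)%E.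
  rewrite EFin_Exp// (integral_distribution (X := V'))//.
    by apply/measurable_EFinP.
  exact: (bmfun_integrable P bfV).
rewrite (eq_integral (fun x : R => x%:E * (\int[P]_w f (V w))%:E)%E); last first.
  move=> x _; rewrite -EV -integralZl//.
  exact: (bmfun_integrable (distribution P V') bf).
rewrite (integral_distribution (X := U'))//; last 2 first.
  by apply: emeasurable_funM => //; apply/measurable_EFinP; exact: measurable_id.
  by apply: (bmfun_integrable P); apply: bmfunM => //; exact: bmfun_cst.
rewrite mulrC -ExpZ//; congr fine; apply: eq_integral => w _ /=.
by rewrite EFinM muleC.
Qed.
End independence.

(** * Series and trigonometric functions *)

Section series.
Context {R : realType}.
Implicit Types a b m : R ^nat.

Definition tsum a : R := limn (series a).

Lemma cvg_series_dominated a m : cvgn (series m) ->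
  (forall n, `|a n| <= m n) -> cvgn (series a).
Proof.
move=> cm am; apply: normed_cvg.
by apply: (series_le_cvg _ _ am cm) => n //=; exact: le_trans (am n).
Qed.

Lemma tsum_tail a m N : cvgn (series m) -> (forall n, `|a n| <= m n) ->
  `|tsum a - series a N| <= tsum m - series m N.
Proof.
move=> cm am; have ca := cvg_series_dominated cm am.
have h1 : `|series a n - series a N| @[n --> \oo] --> `|tsum a - series a N|.
  by apply: cvg_norm; apply: cvgB => //; exact: cvg_cst.
have h2 : series m n - series m N @[n --> \oo] --> tsum m - series m N.
  by apply: cvgB => //; exact: cvg_cst.
rewrite -(cvg_lim _ h1)// -(cvg_lim _ h2)//; apply: ler_lim.
- by apply/cvg_ex; eexists; exact: h1.
- by apply/cvg_ex; eexists; exact: h2.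
near=> n; have Nn : (N <= n)%N by near: n; exists N.
rewrite !sub_series_geq//; apply: le_trans (ler_norm_sum _ _ _) _.
exact: ler_sum.
Unshelve. all: by end_near. Qed.

Lemma tsum_norm_le a m : cvgn (series m) -> (forall n, `|a n| <= m n) ->
  `|tsum a| <= tsum m.
Proof.
move=> cm am; have := tsum_tail 0 cm am.
by rewrite /series/= !big_geq// !subr0.
Qed.

(** Dominated convergence for series: beyond a rank where the tail of [m] is below [e / 3] both
    tails are negligible, and a finite sum converges termwise. *)
Lemma tannery m (a : nat -> R ^nat) b : cvgn (series m) ->
  (forall k n, `|a k n| <= m n) -> (forall n, a k n @[k --> \oo] --> b n) ->
  tsum (a k) @[k --> \oo] --> tsum b.
Proof.
move=> cm am ab.
have bm n : `|b n| <= m n.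
  have /cvg_norm/(@cvg_lim _ _) <- // := ab n.
  by apply: limr_le; [apply: is_cvg_norm; apply/cvg_ex; exists (b n); exact: ab|exact: nearW].
have sab N : series (a k) N @[k --> \oo] --> series b N.
  by rewrite /series/=; apply: cvg_big => [|n _]; [exact: add_continuous|exact: ab].
apply/cvgrPdist_lt => e e0.
have e3 : 0 < e / 3 by rewrite divr_gt0.
have [N _ hN] : \forall N \near \oo, `|tsum m - series m N| < e / 3.
  by move: (e / 3) e3; apply/cvgrPdist_lt.
have {hN} := hN N (leqnn N).
rewrite /= ltr_norml => /andP[_ mN].
near=> k.
have h1 := tsum_tail N cm bm.
have h2 := tsum_tail N cm (am k).
have h3 : `|series b N - series (a k) N| < e / 3.
  by near: k; move: (e / 3) e3; apply/cvgrPdist_lt; exact: sab.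
move: h1 h2 h3; rewrite !ler_norml !ltr_norml => /andP[? ?] /andP[? ?] /andP[? ?].
by apply/andP; split; lra.
Unshelve. all: by end_near. Qed.

End series.

Section complex_trig.
Context {R : realType}.
Implicit Types (c z : R[i]) (x y : R).

Lemma cmodE z : (cmod z)%:C = `|z|.
Proof. by rewrite /cmod normc_def. Qed.

Lemma cmod_sqrt z : cmod z = Num.sqrt (Re z ^+ 2 + Im z ^+ 2).
Proof. by rewrite /cmod normc_def. Qed.

Lemma cmod_ge0 z : 0 <= cmod z.
Proof. by rewrite cmod_sqrt sqrtr_ge0. Qed.

Lemma cmod_sqr z : cmod z ^+ 2 = Re z ^+ 2 + Im z ^+ 2.
Proof. by rewrite cmod_sqrt sqr_sqrtr// addr_ge0// sqr_ge0. Qed.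

Lemma cmodM z1 z2 : cmod (z1 * z2) = cmod z1 * cmod z2.
Proof. by apply/complexI; rewrite rmorphM/= !cmodE normrM. Qed.

Lemma cmodD z1 z2 : cmod (z1 + z2) <= cmod z1 + cmod z2.
Proof. by rewrite -lecR rmorphD/= !cmodE ler_normD. Qed.

Lemma cmodV z : cmod z^-1 = (cmod z)^-1.
Proof. by apply/complexI; rewrite fmorphV/= !cmodE normfV. Qed.

Lemma normRe_cmod z : `|Re z| <= cmod z.
Proof. by rewrite cmod_sqrt -sqrtr_sqr ler_wsqrtr// lerDl sqr_ge0. Qed.

Definition cis x : R[i] := cos x +i* sin x.

Lemma cis0 : cis 0 = 1.
Proof. by rewrite /cis cos0 sin0. Qed.

Lemma cisD x y : cis (x + y) = cis x * cis y.
Proof. by rewrite /cis cosD sinD; apply/eqP; rewrite eq_complex/= [X in _ && (_ == X)]addrC !eqxx. Qed.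

Lemma cmod_cis x : cmod (cis x) = 1.
Proof. by rewrite cmod_sqrt/= cos2Dsin2 sqrtr1. Qed.

Lemma cexp_i x : cexp ('i%C * x%:C) = cis x.
Proof.
by rewrite /cexp/cis /= !(mul0r, mulr0, subr0, mul1r, addr0, add0r) oppr0 expR0 mul1r.
Qed.

(** This is [2 |sin (x / 2)|], a periodic substitute for the distance from [x] to the multiples of
    [2 pi]. *)
Definition chord x : R := cmod (cis x - 1).

Lemma chord_ge0 x : 0 <= chord x.
Proof. exact: cmod_ge0. Qed.

Lemma chord_sqr x : chord x ^+ 2 = 2 - 2 * cos x.
Proof. by rewrite /chord cmod_sqr/= subr0; have := cos2Dsin2 x; lra. Qed.

Lemma chord_le2 x : chord x <= 2.
Proof.
rewrite -(@ler_pXn2r _ 2) ?nnegrE ?chord_ge0// chord_sqr.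
by have := cos_geN1 x; lra.
Qed.

(** By induction from [z^(n+1) - 1 = z (z^n - 1) + (z - 1)] with [|z| = 1]. *)
Lemma chord_natM n x : chord (n%:R * x) <= n%:R * chord x.
Proof.
elim: n => [|n ih]; first by rewrite !mul0r /chord cis0 subrr /cmod normr0.
rewrite -natr1 !mulrDl !mul1r.
have -> : chord (n%:R * x + x) = cmod (cis x * (cis (n%:R * x) - 1) + (cis x - 1)).
  by congr cmod; rewrite cisD; ring.
by apply: le_trans (cmodD _ _) _; rewrite cmodM cmod_cis mul1r lerD2r.
Qed.

(** The real part of [c * cis x]. Integrands thus stay real, while multiplying a mode by a complex
    number acts on the coefficient [c] alone. *)
Definition trig c x : R := Re c * cos x - Im c * sin x.

Lemma trigE c x : trig c x = Re (c * cis x).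
Proof. by case: c. Qed.

Lemma trig0 c : trig c 0 = Re c.
Proof. by rewrite /trig cos0 sin0; ring. Qed.

Lemma trig_norm c x : `|trig c x| <= cmod c.
Proof.
by rewrite trigE (le_trans (normRe_cmod _))// cmodM cmod_cis mulr1.
Qed.

Lemma trig_dist c x : `|trig c x - trig c 0| <= cmod c * chord x.
Proof.
rewrite !trigE -raddfB/= -mulrBr cis0 -cmodM; exact: normRe_cmod.
Qed.

Lemma trigB c1 c2 x : trig (c1 - c2) x = trig c1 x - trig c2 x.
Proof. by rewrite !trigE mulrBl raddfB. Qed.

Lemma continuous_trig c : continuous (trig c).
Proof.
move=> x; apply: cvgB; apply: cvgM; try exact: cvg_cst.
- exact: continuous_cos.
- exact: continuous_sin.
Qed.

Lemma bmfun_trig_scale c l : bmfun (fun y => trig c (l * y)).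
Proof.
apply: (@bmfunP _ _ _ _ (cmod c)) => [|y]; last exact: trig_norm.
apply: measurableT_comp; last exact: measurable_funM.
by apply: continuous_measurable_fun; exact: continuous_trig.
Qed.

End complex_trig.

Lemma Exp_eq_law d (T : measurableType d) d' (T' : measurableType d')
    (R : realType) (P : probability T R) (P' : probability T' R)
    (V : T -> R) (V' : T' -> R) (f : R -> R) :
  measurable_fun setT V -> measurable_fun setT V' -> bmfun f ->
  (forall B, measurable B -> P (V @^-1` B) = P' (V' @^-1` B)) ->
  \int[P]_w f (V w) = \int[P']_w f (V' w).
Proof.
move=> mV mV' bf eqV.
pose V1 : {RV P >-> R} := mfun_Sub (mem_set mV).
pose V2 : {RV P' >-> R} := mfun_Sub (mem_set mV').
have mf := bf.1.
have bfV1 : bmfun (fun w => f (V w)).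
  by split; [exact: measurableT_comp|case: bf.2 => N fN; exists N].
have bfV2 : bmfun (fun w => f (V' w)).
  by split; [exact: measurableT_comp|case: bf.2 => N fN; exists N].
transitivity (fine (\int[distribution P V1]_y (f y)%:E)).
  rewrite (integral_distribution (X := V1))//; first exact/measurable_EFinP.
  exact: (bmfun_integrable P bfV1).
transitivity (fine (\int[distribution P' V2]_y (f y)%:E)).
  by congr fine; apply: eq_measure_integral => B mB _; exact: eqV.
rewrite (integral_distribution (X := V2))//; first exact/measurable_EFinP.
exact: (bmfun_integrable P' bfV2).
Qed.

Lemma measurable_preimageT d (T : measurableType d) (R : realType) (f : T -> R)
  (B : set R) : measurable_fun setT f -> measurable B -> measurable (f @^-1` B).
Proof. by move=> mf mB; have := mf measurableT _ mB; rewrite setTI. Qed.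

(** * The Markov property in Fourier form *)

Section path_measurability.
Context {R : realType}.
Implicit Types (s t a : R) (U : pathspace R -> R).

(** The path space with the sigma-algebra of time [a], as a measurable space of its own: the general
    closure properties of measurable functions then apply to adapted functionals. *)
Definition filt a := g_sigma_algebraType (@events_on R [set s | s <= a]).
HB.instance Definition _ a := Measurable.on (filt a).

Lemma measurable_wrtP a U :
  measurable_wrt (natural_filtration a) U <->
  measurable_fun setT (U : filt a -> R).
Proof.
split=> [mU _ B mB|mU B mB]; first by rewrite setTI; exact: mU.
by have := mU measurableT _ mB; rewrite setTI.
Qed.

Lemma measurable_X s : 0 <= s -> measurable_fun setT (@X R s).
Proof.
move=> s0 _ B mB; rewrite setTI; apply: sub_sigma_algebra.
by exists s, B.
Qed.

Lemma measurable_X_filt s a : 0 <= s -> s <= a ->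
  measurable_fun setT (X s : filt a -> R).
Proof.
move=> s0 sa _ B mB; rewrite setTI; apply: sub_sigma_algebra.
by exists s, B.
Qed.

Lemma natural_filtration_sub a b : a <= b ->
  natural_filtration a `<=` @natural_filtration R b.
Proof.
move=> ab; apply: sub_sigma_algebra2 => A [s [B [sa s0 mB ->]]].
by exists s, B; split => //=; exact: le_trans ab.
Qed.

Lemma natural_filtration_measurable a A :
  natural_filtration a A -> measurable (A : set (pathspace R)).
Proof.
apply: sub_sigma_algebra2 => {}A [s [B [sa s0 mB ->]]].
by exists s, B.
Qed.

Lemma measurable_wrt_sub a b U : a <= b ->
  measurable_wrt (natural_filtration a) U ->
  measurable_wrt (natural_filtration b) U.
Proof. by move=> ab mU B mB; apply: (natural_filtration_sub ab); exact: mU. Qed.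

Lemma measurable_wrt_measurable a U :
  measurable_wrt (natural_filtration a) U -> measurable_fun setT U.
Proof.
move=> mU _ B mB; rewrite setTI; apply: (@natural_filtration_measurable a).
exact: mU.
Qed.

Lemma measurable_wrtM a U V : measurable_wrt (natural_filtration a) U ->
  measurable_wrt (natural_filtration a) V ->
  measurable_wrt (natural_filtration a) (fun w => U w * V w).
Proof.
move=> /measurable_wrtP mU /measurable_wrtP mV; apply/measurable_wrtP.
exact: measurable_funM.
Qed.

Lemma measurable_wrt_cst a (c : R) :
  measurable_wrt (natural_filtration a) (cst c).
Proof. by apply/measurable_wrtP; exact: measurable_cst. Qed.

Lemma measurable_wrt_X a s (f : R -> R) : 0 <= s -> s <= a ->
  measurable_fun setT f ->
  measurable_wrt (natural_filtration a) (fun w => f (X s w)).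
Proof.
move=> s0 sa mf; apply/measurable_wrtP; apply: measurableT_comp => //.
exact: measurable_X_filt.
Qed.

Lemma incr_translate (x r h : R) (B : set R) :
  [set w | ((fun w => X (r + h) w - @X R r w) @^-1` B) (translate x w)] =
  (fun w => X (r + h) w - @X R r w) @^-1` B.
Proof.
apply/funext => w; rewrite /preimage/= /X/=; congr (B _).
by rewrite opprD addrACA subrr add0r.
Qed.

Lemma natural_filtration_translate x a A : natural_filtration a A ->
  natural_filtration a [set w | A (translate x w)].
Proof.
have : measurable_fun setT (translate x : filt a -> filt a).
  apply: (@measurability _ _ _ (filt a) _ _ (@events_on R [set s | s <= a])) => //.
  move=> _ [_ [s [B [sa s0 mB ->]]] <-]; rewrite setTI.
  have /(_ measurableT B mB) : measurable_fun setT ((fun w => x + X s w) : filt a -> R).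
    by apply: measurable_funD => //; exact: measurable_X_filt.
  by rewrite setTI.
by move=> /(_ measurableT A) h /h; rewrite setTI.
Qed.

End path_measurability.

Section levy.
Context {R : realType} (P : R -> probability (pathspace R) R) (Psi : R -> R[i]).
Hypothesis levyP : levy_process P.
Hypothesis PsiE : characteristic_exponent (P 0) Psi.
Implicit Types (s t a h x r l : R) (U : pathspace R -> R).

Let measurable_incr (r h : R) : 0 <= r -> 0 <= h ->
  measurable_fun setT (fun w => @X R (r + h) w - X r w).
Proof.
by move=> r0 h0; apply: measurable_funB; apply: measurable_X => //; exact: addr_ge0.
Qed.

Let incr_law (x r h : R) (B : set R) : 0 <= r -> 0 <= h -> measurable B ->
  P x ((fun w => X (r + h) w - X r w) @^-1` B) = P 0 (X h @^-1` B).
Proof.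
move=> r0 h0 mB; have rh : r <= r + h by rewrite lerDl.
rewrite levyP.2; last exact: measurable_preimageT (measurable_incr r0 h0) mB.
rewrite (_ : [set w | _] = (fun w => X (r + h) w - @X R r w) @^-1` B) ?incr_translate//.
by rewrite (levy_stationary levyP.1)// addrC addKr.
Qed.

Let incr_indep (x r h : R) A (B : set R) : 0 <= r -> 0 <= h ->
  natural_filtration r A -> measurable B ->
  P x (A `&` ((fun w => X (r + h) w - X r w) @^-1` B)) =
  (P x A * P x ((fun w => (X (r + h) w - X r w)%R) @^-1` B))%E.
Proof.
move=> r0 h0 rA mB; have rh : r <= r + h by rewrite lerDl.
have mA := natural_filtration_measurable rA.
have mY := measurable_preimageT (measurable_incr r0 h0) mB.
rewrite (levyP.2 x _ mA) (levyP.2 x _ mY) (levyP.2 x _ (measurableI _ _ mA mY)).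
have eqY := incr_translate x r h B.
rewrite (_ : [set w | (A `&` _) _] = [set w | A (translate x w)] `&`
   [set w | B (X (r + h) w - X r w)]); last first.
  transitivity ([set w | A (translate x w)] `&`
    [set w | ((fun w => X (r + h) w - @X R r w) @^-1` B) (translate x w)]) => //.
  by rewrite eqY.
rewrite (levy_indep levyP.1)//; last exact: natural_filtration_translate.
by rewrite eqY.
Qed.

Let charE l h : 0 <= h ->
  \int[P 0]_w cos (l * X h w) = Re (cexp (- (h%:C * Psi l))) /\
  \int[P 0]_w sin (l * X h w) = Im (cexp (- (h%:C * Psi l))).
Proof.
move=> h0; rewrite -PsiE// /cexpectation /=.
by split; apply: eq_Rintegral => w _; rewrite !(mul0r, mulr0, mul1r, subr0, add0r, addr0) oppr0 expR0 mul1r.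
Qed.

Let bmfun_cos_scale l : bmfun (fun y : R => cos (l * y)).
Proof.
apply: (@bmfunP _ _ _ _ 1) => [|w]; last by rewrite ler_norml cos_geN1 cos_le1.
apply: measurableT_comp; last exact: measurable_funM.
by apply: continuous_measurable_fun; exact: continuous_cos.
Qed.

Let bmfun_sin_scale l : bmfun (fun y : R => sin (l * y)).
Proof.
apply: (@bmfunP _ _ _ _ 1) => [|w]; last by rewrite ler_norml sin_geN1 sin_le1.
apply: measurableT_comp; last exact: measurable_funM.
by apply: continuous_measurable_fun; exact: continuous_sin.
Qed.

Lemma bmfun_trig_X (c : R[i]) l r : 0 <= r -> bmfun (fun w => trig c (l * @X R r w)).
Proof.
move=> r0; split; last by exists (cmod c) => w; exact: trig_norm.
by apply: measurableT_comp (bmfun_trig_scale c l).1 (measurable_X r0).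
Qed.

(** The mode of frequency [l] is an eigenfunction of the semigroup: the increment after [r] is
    independent of the past, and its characteristic function multiplies the coefficient. This is the
    only form in which the Markov property is used. *)
Lemma trig_markov x (c : R[i]) l r h U : 0 <= r -> 0 <= h ->
  bmfun U -> measurable_wrt (natural_filtration r) U ->
  \int[P x]_w (U w * trig c (l * X (r + h) w)) =
  \int[P x]_w (U w * trig (c * cexp (- (h%:C * Psi l))) (l * X r w)).
Proof.
move=> r0 h0 bU mU.
pose Y w := X (r + h) w - @X R r w.
have mtrig c' : measurable_wrt (natural_filtration r) (fun w => trig c' (l * @X R r w)).
  apply: (@measurable_wrt_X _ _ _ (fun y => trig c' (l * y))) => //.
  exact: (bmfun_trig_scale c' l).1.
have bUt c' : bmfun (fun w => U w * trig c' (l * @X R r w)).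
  by apply: bmfunM => //; exact: bmfun_trig_X.
have indE c' f : bmfun f ->
  \int[P x]_w (U w * trig c' (l * X r w) * f (Y w)) =
  (\int[P x]_w (U w * trig c' (l * X r w))) * \int[P 0]_w f (X h w).
  move=> bf; rewrite (Exp_indep _ (measurable_incr r0 h0) bf)//; last first.
    move=> A B mA mB; apply: incr_indep => //.
    exact: (measurable_wrtM mU (mtrig c')).
  congr (_ * _); apply: Exp_eq_law => //; first exact: measurable_incr.
    exact: measurable_X.
  by move=> B mB; exact: incr_law.
have bf (f : R -> R) : bmfun f -> bmfun (fun w => f (Y w)).
  move=> [mf [M fM]]; apply: (@bmfunP _ _ _ _ M) => //.
  by apply: measurableT_comp => //; exact: measurable_incr.
(* The addition formula for the angle [l * X r w + l * Y w]; the coefficient [- 'i%C * c] turns the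
   real part of [c * cis] into its imaginary part. *)
transitivity (\int[P x]_w (U w * trig c (l * X r w) * cos (l * Y w)
    - U w * trig (- 'i%C * c) (l * X r w) * sin (l * Y w))).
  apply: eq_Rintegral => w _.
  rewrite -!mulrA -mulrBr; congr (_ * _).
  have -> : l * X (r + h) w = l * X r w + l * Y w by rewrite -mulrDr /Y addrCA subrr addr0.
  by case: c => a b; rewrite /trig/= cosD sinD; ring.
have bfc := bf _ (bmfun_cos_scale l); have bfs := bf _ (bmfun_sin_scale l).
rewrite ExpB; [|exact: bmfunM|exact: bmfunM].
rewrite (indE c (fun y => cos (l * y)))// (indE _ (fun y => sin (l * y)))//.
have [-> ->] := charE l h0.
rewrite ![(\int[P x]_w _) * _]mulrC -!ExpZ// -ExpB; try exact: bmfunZ.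
apply: eq_Rintegral => w _.
by case: c (cexp _) => a b [a' b']; rewrite /trig/=; ring.
Qed.

End levy.

(** * The characteristic exponent on the dual lattice *)

Section exponent.
Context {R : realType} (P : R -> probability (pathspace R) R) (Psi : R -> R[i]).
Hypothesis levyP : levy_process P.
Hypothesis PsiE : characteristic_exponent (P 0) Psi.
Implicit Types (s t a h x r l : R).

Lemma Exp_trig_X (c : R[i]) l t : 0 <= t ->
  \int[P 0]_w trig c (l * X t w) = Re (c * cexp (- (t%:C * Psi l))).
Proof.
move=> t0; have := @trig_markov _ P Psi levyP PsiE 0 c l 0 t (cst 1) (lexx 0) t0.
move=> /(_ (bmfun_cst _) (@measurable_wrt_cst _ _ _)).
under eq_Rintegral do rewrite /= mul1r add0r.
move=> ->; under eq_Rintegral do rewrite /= mul1r.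
have mX0 : measurable [set w | @X R 0 w = 0].
  exact: (measurable_preimageT (measurable_X (lexx 0)) (measurable_set1 0)).
rewrite (@Rintegral_eq_off_null _ _ _ _ (~` [set w | @X R 0 w = 0]) _
  (fun=> Re (c * cexp (- (t%:C * Psi l)))))//; first exact: Exp_cst.
- exact: measurableC.
- by apply: (etrans (probability_setC (P 0) mX0)); rewrite (levy_start levyP.1) subee.
- by move=> w /contrapT /= ->; rewrite mulr0 trig0.
Qed.

(** A characteristic function has modulus at most 1. Testing its value [z] at time 1 against the
    coefficient [conjc z] gives [|z|^2 <= |z|], and [|z| = exp (- Re (Psi l))]. *)
Lemma Psi_ge0 l : 0 <= Re (Psi l).
Proof.
set z := cexp (- (1%:C * Psi l)).
have : Re (conjc z * z) <= cmod (conjc z).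
  rewrite -Exp_trig_X//; apply: le_trans (ler_norm _) _.
  by apply: Exp_norm_le; [exact: bmfun_trig_X|move=> w; exact: trig_norm].
have -> : Re (conjc z * z) = cmod (conjc z) ^+ 2.
  by rewrite cmod_sqr; case: (z) => a b /=; ring.
have cmE : cmod (conjc z) = expR (- Re (Psi l)).
  rewrite cmod_sqrt /z /cexp; case: (Psi l) => a b /=.
  rewrite !(mul0r, mul1r, subr0, addr0).
  rewrite -[RHS]ger0_norm ?expR_ge0// -sqrtr_sqr; congr Num.sqrt.
  have := cos2Dsin2 (- b); set C := cos _; set S := sin _ => h.
  by rewrite sqrrN !exprMn -mulrDr h mulr1.
rewrite cmE expr2 ger_pMr ?expR_gt0// => h.
by rewrite -oppr_le0 -(@ler_expR R) expR0.
Qed.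

Lemma cmod_cexp (z : R[i]) : 0 <= Re z -> cmod (cexp (- z)) <= 1.
Proof.
case: z => a b /= a0; rewrite /cexp cmodM /= cmod_cis mulr1.
by rewrite cmod_sqrt/= expr0n addr0 sqrtr_sqr ger0_norm ?expR_ge0// expR_le1 oppr_le0.
Qed.

Lemma cos_scale_ge1 (b : R) : (forall t, 0 <= t -> 1 <= cos (t * b)) -> b = 0.
Proof.
move=> h; apply/eqP; apply: contraT => b0.
have := h (pi / `|b|) (divr_ge0 (pi_ge0 _) (normr_ge0 _)).
rewrite -cos_norm !normrM normfV normr_id (ger0_norm (pi_ge0 _)) divfK ?normr_eq0//.
by rewrite cospi; lra.
Qed.

(** The exponential is not injective, but equality at all scales [t] determines the exponent: the
    moduli at [t = 1] give the real parts, and then [cos (t * (b1 - b2)) = 1] for every [t] gives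
    the imaginary parts. *)
Lemma cexp_scale_inj (z1 z2 : R[i]) :
  (forall t, 0 <= t -> cexp (- (t%:C * z1)) = cexp (- (t%:C * z2))) -> z1 = z2.
Proof.
case: z1 z2 => [a1 b1] [a2 b2] h.
have e t : 0 <= t ->
    expR (- (t * a1)) * cos (t * b1) = expR (- (t * a2)) * cos (t * b2) /\
    expR (- (t * a1)) * sin (t * b1) = expR (- (t * a2)) * sin (t * b2).
  move=> t0; have /eqP := h t t0; rewrite eq_complex /cexp /=.
  rewrite !(mul0r, subr0, addr0) !cosN !sinN !mulrN => /andP[/eqP -> /eqP /oppr_inj ->].
  by split.
have E t : 0 <= t -> expR (- (t * a1)) = expR (- (t * a2)).
  move=> t0; have [e1 e2] := e t t0.
  apply/eqP; rewrite -(@eqrXn2 _ 2)//= ?expR_ge0//; apply/eqP.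
  rewrite -[LHS]mulr1 -[RHS]mulr1 -{1}(cos2Dsin2 (t * b1)) -(cos2Dsin2 (t * b2)).
  by rewrite !mulrDr -!exprMn e1 e2.
have a12 : a1 = a2.
  by have := E 1 ler01; rewrite !mul1r => /expR_inj/oppr_inj.
have b12 : b1 - b2 = 0.
  apply: cos_scale_ge1 => t t0; have [] := e t t0.
  have e0 : expR (- (t * a2)) != 0 by rewrite gt_eqF ?expR_gt0.
  rewrite a12 => /(mulfI e0) c /(mulfI e0) s.
  rewrite mulrBr cosB c s -!expr2 cos2Dsin2 lexx//.
by rewrite a12; congr (_ +i* _); apply/eqP; rewrite -subr_eq0 b12.
Qed.

Lemma Re_mul_inj (z1 z2 : R[i]) : (forall c, Re (c * z1) = Re (c * z2)) -> z1 = z2.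
Proof.
case: z1 z2 => [a1 b1] [a2 b2] h; congr (_ +i* _).
  by have := h 1; rewrite !mul1r.
by have := h (0 +i* (- 1)); rewrite /= !mul0r !sub0r !mulN1r !opprK.
Qed.

(** As [X t] is real, reversing the frequency conjugates the characteristic function;
    [cexp_scale_inj] transfers this to the exponent. *)
Lemma PsiN l : Psi (- l) = conjc (Psi l).
Proof.
apply: cexp_scale_inj => t t0; apply: Re_mul_inj => c; rewrite -Exp_trig_X//.
transitivity (\int[P 0]_w trig (conjc c) (l * X t w)).
  by apply: eq_Rintegral => w _; rewrite mulNr /trig cosN sinN; case: c => a b /=; ring.
rewrite Exp_trig_X//; case: c (Psi l) => a b [a' b']; rewrite /cexp/=.
by rewrite !(mul0r, subr0, addr0) !mulrN !sinN !cosN; ring.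
Qed.

(** The inequality [1 - cos (k y) <= k^2 (1 - cos y)], which is [chord_natM] squared, is integrated
    at [y = l * X t]. Its right side has mean 0, so the real part of [exp (- t Psi (k l))] is at
    least 1 for every [t], which forces the exponent to vanish. *)
Lemma Psi_natM_eq0 l k : Psi l = 0 -> Psi (k%:R * l) = 0.
Proof.
move=> Pl.
have hE t : 0 <= t -> 1 <= Re (cexp (- (t%:C * Psi (k%:R * l)))).
  move=> t0; rewrite -[X in Re X]mul1r -Exp_trig_X//.
  have E1 : \int[P 0]_w (1 - k%:R ^+ 2 * (1 - trig 1 (l * X t w))) = 1 :> R.
    rewrite ExpB ?Exp_cst ?ExpZ//; last 3 first.
    - by apply: bmfunB; [exact: bmfun_cst|exact: bmfun_trig_X].
    - exact: bmfun_cst.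
    - by apply: bmfunZ; apply: bmfunB; [exact: bmfun_cst|exact: bmfun_trig_X].
    rewrite ExpB ?Exp_cst ?Exp_trig_X//; last 2 first.
    - exact: bmfun_cst.
    - exact: bmfun_trig_X.
    by rewrite Pl mulr0 oppr0 /cexp/= expR0 cos0 sin0; ring.
  rewrite -[leLHS]E1; apply: le_Exp.
  - apply: bmfunB; first exact: bmfun_cst.
    by apply: bmfunZ; apply: bmfunB; [exact: bmfun_cst|exact: bmfun_trig_X].
  - exact: bmfun_trig_X.
  move=> w; have := chord_natM k (l * X t w).
  rewrite -(@ler_pXn2r _ 2) ?nnegrE ?mulr_ge0 ?chord_ge0//.
  rewrite exprMn !chord_sqr /trig/= !mul0r !mul1r !subr0 => h.
  rewrite -mulrA; move: (cos _) (cos _) (k%:R ^+ 2) h => c1 c2 a h; lra.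
have a0 := Psi_ge0 (k%:R * l).
move: hE a0; case: (Psi (k%:R * l)) => a b /= hE a0.
have {}hE t : 0 <= t -> 1 <= expR (- (t * a)) * cos (t * b).
  by move=> /hE; rewrite !(mul0r, subr0, addr0) cosN.
have b0 : b = 0.
  apply: cos_scale_ge1 => t t0; have := hE t t0.
  have : expR (- (t * a)) <= 1 by rewrite expR_le1 oppr_le0 mulr_ge0.
  have := expR_gt0 (- (t * a)).
  by have := cos_le1 (t * b); nra.
have := hE 1 ler01; rewrite b0 mulr0 cos0 mulr1 mul1r => h.
have {}h : a <= 0 by rewrite -oppr_ge0 -(@ler_expR R) expR0.
by congr (_ +i* _); apply/eqP; rewrite eq_le h a0.
Qed.

Variable L : R.
Hypothesis sumL : lattice_summable L Psi.

Definition lam (n : nat) : R := dual_point L n%:Z.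
Definition psi_ (n : nat) : R[i] := Psi (lam n).

Lemma lamE n : lam n = n%:R * lam 1.
Proof. by rewrite /lam /dual_point -!pmulrn; ring. Qed.

Lemma summable_resolvent : cvgn (series (fun n => cmod (1 + psi_ n)^-1)).
Proof.
have /(_ 1 ltr01) h := sumL.
have h2 : summable [set: nat] (fun n => (cmod (1 + psi_ n)^-1)%:E).
  apply: le_lt_trans h.
  pose f (n : int) := (cmod (1%:C + Psi (dual_point L n))^-1)%:E.
  have f0 n : (0 <= f n)%E by rewrite lee_fin cmod_ge0.
  rewrite [leRHS](_ : _ = (\esum_(i in setT) f i)%E)//.
  rewrite (@esumID _ _ (range Posz) setT f)//.
  rewrite setTI esum_image; last by move=> a b _ _ [].
apply: (@le_trans _ _ (\esum_(i in [set: nat]) f i%:Z)%E).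
    by apply: le_esum => n _; rewrite gee0_abs// lee_fin cmod_ge0.
  by rewrite leeDl// esum_ge0.
rewrite -set_true in h2; have := summable_cvg (P := xpredT) _ h2; apply=> n _.
by rewrite lee_fin cmod_ge0.
Qed.

Lemma psi0 : psi_ 0 = 0.
Proof.
apply: cexp_scale_inj => t t0; apply: Re_mul_inj => c; rewrite -Exp_trig_X//.
transitivity (\int[P 0]_w Re c).
  by apply: eq_Rintegral => w _; rewrite lamE !mul0r trig0.
by rewrite Exp_cst mulr0 oppr0 /cexp/= expR0 cos0 sin0; case: c => a b /=; ring.
Qed.

(* A zero of [Psi] would be shared by its multiples, against summability. *)
Lemma psi_neq0 n : (0 < n)%N -> psi_ n != 0.
Proof.
move=> n0; apply/eqP => psin0.
have h k : psi_ (k * n) = 0.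
  by rewrite /psi_ lamE natrM -mulrA -lamE; exact: Psi_natM_eq0.
have /cvgrPdist_lt/(_ 1 ltr01)[N _ hN] := cvg_series_cvg_0 summable_resolvent.
have := hN (N * n)%N; rewrite /= leq_pmulr// => /(_ isT).
by rewrite h addr0 sub0r normrN invr1 /cmod normr1 normr1 ltxx.
Qed.

(** The terms [1 / |1 + psi_ n|] tend to 0, so [|1 + psi_ n| > 2] from some rank on; there [|psi_ n|
    >= |1 + psi_ n| - 1 >= |1 + psi_ n| / 2]. The finitely many other terms, including the rank 0
    with its inverse of 0, do not affect convergence. *)
Lemma summable_psiV : cvgn (series (fun n => cmod (psi_ n)^-1)).
Proof.
have cv := summable_resolvent.
have /cvgrPdist_lt/(_ 2^-1) h0 := cvg_series_cvg_0 cv.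
have {h0} [|N _ hN] := h0; first by rewrite invr_gt0.
rewrite -(is_cvg_series_restrict N).
have : cvgn (fun n => 2 * series (fun n => cmod (1 + psi_ n)^-1) n).
  by apply: is_cvgM => //; exact: is_cvg_cst.
rewrite (_ : (fun n => _) = series (fun n => 2 * cmod (1 + psi_ n)^-1)); last first.
  by apply/funext => n; rewrite /series/= mulr_sumr.
rewrite -(is_cvg_series_restrict N) => c2.
have le_ n : (N <= n)%N -> cmod (psi_ n)^-1 <= 2 * cmod (1 + psi_ n)^-1.
  move=> /hN /=; rewrite sub0r normrN ger0_norm ?cmod_ge0// !cmodV => lt2.
  have h1 : 0 < (cmod (1 + psi_ n))^-1 \/ cmod (1 + psi_ n) = 0.
    have := cmod_ge0 (1 + psi_ n); rewrite le_eqVlt => /predU1P[<-|]; first by right.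
    by left; rewrite invr_gt0.
  have h2 : cmod (1 + psi_ n) <= 1 + cmod (psi_ n).
    by apply: le_trans (cmodD _ _) _; rewrite /cmod normr1.
  have h3 := Psi_ge0 (lam n).
  have h4 : 1 <= cmod (1 + psi_ n).
    apply: le_trans (normRe_cmod _); rewrite raddfD/=.
    by apply: le_trans (ler_norm _); rewrite lerDl.
  have h5 : 2 < cmod (1 + psi_ n).
    by rewrite -ltf_pV2 ?posrE//; exact: lt_le_trans h4.
  rewrite -[X in X * _]invrK -invfM lef_pV2 ?posrE; lra.
have h2 n : \sum_(N <= k < n) cmod (psi_ k)^-1 <= \sum_(N <= k < n) (2 * cmod (1 + psi_ k)^-1).
  by apply: ler_sum_nat => k /andP[Nk _]; exact: le_.
apply: nondecreasing_is_cvgn.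
  apply/nondecreasing_seqP => n /=; have [Nn|nN] := leqP N n.
    by rewrite (big_nat_recr n N _ Nn)/= lerDl cmod_ge0.
  by rewrite !big_geq// ltnW.
exists (limn [sequence \sum_(N <= k < n) (2 * cmod (1 + psi_ k)^-1)]_n).
move=> _ [n _ <-]; apply: le_trans (h2 n) _; apply: nondecreasing_cvgn_le => //.
apply/nondecreasing_seqP => m /=; have [Nm|mN] := leqP N m.
  by rewrite (big_nat_recr m N _ Nm)/= lerDl mulr_ge0 ?cmod_ge0.
by rewrite !big_geq// ltnW.
Qed.

End exponent.

Lemma difference_quotient_cvg (R : realType) (f : R -> R) (l : R) (h_ : R ^nat) :
  is_derive (0 : R) 1 f l -> (forall k, 0 < h_ k) -> h_ k @[k --> \oo] --> 0 ->
  (f (h_ k) - f 0) / h_ k @[k --> \oo] --> l.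
Proof.
move=> [df dfl] h0 hk0.
have : h^-1 *: ((f \o shift 0) (h *: 1) - f 0) @[h --> 0^'] --> l.
  by rewrite -dfl; exact: df.
move=> /cvgr_dnbhsP/(_ h_) H; apply: cvg_trans (H _); last first.
  by split => // k; rewrite gt_eqF.
apply: near_eq_cvg; apply: nearW => k /=.
by rewrite /GRing.scale/= mulr1 addr0 mulrC.
Qed.

Lemma cmod_le_ReIm (R : realType) (z : R[i]) : cmod z <= `|Re z| + `|Im z|.
Proof.
rewrite -(@ler_pXn2r _ 2) ?nnegrE ?cmod_ge0 ?addr_ge0// cmod_sqr.
have := normr_ge0 (Re z); have := normr_ge0 (Im z).
by rewrite -(real_normK (num_real (Re z))) -(real_normK (num_real (Im z))); nra.
Qed.

(** * The resolvent of the circle process *)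

Section circle_resolvent.
Context {R : realType} (psi : nat -> R[i]).
Hypothesis psi0 : psi 0 = 0.
Hypothesis psi_ge0 : forall n, 0 <= Re (psi n).
Hypothesis psi_neq0 : forall n, (0 < n)%N -> psi n != 0.
Hypothesis summable_psi : cvgn (series (fun n => cmod (psi n)^-1)).
Implicit Types (q h th y d : R) (n N : nat).

(* The terms of index [n] and [-n] of a sum over the integers are paired. *)
Definition om n : R := if n is 0 then 1 else 2.
Definition rho q n : R[i] := (q%:C + psi n)^-1.
(* The [q]-resolvent density of the process on the circle, up to a constant. *)
Definition circ_res q th : R := tsum (fun n => om n * trig (rho q n) (n%:R * th)).
(** The function of the theorem in the angle variable, as a real series over the naturals. The term
    of rank 0 vanishes whatever its coefficient, since the angle is then 0. *)
Definition phi0 th : R :=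
  tsum (fun n => om n * (Re (psi n)^-1 - trig (psi n)^-1 (n%:R * th))).

Lemma om_ge0 n : 0 <= om n. Proof. by case: n. Qed.

Lemma om_le2 n : om n <= 2. Proof. by case: n => [|n] /=; lra. Qed.

(** The rank 0 is singled out because [rho q 0] is [1/q], whereas [(psi 0)^-1] is 0 by convention.
    At the other ranks [|q + psi n| >= |psi n|] because the real part of [psi n] is nonnegative; 2
    bounds the weight [om]. *)
Definition majorant q n : R := 2 * ((n == 0)%:R * q^-1 + cmod (psi n)^-1).

Lemma majorant_ge0 q n : 0 < q -> 0 <= majorant q n.
Proof.
by move=> q0; rewrite mulr_ge0// addr_ge0 ?cmod_ge0// mulr_ge0// invr_ge0 ltW.
Qed.

Lemma summable_majorant q : cvgn (series (majorant q)).
Proof.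
have c1 : cvgn (series (fun n => (n == 0)%:R * q^-1)).
  rewrite -(is_cvg_series_restrict 1); apply/cvg_ex; exists 0.
  rewrite [X in X @ _](_ : _ = fun=> 0); first exact: cvg_cst.
  apply/funext => n /=; rewrite big_nat big1//= => -[|i] //= _.
  by rewrite mul0r.
rewrite (_ : majorant q = 2 *: ((fun n => (n == 0)%:R * q^-1) + (fun n => cmod (psi n)^-1))).
  by apply: is_cvg_seriesZ; exact: is_cvg_seriesD.
by apply/funext => n.
Qed.

Lemma cmod_addr_ge q n : 0 <= q -> cmod (psi n) <= cmod (q%:C + psi n).
Proof.
move=> q0; rewrite -(@ler_pXn2r _ 2) ?nnegrE ?cmod_ge0// !cmod_sqr.
case: (psi n) (psi_ge0 n) => a b /= a0; rewrite add0r lerD2r.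
by rewrite ler_sqr ?nnegrE ?addr_ge0// lerDr.
Qed.

Lemma cmod_gt0 (z : R[i]) : (0 < cmod z) = (z != 0).
Proof.
by rewrite lt_neqAle cmod_ge0 andbT eq_sym -(inj_eq (@complexI R)) cmodE normr_eq0.
Qed.

Lemma cmod_rho q n : 0 < q -> cmod (rho q n) <= (n == 0)%:R * q^-1 + cmod (psi n)^-1.
Proof.
move=> q0; rewrite /rho; case: n => [|n].
  by rewrite psi0 addr0 invr0 cmodV {2}/cmod normr0 addr0 mul1r
    cmod_sqrt/= expr0n addr0 sqrtr_sqr gtr0_norm.
rewrite mul0r add0r !cmodV lef_pV2 ?posrE; first exact/cmod_addr_ge/ltW.
  by rewrite (lt_le_trans _ (cmod_addr_ge _ (ltW q0)))// cmod_gt0 psi_neq0.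
by rewrite cmod_gt0 psi_neq0.
Qed.

Lemma om_cmod_rho q n : 0 < q -> om n * cmod (rho q n) <= majorant q n.
Proof.
move=> q0; apply: ler_pM; [exact: om_ge0|exact: cmod_ge0|exact: om_le2|].
exact: cmod_rho.
Qed.

Lemma circ_res_term q n th : 0 < q ->
  `|om n * trig (rho q n) (n%:R * th)| <= majorant q n.
Proof.
move=> q0; apply: le_trans (om_cmod_rho n q0).
by rewrite normrM (ger0_norm (om_ge0 n)) ler_wpM2l ?om_ge0// trig_norm.
Qed.

Lemma circ_res_bounded q th : 0 < q -> `|circ_res q th| <= tsum (majorant q).
Proof.
move=> q0; apply: tsum_norm_le => [|n]; first exact: summable_majorant.
exact: circ_res_term.
Qed.

Lemma circ_res_cvg q (y : R ^nat) th : 0 < q -> y k @[k --> \oo] --> th ->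
  circ_res q (y k) @[k --> \oo] --> circ_res q th.
Proof.
move=> q0 yth; rewrite /circ_res; apply: (tannery (@summable_majorant q)) => [k n|n].
  exact: circ_res_term.
apply: cvgM; first exact: cvg_cst.
apply: (@cvg_comp _ _ _ (fun k => n%:R * y k) (trig (rho q n)) _ (nbhs (n%:R * th))); last exact: continuous_trig.
by apply: cvgM => //; exact: cvg_cst.
Qed.

Lemma Re_rho_ge0 q n : 0 < q -> 0 <= Re (rho q n).
Proof.
rewrite /rho; case: (psi n) (psi_ge0 n) => a b /= a0 q0.
by rewrite divr_ge0 ?addr_ge0 ?sqr_ge0// ?ltW.
Qed.

(** At angle 0 every term is nonnegative, as [Re (rho q n) >= 0], and the term of rank 0 is [1/q].
    Positivity allows this factor to be cancelled from a quotient later. *)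
Lemma circ_res0_gt0 q : 0 < q -> 0 < circ_res q 0.
Proof.
move=> q0; apply: (@lt_le_trans _ _ (series (fun n => om n * trig (rho q n) (n%:R * 0)) 1)).
  rewrite /series/= big_nat1 mul1r mulr0 trig0 /rho psi0 addr0 /=.
  by rewrite divr_gt0// expr0n addr0 exprn_gt0.
rewrite /circ_res /tsum; set f := fun n => _.
apply: (@nondecreasing_cvgn_le _ (series f)).
  apply/nondecreasing_seqP => n; rewrite /series/= big_nat_recr//= lerDl.
  by rewrite /f mulr0 trig0 mulr_ge0 ?om_ge0 ?Re_rho_ge0.
apply: (cvg_series_dominated (@summable_majorant q)) => n.
exact: circ_res_term.
Qed.

Definition phi_res q th : R := circ_res q 0 - circ_res q th.

Lemma phi_resE q th : 0 < q -> phi_res q th =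
  tsum (fun n => om n * (Re (rho q n) - trig (rho q n) (n%:R * th))).
Proof.
move=> q0; rewrite /phi_res /circ_res /tsum -lim_seriesB.
- congr (limn (series _)); apply/funext => n.
  rewrite [LHS](_ : _ = om n * trig (rho q n) (n%:R * 0) -
    om n * trig (rho q n) (n%:R * th))//.
  by rewrite mulr0 trig0 [RHS]mulrBr.
- apply: (cvg_series_dominated (@summable_majorant q)) => n; exact: circ_res_term.
- apply: (cvg_series_dominated (@summable_majorant q)) => n; exact: circ_res_term.
Qed.

(** Unlike [majorant], free of [q]: the rank 0 cancels in the difference and takes [1/q] with it.
    The constant is the weight 2 times the two terms of the difference. *)
Definition phi_majorant n : R := 4 * cmod (psi n)^-1.

Lemma summable_phi_majorant : cvgn (series phi_majorant).
Proof.
have -> : phi_majorant = 4 *: (fun n => cmod (psi n)^-1) by apply/funext.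
exact: is_cvg_seriesZ.
Qed.

Lemma phi0_term (c : R[i]) n th : cmod c <= cmod (psi n)^-1 ->
  `|om n * (Re c - trig c (n%:R * th))| <= phi_majorant n.
Proof.
move=> h; rewrite normrM (ger0_norm (om_ge0 n)).
have -> : phi_majorant n = 2 * (cmod (psi n)^-1 + cmod (psi n)^-1).
  by rewrite /phi_majorant; ring.
apply: ler_pM => //; [exact: om_ge0|exact: om_le2|].
apply: le_trans (ler_normB _ _) _; apply: lerD.
  exact: le_trans (normRe_cmod _) h.
exact: le_trans (trig_norm _ _) h.
Qed.

Let phi_res_term q n th : 0 < q ->
  `|om n * (Re (rho q n) - trig (rho q n) (n%:R * th))| <= phi_majorant n.
Proof.
move=> q0; case: n => [|n].
  by rewrite mul0r trig0 subrr mulr0 normr0 mulr_ge0 ?cmod_ge0.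
by apply: phi0_term; have := cmod_rho n.+1 q0; rewrite mul0r add0r.
Qed.

Lemma phi_res_bounded q th : 0 < q -> `|phi_res q th| <= tsum phi_majorant.
Proof.
move=> q0; rewrite phi_resE//; apply: tsum_norm_le => [|n].
  exact: summable_phi_majorant.
exact: phi_res_term.
Qed.

Lemma phi0_bounded th : `|phi0 th| <= tsum phi_majorant.
Proof.
apply: tsum_norm_le => [|n]; first exact: summable_phi_majorant.
exact: phi0_term.
Qed.

Let rho_cvg (q_ : R ^nat) n : (0 < n)%N -> q_ k @[k --> \oo] --> 0 ->
  Re (rho (q_ k) n) @[k --> \oo] --> Re (psi n)^-1 /\
  Im (rho (q_ k) n) @[k --> \oo] --> Im (psi n)^-1.
Proof.
move=> /psi_neq0; rewrite /rho; case: (psi n) => a b ab0 qk0.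
have D0 : a ^+ 2 + b ^+ 2 != 0.
  apply: contra ab0; rewrite paddr_eq0 ?sqr_ge0// !sqrf_eq0 => /andP[/eqP -> /eqP ->].
  by [].
have ca : q_ k + a @[k --> \oo] --> a.
  by rewrite -[X in _ --> X]add0r; apply: cvgD => //; exact: cvg_cst.
have cD : ((q_ k + a) ^+ 2 + (0 + b) ^+ 2)^-1 @[k --> \oo] --> (a ^+ 2 + b ^+ 2)^-1.
  apply: cvgV => //; apply: cvgD; last by rewrite add0r; exact: cvg_cst.
  by apply: cvgM.
split => /=; first exact: cvgM.
by rewrite -mulNr; under eq_fun do rewrite -mulNr add0r; under eq_fun do rewrite -{2}[b]add0r; apply: cvgM => //; exact: cvg_cst.
Qed.

Lemma phi_res_cvg (q_ : R ^nat) th : (forall k, 0 < q_ k) ->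
  q_ k @[k --> \oo] --> 0 -> phi_res (q_ k) th @[k --> \oo] --> phi0 th.
Proof.
move=> q0 qk0; under eq_fun do rewrite phi_resE//.
apply: (tannery summable_phi_majorant) => [k n|n]; first exact: phi_res_term.
apply: cvgM; first exact: cvg_cst.
case: n => [|n].
  rewrite mul0r trig0 subrr; under eq_fun do rewrite trig0 subrr.
  exact: cvg_cst.
have [cr ci] := rho_cvg (ltn0Sn n) qk0.
by apply: cvgB => //; apply: cvgB; apply: cvgM => //; exact: cvg_cst.
Qed.

Definition fejer_weight N n : R := 1 - n%:R / N%:R.

Lemma fejer_weight_itv N n : (n < N)%N -> 0 <= fejer_weight N n <= 1.
Proof.
move=> nN; have N0 : 0 < N%:R :> R by rewrite ltr0n (leq_trans _ nN).
by rewrite /fejer_weight subr_ge0 ler_pdivrMr// mul1r ler_nat ltnW//= gerBl divr_ge0.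
Qed.

(** The Fejer mean of order [N] of [circ_res q]: a trigonometric polynomial, to which [trig_markov]
    applies mode by mode. *)
Definition smooth_res q N th : R :=
  \sum_(n < N) om n * fejer_weight N n * trig (rho q n) (n%:R * th).

(** The Fejer mean as a series padded by zeros, so that dominated convergence of series applies when
    [N] grows. *)
Let smooth_term q N th n : R :=
  if (n < N)%N then om n * fejer_weight N n * trig (rho q n) (n%:R * th) else 0.

Let smooth_termE q N th K : (N <= K)%N ->
  series (smooth_term q N th) K = smooth_res q N th.
Proof.
move=> NK; rewrite /series/= (big_cat_nat _ NK)//= [X in _ + X]big_nat.
rewrite [X in _ + X]big1 ?addr0; last by move=> i /andP[Ni _]; rewrite /smooth_term ltnNge Ni.
by rewrite big_mkord; apply: eq_bigr => i _; rewrite /smooth_term ltn_ord.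
Qed.

Let smooth_tsum q N th : tsum (smooth_term q N th) = smooth_res q N th.
Proof.
apply: cvg_lim => //; apply: cvg_near_cst; near=> K.
by apply: smooth_termE; near: K; exists N.
Unshelve. all: by end_near. Qed.

Let smooth_term_le q N th n : 0 < q -> `|smooth_term q N th n| <= majorant q n.
Proof.
move=> q0; rewrite /smooth_term; case: ifPn => nN; last first.
  by rewrite normr0 majorant_ge0.
apply: le_trans (circ_res_term n th q0).
have /andP[f0 f1] := fejer_weight_itv nN.
rewrite mulrAC normrM (ger0_norm f0) ler_piMr//.
Qed.

Lemma smooth_res_bounded q N th : 0 < q -> `|smooth_res q N th| <= tsum (majorant q).
Proof.
move=> q0; rewrite -smooth_tsum; apply: tsum_norm_le => [|n].
  exact: summable_majorant.
exact: smooth_term_le.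
Qed.

Lemma smooth_res_cvg q th : 0 < q ->
  smooth_res q N th @[N --> \oo] --> circ_res q th.
Proof.
move=> q0; under eq_fun do rewrite -smooth_tsum.
apply: (tannery (@summable_majorant q)) => [k n|n]; first exact: smooth_term_le.
have : om n * fejer_weight N n * trig (rho q n) (n%:R * th) @[N --> \oo] -->
    om n * 1 * trig (rho q n) (n%:R * th).
  apply: cvgM; last exact: cvg_cst; apply: cvgM; first exact: cvg_cst.
  rewrite -[X in _ --> X]subr0; apply: cvgB; first exact: cvg_cst.
  rewrite -[X in _ --> X](mulr0 (n%:R : R)); apply: cvgM; first exact: cvg_cst.
  by apply/gtr0_cvgV0; [near=> N; rewrite ltr0n; near: N; exists 1%N|exact: cvgr_idn].
rewrite mulr1; apply: cvg_trans; apply: near_eq_cvg; near=> N.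
rewrite /smooth_term ifT//; near: N; by exists n.+1.
Unshelve. all: by end_near. Qed.

(** Controls the oscillation of all the Fejer means within chord [d] of angle 0, uniformly in [N]:
    the mode of rank [n] moves by at most [|rho q n| * chord (n th)], and that chord is below both 2
    and [n * d]. *)
Definition modulus q d : R := tsum (fun n => om n * cmod (rho q n) * Num.min 2 (n%:R * d)).

Let modulus_term q d n : 0 < q -> 0 <= d ->
  `|om n * cmod (rho q n) * Num.min 2 (n%:R * d)| <= 2 * majorant q n.
Proof.
move=> q0 d0; rewrite mulrC normrM ler_pM//.
  by rewrite ger0_norm ?ge_min ?lexx// le_min mulr_ge0// andbT.
by rewrite ger0_norm ?om_cmod_rho// mulr_ge0 ?om_ge0 ?cmod_ge0.
Qed.

Let summable_2majorant q : cvgn (series (fun n => 2 * majorant q n)).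
Proof.
rewrite (_ : (fun n => _) = 2 *: majorant q); last by apply/funext.
by apply: is_cvg_seriesZ; exact: summable_majorant.
Qed.

Lemma smooth_res_modulus q N th d : 0 < q -> chord th <= d ->
  `|smooth_res q N th - smooth_res q N 0| <= modulus q d.
Proof.
move=> q0 thd; have d0 : 0 <= d := le_trans (chord_ge0 _) thd.
rewrite /smooth_res -sumrB.
apply: (@le_trans _ _ (series (fun n => om n * cmod (rho q n) * Num.min 2 (n%:R * d)) N)).
  rewrite /series/= big_mkord; apply: le_trans (ler_norm_sum _ _ _) _.
  apply: ler_sum => n _; rewrite mulr0 -mulrBr normrM.
  have /andP[f0 f1] := fejer_weight_itv (ltn_ord n).
  rewrite (ger0_norm (mulr_ge0 (om_ge0 n) f0)) -mulrA -[leRHS]mulrA.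
  rewrite ler_wpM2l ?om_ge0// -[leRHS]mul1r ler_pM//.
  apply: le_trans (trig_dist _ _) _; rewrite ler_wpM2l ?cmod_ge0//.
  rewrite le_min chord_le2/=; apply: le_trans (chord_natM _ _) _.
  by rewrite ler_wpM2l.
apply: nondecreasing_cvgn_le.
  apply/nondecreasing_seqP => n; rewrite /series/= big_nat_recr//= lerDl.
  apply: mulr_ge0; first by rewrite mulr_ge0 ?om_ge0 ?cmod_ge0.
  by rewrite le_min ler0n mulr_ge0.
apply: (cvg_series_dominated (@summable_2majorant q)) => n.
exact: modulus_term.
Qed.

Lemma modulus_cvg0 q (d_ : R ^nat) : 0 < q -> (forall k, 0 <= d_ k) ->
  d_ k @[k --> \oo] --> 0 -> modulus q (d_ k) @[k --> \oo] --> 0.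
Proof.
move=> q0 d0 dk0.
rewrite [X in _ --> X](_ : _ = tsum (fun n => om n * cmod (rho q n) * Num.min 2 (n%:R * 0))); last first.
  rewrite /tsum [X in series X](_ : _ = fun=> 0); last first.
    by apply/funext => n; rewrite mulr0 min_r// mulr0.
  apply/esym; apply: cvg_lim => //; rewrite [X in X @ _](_ : _ = fun=> 0); first exact: cvg_cst.
  by apply/funext => n; rewrite /series/= big1.
apply: (tannery (@summable_2majorant q)) => [k n|n]; first exact: modulus_term.
apply: cvgM; first exact: cvg_cst.
rewrite mulr0 min_r//; apply: (@squeeze_cvgr _ _ _ _ (fun=> 0) (fun k => n%:R * d_ k)).
- by apply: nearW => k; rewrite ge_min lexx orbT andbT le_min ler0n mulr_ge0.
- exact: cvg_cst.
- by rewrite -[X in _ --> X](mulr0 (n%:R : R)); apply: cvgM => //; exact: cvg_cst.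
Qed.

Definition fejer N th : R := \sum_(n < N) om n * fejer_weight N n * cos (n%:R * th).

(* Multiplying by [chord th ^+ 2] telescopes the Fejer kernel twice. *)
Lemma fejerE N th : (0 < N)%N ->
  chord th ^+ 2 * (N%:R * fejer N th) = chord (N%:R * th) ^+ 2.
Proof.
move=> N0.
(* The Dirichlet kernels: [N] times the Fejer kernel is their sum, and [chord th ^+ 2] times each of
   them is a difference of consecutive cosines. *)
pose D k : R := \sum_(n < k) om n * cos (n%:R * th).
have NfE k : (0 < k)%N -> k%:R * fejer k th = \sum_(i < k) D i.+1.
  elim: k => // k ih _; rewrite big_ord_recr/=.
  have [->|k0] := posnP k.
    rewrite big_ord0 add0r mul1r /fejer /D !big_ord1 /fejer_weight /= mul0r subr0.
    by rewrite mulr1.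
  rewrite -ih// /fejer /D big_ord_recr/= mulrDr !mulr_sumr [in RHS]big_ord_recr/=.
  rewrite addrA -big_split/=; congr (_ + _).
    apply: eq_bigr => i _; rewrite /fejer_weight.
    have k1 : k%:R != 0 :> R by rewrite pnatr_eq0 -lt0n.
    have k2 : 1 + k%:R != 0 :> R by rewrite nat1r pnatr_eq0.
    by rewrite -[k.+1%:R]nat1r; field; rewrite k1 k2.
  have k2 : 1 + k%:R != 0 :> R by rewrite nat1r pnatr_eq0.
  by rewrite /fejer_weight -[k.+1%:R]nat1r; field.
have DE k : (2 - 2 * cos th) * D k.+1 = 2 * cos (k%:R * th) - 2 * cos (k.+1%:R * th).
  elim: k => [|k ih].
    by rewrite /D big_ord1 /= mul0r cos0 !mul1r; ring.
  rewrite /D big_ord_recr/= mulrDr ih.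
  have -> : k.+2%:R * th = k.+1%:R * th + th by rewrite -[k.+2%:R]natr1 mulrDl mul1r.
  have -> : k%:R * th = k.+1%:R * th - th by rewrite -[k.+1%:R]natr1 mulrDl mul1r addrK.
  by rewrite !cosD cosN sinN; ring.
rewrite NfE// !chord_sqr mulr_sumr; under eq_bigr do rewrite DE.
suff -> k : \sum_(i < k) (2 * cos (i%:R * th) - 2 * cos (i.+1%:R * th)) =
    2 - 2 * cos (k%:R * th) by [].
elim: k => [|k ih]; first by rewrite big_ord0 mul0r cos0; ring.
by rewrite big_ord_recr/= ih; ring.
Qed.

(** By [fejerE] the kernel is [chord (N th) ^ 2 / (N chord th ^ 2)], and a chord is at most 2. *)
Lemma fejer_le N th d : (0 < N)%N -> 0 < d -> d <= chord th ->
  `|fejer N th| <= 4 / (N%:R * d ^+ 2).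
Proof.
move=> N0 d0 dth; have c0 := lt_le_trans d0 dth.
have NR : 0 < N%:R :> R by rewrite ltr0n.
have e : chord th ^+ 2 * (N%:R * `|fejer N th|) = chord (N%:R * th) ^+ 2.
  rewrite -fejerE// -[RHS]ger0_norm; last by rewrite fejerE// exprn_ge0 ?chord_ge0.
  by rewrite normrM (ger0_norm (exprn_ge0 _ (chord_ge0 _))) normrM normr_nat.
rewrite ler_pdivlMr ?mulr_gt0 ?exprn_gt0//.
have : chord (N%:R * th) ^+ 2 <= 4.
  by have := chord_le2 (N%:R * th); have := chord_ge0 (N%:R * th); nra.
rewrite -e; apply: le_trans.
have -> : chord th ^+ 2 * (N%:R * `|fejer N th|) =
    `|fejer N th| * (N%:R * chord th ^+ 2) by ring.
by rewrite !ler_wpM2l// ler_sqr ?nnegrE ?chord_ge0 ?(ltW d0).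
Qed.

(** With [w = q + psi n], the inverse of [rho q n], this is [|rho q n|] times the Taylor remainder
    [|1 - exp (- h w) - h w|], hence [o(h)] for each fixed [n]. *)
Definition gen_err q n h : R :=
  cmod (rho q n * (1 - (expR (- (q * h)))%:C * cexp (- (h%:C * psi n))) - h%:C).

Lemma gen_err_cvg0 q n (h_ : R ^nat) : 0 < q -> (forall k, 0 < h_ k) ->
  h_ k @[k --> \oo] --> 0 -> gen_err q n (h_ k) / h_ k @[k --> \oo] --> 0.
Proof.
move=> q0 h0 hk0.
pose a := q + Re (psi n); pose b := Im (psi n).
have a0 : 0 < a by rewrite ltr_wpDr.
have w0 : q%:C + psi n != 0.
  by rewrite -cmod_gt0 (lt_le_trans a0)// (le_trans (ler_norm _))// (le_trans _ (normRe_cmod _))// raddfD.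
(* This function and the next are the real part of [exp (- h w)] and minus its imaginary part, for
   [w = q + psi n]. *)
have da : is_derive (0 : R) 1 (fun h => expR (- (h * a)) * cos (h * b)) (- a).
  apply: is_derive_eq; rewrite !scaler1.
  by rewrite !mul0r oppr0 expR0 cos0 sin0 !scale1r !scale0r; ring.
have db : is_derive (0 : R) 1 (fun h => expR (- (h * a)) * sin (h * b)) b.
  apply: is_derive_eq; rewrite !scaler1.
  by rewrite !mul0r oppr0 expR0 cos0 sin0 !(scale1r, mulr1, mul1r, addr0, add0r, scale0r).
have ca := difference_quotient_cvg da h0 hk0.
have cb := difference_quotient_cvg db h0 hk0.
apply: (@squeeze_cvgr _ _ _ _ (fun=> 0) (fun k => cmod (rho q n) *
  (`|- a - (expR (- (h_ k * a)) * cos (h_ k * b) - expR (- (0 * a)) * cos (0 * b)) / h_ k| +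
   `|b - (expR (- (h_ k * a)) * sin (h_ k * b) - expR (- (0 * a)) * sin (0 * b)) / h_ k|))).
- apply: nearW => k; rewrite divr_ge0 ?cmod_ge0 ?(ltW (h0 k))//=.
  rewrite ler_pdivrMr// -mulrA mulrDl.
  have hk := h0 k.
  have nm x : `|x| * h_ k = `|x * h_ k| by rewrite normrM (gtr0_norm hk).
  rewrite !nm !mulrBl !divfK ?gt_eqF//.
  rewrite !mul0r oppr0 expR0 cos0 sin0 mulr0 subr0 mulr1.
  rewrite /gen_err (_ : _ - _ = rho q n * (1 - (expR (- (q * h_ k)))%:C *
    cexp (- ((h_ k)%:C * psi n)) - (h_ k)%:C * (q%:C + psi n))); last first.
    rewrite [RHS]mulrBr; congr (_ - _).
    by rewrite mulrCA /rho mulVf// mulr1.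
  rewrite cmodM ler_wpM2l ?cmod_ge0//; apply: le_trans (cmod_le_ReIm _) _.
  have eE : expR (- (h_ k * a)) = expR (- (q * h_ k)) * expR (- (h_ k * Re (psi n))).
    by rewrite -expRD; congr expR; rewrite /a; ring.
  rewrite eE /a /b; case: (psi n) => a' b'; rewrite /cexp/= !(mul0r, subr0, addr0, sub0r, add0r) !sinN !cosN.
  apply: lerD; rewrite le_eqVlt; apply/orP; left; apply/eqP.
  - congr Num.norm; ring.
  - rewrite -normrN; congr Num.norm; ring.
- exact: cvg_cst.
- rewrite -[X in _ --> X](mulr0 (cmod (rho q n))); apply: cvgM; first exact: cvg_cst.
  rewrite -[X in _ --> X]addr0; apply: cvgD; apply/norm_cvg0P.
  + rewrite -[X in _ --> X](subrr (- a)); apply: cvgB => //; exact: cvg_cst.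
  + rewrite -[X in _ --> X](subrr b); apply: cvgB => //; exact: cvg_cst.
Qed.

End circle_resolvent.

(** * Entrance times *)

Section first_entrance.
Context {R : realType}.
Implicit Types (A : set R) (w : pathspace R) (a h q r t s : R) (k : R -> R).

Definition hit a A w : \bar R :=
  ereal_inf [set t%:E | t in [set t | a <= t /\ A (X t w)]].

(** The discount factor at a possibly infinite time; the value 0 at [+oo] makes paths that never
    enter contribute nothing. *)
Definition lapl q (x : \bar R) : R := if x is r%:E then expR (- (q * r)) else 0.

(** Real products of indicators rather than events, so that adaptedness and the telescoping of first
    entrances are algebraic. *)
Definition avoid A a h (j : nat) w : R := \prod_(i < j) \1_(~` A) (X (a + i%:R * h) w).
Definition enter A a h (j : nat) w : R := avoid A a h j w * \1_A (X (a + j%:R * h) w).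

(** At most one summand is nonzero: the sum is the discounted value of [k] at the first grid time in
    [A], or 0 if the [K] grid points all miss [A]. *)
Definition grid_sum q A a h (K : nat) k w : R :=
  \sum_(j < K) expR (- (q * (a + j%:R * h))) * enter A a h j w * k (a + j%:R * h).

Lemma hit_ge a A w : (a%:E <= hit a A w)%E.
Proof. by apply: le_ereal_inf_tmp => _ [t [at_ _] <-]; rewrite lee_fin. Qed.

Lemma hit_le a A w t : a <= t -> A (X t w) -> (hit a A w <= t%:E)%E.
Proof. by move=> at_ At; apply: ereal_inf_lbound; exists t. Qed.

Lemma hit_subset a A B w : A `<=` B -> (hit a B w <= hit a A w)%E.
Proof.
move=> AB; apply: le_ereal_inf => _ [t [at_ At] <-]; exists t => //.
by split => //; exact: AB.
Qed.

Lemma avoidS A a h j w :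
  avoid A a h j.+1 w = avoid A a h j w * \1_(~` A) (X (a + j%:R * h) w).
Proof. by rewrite /avoid big_ord_recr. Qed.

Lemma avoid_enter A a h j w :
  avoid A a h j w = enter A a h j w + avoid A a h j.+1 w.
Proof.
rewrite avoidS /enter -mulrDr !indicE in_setC.
by case: (_ \in _); rewrite /= ?addr0 ?add0r mulr1.
Qed.

Lemma sum_enter A a h K w :
  \sum_(j < K) enter A a h j w = 1 - avoid A a h K w.
Proof.
elim: K => [|K ih]; first by rewrite big_ord0 /avoid big_ord0 subrr.
by rewrite big_ord_recr/= ih {1}[in LHS]avoid_enter; ring.
Qed.

Lemma avoid_itv A a h j w : 0 <= avoid A a h j w <= 1.
Proof.
elim: j => [|j /andP[ih0 ih1]]; first by rewrite /avoid big_ord0 ler01 lexx.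
by rewrite avoidS indicE; case: (_ \in _); rewrite ?mulr1 ?mulr0 ?lexx ?ler01 ?ih0.
Qed.

Lemma enter_ge0 A a h j w : 0 <= enter A a h j w.
Proof.
by have /andP[h0 _] := avoid_itv A a h j w; rewrite mulr_ge0// indicE; case: (_ \in _).
Qed.

Lemma enter_le1 A a h j w : enter A a h j w <= 1.
Proof.
have /andP[h0 h1] := avoid_itv A a h j w.
by rewrite -[leRHS]mulr1 ler_pM// indicE; case: (_ \in _).
Qed.

Lemma grid_sumP q A a h K k w :
  ((forall j, (j < K)%N -> ~ A (X (a + j%:R * h) w)) /\
    grid_sum q A a h K k w = 0) \/
  exists j0, [/\ (j0 < K)%N, A (X (a + j0%:R * h) w),
    (forall j, (j < j0)%N -> ~ A (X (a + j%:R * h) w)) &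
    grid_sum q A a h K k w = expR (- (q * (a + j0%:R * h))) * k (a + j0%:R * h)].
Proof.
have avoid1 K0 : (forall j, (j < K0)%N -> ~ A (X (a + j%:R * h) w)) ->
    avoid A a h K0 w = 1.
  by move=> H; rewrite /avoid big1// => i _; rewrite indicE mem_set//; exact: H.
elim: K => [|K [[H ih]|[j0 [j0K Aj0 H ih]]]].
- by left; split => //; rewrite /grid_sum big_ord0.
- have [AK|nAK] := pselect (A (X (a + K%:R * h) w)).
  + right; exists K; split => //.
    rewrite /grid_sum big_ord_recr/= -/(grid_sum q A a h K k w) ih add0r.
    by rewrite /enter avoid1// indicE mem_set// !mulr1.
  + left; split.
      by move=> j; rewrite ltnS leq_eqVlt => /predU1P[->|/H].
    rewrite /grid_sum big_ord_recr/= -/(grid_sum q A a h K k w) ih add0r.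
    by rewrite /enter indicE memNset// !(mulr0, mul0r).
- right; exists j0; split => //; first exact: ltnW.
  rewrite /grid_sum big_ord_recr/= -/(grid_sum q A a h K k w) ih.
  rewrite /enter /avoid (bigD1 (Ordinal j0K))//= indicE memNset; last by move=> /(_ Aj0).
  by rewrite !(mul0r, mulr0) addr0.
Qed.

Lemma right_nbhs (w : pathspace R) A t : 0 <= t -> open A -> A (X t w) ->
  exists2 rho, 0 < rho & forall u, t <= u < t + rho -> A (X u w).
Proof.
move=> t0 oA At; have cr := cadlag_right (Defs.pathP (w : Defs.path R)) t0.
have : \forall x \near t^'+, A (X x w) by apply: cr; exact: open_nbhs_nbhs.
move=> /nbhs_ballP[rho/= rho0 H]; exists rho => // u /andP[].
rewrite le_eqVlt => /predU1P[<- //|tu utr]; apply: H => //=.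
by rewrite -ball_normE/= ltr0_norm ?subr_lt0// opprB ltrBlDl.
Qed.

(** By right continuity the path stays in the open set for some time after a visit close to [r], and
    a fine enough grid has a point in that interval. *)
Lemma grid_hits a A w r eps : 0 <= a -> open A -> hit a A w = r%:E -> 0 < eps ->
  exists2 rho, 0 < rho & forall h, 0 < h < rho ->
    exists j, A (X (a + j%:R * h) w) /\ a + j%:R * h < r + eps.
Proof.
move=> a0 oA hitr e0; have e2 : 0 < eps / 2 by rewrite divr_gt0.
have : (hit a A w < (r + eps / 2)%:E)%E by rewrite hitr lte_fin ltrDl.
move=> /ereal_inf_lt[_ [t [at_ At] <-]]; rewrite lte_fin => tr.
have [rho rho0 H] := right_nbhs (le_trans a0 at_) oA At.
exists (Num.min rho (eps / 2)); first by rewrite lt_min rho0.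
move=> h /andP[h0]; rewrite lt_min => /andP[hrho heps].
pose x := (t - a) / h; have x0 : 0 <= x by rewrite divr_ge0 ?subr_ge0// ltW.
(* The first grid point strictly after [t]; it is at most one step beyond [t]. *)
exists (Num.truncn x).+1.
have /andP[x1 x2] := truncn_itv x0.
have y1 : t < a + (Num.truncn x).+1%:R * h.
  by rewrite -ltrBlDl -ltr_pdivrMr.
have y2 : a + (Num.truncn x).+1%:R * h <= t + h.
  by rewrite -natr1 mulrDl mul1r addrA lerD2r -lerBrDl -ler_pdivlMr.
split; last by lra.
by apply: H; rewrite (ltW y1)/= (le_lt_trans y2)// ltrD2l.
Qed.

Definition mesh (m : nat) : R := m.+1%:R^-1.

Lemma mesh_gt0 m : 0 < mesh m. Proof. by rewrite invr_gt0. Qed.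

Lemma mesh_cvg0 : mesh m @[m --> \oo] --> 0.
Proof. exact: cvg_harmonic. Qed.

(* A grid of mesh [1/(m+1)] and horizon [m+1]. *)
Definition grid q A a (m : nat) k w : R := grid_sum q A a (mesh m) (m.+1 ^ 2)%N k w.

Lemma grid_near a A w r eps k q : 0 <= a -> open A -> hit a A w = r%:E -> 0 < eps ->
  \forall m \near \oo, exists t, [/\ r <= t, t < r + eps &
    grid q A a m k w = expR (- (q * t)) * k t].
Proof.
move=> a0 oA hitr e0; have [rho rho0 H] := grid_hits a0 oA hitr e0.
rewrite /grid; near=> m.
have mrho : mesh m < rho.
  have : `|0 - mesh m| < rho by near: m; move/cvgrPdist_lt : mesh_cvg0; exact.
  by rewrite sub0r normrN ger0_norm// ltW// mesh_gt0.
have [j [Aj jr]] := H (mesh m) (introT andP (conj (mesh_gt0 m) mrho)).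
have [[Hn _]|[j0 [j0K Aj0 Hj0 ->]]] := grid_sumP q A a (mesh m) (m.+1 ^ 2) k w.
  (* The grid cannot stop too early: [(m+1)^2] steps of length [1/(m+1)] cover a duration [m+1],
     which exceeds [r + eps] for large [m]. *)
  exfalso; apply: (Hn j) => //.
  rewrite -(ltr_nat R) natrX.
  have : j%:R * mesh m < m.+1%:R.
    apply: (@lt_le_trans _ _ (r + eps)).
      by apply: le_lt_trans jr; rewrite lerDr.
    apply: (@le_trans _ _ m%:R); last by rewrite ler_nat.
    by near: m; exact: nbhs_infty_ger.
  by rewrite /mesh ltr_pdivrMr// expr2.
exists (a + j0%:R * mesh m); split => //.
  by rewrite -lee_fin -hitr hit_le// lerDl mulr_ge0// ltW// mesh_gt0.
apply: le_lt_trans jr; rewrite lerD2l ler_wpM2r ?(ltW (mesh_gt0 m))// ler_nat.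
by rewrite leqNgt; apply/negP => /Hj0.
Unshelve. all: by end_near. Qed.

Lemma hit_oo a A w m k q : hit a A w = +oo%E -> grid q A a m k w = 0.
Proof.
move=> hoo; rewrite /grid.
have [[_ ->//]|[j0 [_ Aj0 _ _]]] := grid_sumP q A a (mesh m) (m.+1 ^ 2) k w.
have : (hit a A w <= (a + j0%:R * mesh m)%:E)%E.
  by rewrite hit_le// lerDl mulr_ge0// ltW// mesh_gt0.
by rewrite hoo.
Qed.

Lemma hit_finP a A w : hit a A w = +oo%E \/ exists2 r, a <= r & hit a A w = r%:E.
Proof.
have := hit_ge a A w; case: (hit a A w) => [r| |] //; last by left.
by right; exists r.
Qed.

Lemma grid_cvg a A w q : 0 <= a -> 0 < q -> open A ->
  grid q A a m (cst 1) w @[m --> \oo] --> lapl q (hit a A w).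
Proof.
move=> a0 q0 oA; have [hoo|[r ar hr]] := hit_finP a A w.
  rewrite hoo/=; under eq_fun do rewrite hit_oo//; exact: cvg_cst.
rewrite hr/=; apply/cvgrPdist_lt => e e0.
have : expR (- (q * t)) @[t --> r] --> expR (- (q * r)).
  apply: (@cvg_comp _ _ _ (fun t => - (q * t)) (@expR R) _ (nbhs (- (q * r)))).
    by apply: cvgN; apply: cvgM; [exact: cvg_cst|exact: cvg_id].
  exact: continuous_expR.
move=> /cvgrPdist_lt/(_ e e0)/nbhs_ballP[eps/= eps0 H].
near=> m.
have [t [rt tr ->]] : exists t, [/\ r <= t, t < r + eps &
    grid q A a m (cst 1) w = expR (- (q * t)) * 1].
  by near: m; exact: grid_near.
rewrite mulr1; apply: H.
by rewrite /ball/= ler0_norm ?subr_le0// opprB ltrBlDl.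
Unshelve. all: by end_near. Qed.

Lemma grid_ge a A w q k r rho c : 0 <= a -> 0 < q -> open A -> hit a A w = r%:E ->
  0 < rho -> 0 <= c -> (forall t, r <= t < r + rho -> c <= k t) ->
  \forall m \near \oo, expR (- (q * (r + rho))) * c <= grid q A a m k w.
Proof.
move=> a0 q0 oA hr rho0 c0 kc.
have := grid_near k q a0 oA hr rho0; apply: filterS => m [t [rt tr ->]].
apply: ler_pM; rewrite ?expR_ge0//; last by apply: kc; rewrite rt tr.
by rewrite ler_expR lerN2 ler_wpM2l ?(ltW q0) ?(ltW tr).
Qed.

Lemma lapl_itv q x : 0 < q -> (0 <= x)%E -> 0 <= lapl q x <= 1.
Proof.
move=> q0; case: x => [r| |] //=; rewrite ?lexx ?ler01// lee_fin => r0.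
by rewrite expR_ge0 expR_le1 oppr_le0 mulr_ge0// ltW.
Qed.

Lemma lapl_cvg q a (u : (\bar R)^nat) : 0 < q -> nondecreasing_seq u ->
  (forall n, a%:E <= u n)%E -> lapl q (u n) @[n --> \oo] --> lapl q (ereal_sup (range u)).
Proof.
move=> q0 ndu au; have cu := ereal_nondecreasing_cvgn ndu.
have uS n : (u n <= ereal_sup (range u))%E by apply: ereal_sup_ubound; exists n.
case ES : (ereal_sup (range u)) => [r| |].
- have ufin n : u n = (fine (u n))%:E.
    rewrite fineK// fin_numE; apply/andP; split.
      by rewrite gt_eqF// (lt_le_trans _ (au n))// ltNyr.
    by rewrite lt_eqF// (le_lt_trans (uS n))// ES ltry.
  rewrite ES in cu.
  have cf : fine (u n) @[n --> \oo] --> r by apply: fine_cvg.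
  rewrite [X in X @ _ --> _](_ : _ = fun n => expR (- (q * fine (u n)))); last first.
    by apply/funext => n; rewrite {1}ufin.
  apply: (@cvg_comp _ _ _ (fun n => - (q * fine (u n))) (@expR R) _ (nbhs (- (q * r)))).
    by apply: cvgN; apply: cvgM => //; exact: cvg_cst.
  exact: continuous_expR.
- rewrite ES in cu; apply/cvgrPdist_lt => e e0.
  (* Beyond this threshold [exp (- q x)] is at most [e * exp (-1)], hence below [e]. *)
  have /cvgeyPge/(_ ((1 - ln e) / q)) := cu.
  apply: filterS => n; rewrite /= sub0r normrN.
  case: (u n) => [x| |] //=; last by rewrite normr0.
  rewrite lee_fin ler_pdivrMr// => h; rewrite ger0_norm ?expR_ge0//.
  rewrite -[ltRHS]lnK ?posrE// ltr_expR; lra.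
- by have := le_trans (au 0%N) (uS 0%N); rewrite ES.
Qed.

Lemma ge_hit a b A w : a <= b -> (b%:E <= hit a A w)%E -> hit b A w = hit a A w.
Proof.
move=> ab bh; apply/eqP; rewrite eq_le; apply/andP; split.
  apply: le_ereal_inf_tmp => _ [t [at_ At] <-].
  by apply: hit_le => //; rewrite -lee_fin (le_trans bh)// hit_le.
by apply: le_ereal_inf => _ [t [bt At] <-]; exists t => //; split => //; exact: le_trans bt.
Qed.

(** Right continuity keeps the path in the open set long enough to meet a rational offset. An
    entrance before [b] is thus a countable union of events at fixed times. *)
Lemma hit_ltP a b A w : 0 <= a -> open A ->
  (hit a A w < b%:E)%E <-> exists p : rat, [/\ 0 <= p, a + ratr p < b & A (X (a + ratr p) w)].
Proof.
move=> a0 oA; split; last first.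
  move=> [p [p0 pb Ap]]; apply: (@le_lt_trans _ _ (a + ratr p)%:E).
    by rewrite hit_le// lerDl ler0q.
  by rewrite lte_fin.
move=> /ereal_inf_lt[_ [t [at_ At] <-]]; rewrite lte_fin => tb.
have [rho rho0 H] := right_nbhs (le_trans a0 at_) oA At.
have : t - a < Num.min (t + rho - a) (b - a) by rewrite lt_min; lra.
move=> /rat_in_itvoo[p]; rewrite in_itv/= lt_min => /andP[p1 /andP[p2 p3]].
exists p; split.
- by rewrite -(@ler0q R) (le_trans _ (ltW p1))// subr_ge0.
- by lra.
- by apply: H; apply/andP; split; lra.
Qed.

End first_entrance.

Lemma bigcup_rat_measurable d (T : measurableType d) (D : set rat)
  (F : rat -> set T) : (forall p, D p -> measurable (F p)) ->
  measurable (\bigcup_(p in D) F p).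
Proof.
move=> mF; rewrite bigcup_mkcond; apply: bigcupT_measurable_rat => p.
by case: ifPn => [/set_mem/mF//|_]; exact: measurable0.
Qed.

(** * Entrance into shrinking neighbourhoods of a zero set *)

Section limit_entrance.
Context {R : realType} (G : R -> R).
Hypothesis cG : continuous G.
Hypothesis G_ge0 : forall y, 0 <= G y.
Implicit Types (w : pathspace R) (a q r t : R).

Definition level (k : nat) : set R := [set y | G y < mesh k].

(* The limit of the entrance times into the neighbourhoods [level k] of the zeros
   of [G]; unlike their hitting time it is measurable. *)
Definition Tlim a w : \bar R := ereal_sup (range (fun k => hit a (level k) w)).

Lemma open_level k : open (level k).
Proof.
rewrite /level (_ : [set _ | _] = G @^-1` [set y | y < mesh k]) //.
by apply: open_comp.
Qed.

Lemma mesh_le (k l : nat) : (k <= l)%N -> mesh l <= mesh k :> R.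
Proof. by move=> kl; rewrite lef_pV2 ?posrE// ler_nat ltnS. Qed.

Lemma level_sub (k l : nat) : (k <= l)%N -> level l `<=` level k.
Proof. by move=> kl y /= /lt_le_trans; apply; exact: mesh_le. Qed.

Lemma nondecreasing_hit a w : nondecreasing_seq (fun k => hit a (level k) w).
Proof. by move=> k l kl; apply: hit_subset; exact: level_sub. Qed.

Lemma hit_le_Tlim a w k : (hit a (level k) w <= Tlim a w)%E.
Proof. by apply: ereal_sup_ubound; exists k. Qed.

Lemma Tlim_ge a w : (a%:E <= Tlim a w)%E.
Proof. exact: le_trans (hit_ge _ _ _) (hit_le_Tlim _ _ 0). Qed.

Lemma lapl_hit_cvg a q w : 0 < q ->
  lapl q (hit a (level k) w) @[k --> \oo] --> lapl q (Tlim a w).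
Proof.
move=> q0; apply: (@lapl_cvg _ q a) => //; first exact: nondecreasing_hit.
by move=> k; exact: hit_ge.
Qed.

Lemma Tlim_hit_zero a w :
  (forall r, Tlim a w = r%:E -> G (X r w) = 0) ->
  hit a [set y | G y = 0] w = Tlim a w.
Proof.
move=> H; apply/eqP; rewrite eq_le; apply/andP; split; last first.
  apply: ge_ereal_sup => _ [k _ <-]; apply: hit_subset => y /= Gy.
  by rewrite /level/= Gy mesh_gt0.
have := Tlim_ge a w; case E : (Tlim a w) => [r| |] //=; rewrite ?leey// lee_fin => ar.
by apply: hit_le => //=; exact: H.
Qed.

(** By right continuity [G] stays above half its value at time [r] during [rho]. First [m] makes the
    look-ahead [mesh m] less than [rho / 2]; then [k] brings the entrance time within [mesh m] below
    [r]; then the grid of index [i] locates it up to [rho / 2]. The look-ahead time falls between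
    [r] and [r + rho]. *)
Lemma Tlim_overshoot q w r : 0 < q -> Tlim 0 w = r%:E -> G (X r w) != 0 ->
  exists2 c, 0 < c & \forall m \near \oo, \forall k \near \oo, \forall i \near \oo,
    c <= grid q (level k) 0 i (fun t => G (X (t + mesh m) w) ^+ 2) w.
Proof.
move=> q0 Tr Gr.
have r0 : 0 <= r by rewrite -lee_fin -Tr Tlim_ge.
have G0 : 0 < G (X r w) by rewrite lt_neqAle eq_sym Gr G_ge0.
pose d := G (X r w) / 2; have d0 : 0 < d by rewrite divr_gt0.
have oA : open [set y | d < G y].
  rewrite (_ : [set _ | _] = G @^-1` [set y | d < y]) //.
  by apply: open_comp.
have [|rho rho0 H] := right_nbhs (w := w) r0 oA; first by rewrite /= /d ltr_pdivrMr//; lra.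
have rho2 : 0 < rho / 2 by rewrite divr_gt0.
exists (expR (- (q * (r + rho / 2))) * d ^+ 2).
  by rewrite mulr_gt0 ?expR_gt0// exprn_gt0.
near=> m.
have m2 : mesh m < rho / 2 :> R.
  have : `|0 - mesh m| < rho / 2 by near: m; move/cvgrPdist_lt : (@mesh_cvg0 R); exact.
  by rewrite sub0r normrN ger0_norm// ltW// mesh_gt0.
have m0 := mesh_gt0 (R := R) m.
near=> k.
have hk : ((r - mesh m)%:E < hit 0 (level k) w)%E.
  near: k; have : ((r - mesh m)%:E < Tlim 0 w)%E by rewrite Tr lte_fin ltrBlDr ltrDl.
  move=> /ereal_sup_gt[_ [k0 _ <-] h0]; exists k0 => // k /= k0k.
  by apply: lt_le_trans h0 _; exact: nondecreasing_hit.
have := hit_le_Tlim 0 w k; rewrite Tr.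
have [->//|[rk rk0 hrk]] := hit_finP 0 (level k) w.
rewrite hrk lee_fin in hk *; rewrite lte_fin in hk => rkr.
have := @grid_ge _ 0 (level k) w q (fun t => G (X (t + mesh m) w) ^+ 2) rk (rho / 2)
  (d ^+ 2) (lexx 0) q0 (@open_level k) hrk rho2 (sqr_ge0 d).
have kc t : rk <= t < rk + rho / 2 -> d ^+ 2 <= G (X (t + mesh m) w) ^+ 2.
  move=> /andP[t1 t2]; rewrite ler_sqr ?nnegrE ?(ltW d0)//.
  by apply/ltW/H; apply/andP; split; lra.
move=> /(_ kc); apply: filterS => i; apply: le_trans.
rewrite ler_wpM2r ?sqr_ge0// ler_expR lerN2 ler_wpM2l ?(ltW q0)//.
by lra.
Unshelve. all: by end_near. Qed.

(** If level [k] is not entered before [a], neither is any smaller one, so the two sequences of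
    entrance times agree from rank [k] on. *)
Lemma Tlim_shift a k w : 0 <= a -> (a%:E <= hit 0 (level k) w)%E -> Tlim a w = Tlim 0 w.
Proof.
move=> a0 ak.
have E l : (k <= l)%N -> hit a (level l) w = hit 0 (level l) w.
  move=> kl; apply: ge_hit => //; apply: le_trans ak _.
  exact: nondecreasing_hit.
apply/eqP; rewrite eq_le; apply/andP; split; apply: ge_ereal_sup => _ [l _ <-].
- apply: (@le_trans _ _ (hit a (level (maxn k l)) w)).
    by apply: nondecreasing_hit; exact: leq_maxr.
  by rewrite E ?leq_maxl// hit_le_Tlim.
- apply: (@le_trans _ _ (hit 0 (level (maxn k l)) w)).
    by apply: nondecreasing_hit; exact: leq_maxr.
  by rewrite -E ?leq_maxl// hit_le_Tlim.
Qed.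

(** The event [t < Tlim] is approximated by events of the natural filtration at [t + mesh j]. A
    single index serves both limits: an entrance time beyond [t] exceeds it by a margin that
    [mesh j] eventually undercuts, and [Tlim <= t] excludes every [j]. *)
Lemma indic_level_cvg t w :
  \1_[set w | ((t + mesh j)%:E <= hit 0 (level j) w)%E] w @[j --> \oo] -->
  (\1_[set w | (t%:E < Tlim 0 w)%E] w : R).
Proof.
have [tT|tT] := pselect (t%:E < Tlim 0 w)%E.
- rewrite [X in _ --> X]indicE mem_set//; apply: cvg_near_cst; have /ereal_sup_gt[_ [k _ <-] tk] := tT.
  have [e e0 te] : exists2 e, 0 < e & ((t + e)%:E <= hit 0 (level k) w)%E.
    move: tk; have [->|[rk rk0 ->]] := hit_finP 0 (level k) w.
      by move=> _; exists 1 => //; rewrite leey.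
    by rewrite lte_fin => trk; exists (rk - t); rewrite ?subr_gt0// addrC subrK.
  near=> j; rewrite indicE mem_set//=.
  apply: (@le_trans _ _ (t + e)%:E).
    rewrite lee_fin lerD2l; apply/ltW.
    have : `|0 - mesh j| < e by near: j; move/cvgrPdist_lt : (@mesh_cvg0 R); exact.
    by rewrite sub0r normrN ger0_norm// ltW// mesh_gt0.
  apply: le_trans te _; apply: nondecreasing_hit.
  by near: j; exists k.
- rewrite [X in _ --> X]indicE memNset//.
  apply: cvg_near_cst; apply: nearW => j; rewrite indicE memNset//= => h.
  apply: tT; apply: lt_le_trans (hit_le_Tlim 0 w j).
  by apply: lt_le_trans h; rewrite lte_fin ltrDl mesh_gt0.
Unshelve. all: by end_near. Qed.

Lemma hit_lt_bigcup a b A : 0 <= a -> open A ->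
  [set w : pathspace R | (hit a A w < b%:E)%E] =
  \bigcup_(p in [set p : rat | 0 <= p /\ a + ratr p < b])
    [set w | A (X (a + ratr p) w)].
Proof.
move=> a0 oA; apply/seteqP; split => w /=.
  by move=> /(hit_ltP _ _ a0 oA)[p [p0 pb Ap]]; exists p.
by move=> [p [p0 pb] Ap]; apply/(hit_ltP _ _ a0 oA); exists p.
Qed.

(** The inequality is strict, so only rational times before [a] are inspected and the natural
    filtration at [a] is enough. *)
Lemma hit_lt_filt a A : open A ->
  natural_filtration a [set w : pathspace R | (hit 0 A w < a%:E)%E].
Proof.
move=> oA; rewrite hit_lt_bigcup//.
suff : measurable (\bigcup_(p in [set p : rat | 0 <= p /\ 0 + ratr p < a])
    [set w : filt a | A (X (0 + ratr p) w)]) by [].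
apply: bigcup_rat_measurable => p [p0 pa].
apply: (@measurable_preimageT _ (filt a) _ (X (0 + ratr p))).
  by apply: measurable_X_filt; rewrite ?add0r ?ler0q//; rewrite add0r in pa; exact: ltW.
exact: open_measurable.
Qed.

Lemma measurable_wrt_level a A : open A ->
  measurable_wrt (natural_filtration a) (\1_[set w | (a%:E <= hit 0 A w)%E] : pathspace R -> R).
Proof.
move=> oA; apply/measurable_wrtP.
have m := @hit_lt_filt a A oA.
have mC : measurable (~` ([set w | (hit 0 A w < a%:E)%E] : set (filt a))).
  exact: measurableC.
rewrite (_ : [set w | _] = ~` [set w | (hit 0 A w < a%:E)%E]).
  exact: measurable_indic.
by apply/seteqP; split => w /=; rewrite leNgt => /negP.
Qed.

Lemma measurable_hit a A : 0 <= a -> open A -> measurable_fun setT (hit a A).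
Proof.
move=> a0 oA; apply: (measurability _ (ErealGenInftyO.measurableE R)) => //.
move=> _ [_ [b ->] <-]; rewrite setTI.
rewrite (_ : _ @^-1` _ = [set w | (hit a A w < b%:E)%E]); last first.
  by apply/seteqP; split => w /=; rewrite in_itv.
rewrite hit_lt_bigcup//.
apply: bigcup_rat_measurable => p [p0 pa].
apply: (@measurable_preimageT _ _ _ (X (a + ratr p))).
  by apply: measurable_X; rewrite addr_ge0 ?ler0q.
exact: open_measurable.
Qed.

Lemma measurable_Tlim a : 0 <= a -> measurable_fun setT (Tlim a).
Proof.
move=> a0; rewrite (_ : Tlim a = fun w => esups (fun k => hit a (level k) w) 0).
  by apply: measurable_fun_esups => k; apply: measurable_hit => //; exact: open_level.
apply/funext => w; rewrite /esups/= /sdrop; congr ereal_sup.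
by apply/seteqP; split => x [k _ <-]; exists k.
Qed.

End limit_entrance.

Lemma Re_realM (R : realType) (a : R) (z : R[i]) : Re (a%:C * z) = a * Re z.
Proof. by case: z => u v /=; rewrite mul0r subr0. Qed.

Lemma cmodN (R : realType) (z : R[i]) : cmod (- z) = cmod z.
Proof. by rewrite /cmod normrN. Qed.

Lemma measurable_limn_einf d (T : measurableType d) (R : realType)
    (g : nat -> T -> \bar R) : (forall n, measurable_fun setT (g n)) ->
  measurable_fun setT (fun w => limn_einf (g ^~ w)).
Proof.
move=> mg; rewrite (_ : (fun w => _) = fun w => (- limn_esup (fun n => - g n w))%E).
  apply: measurableT_comp => //.
  by apply: measurable_fun_limn_esup => n; exact: measurableT_comp.
apply/funext => w; rewrite -limn_einfN; congr limn_einf.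
by apply/funext => n /=; rewrite oppeK.
Qed.

Lemma limn_einf_ge (R : realType) (u : (\bar R)^nat) (c : \bar R) :
  (\forall n \near \oo, (c <= u n)%E) -> (c <= limn_einf u)%E.
Proof.
move=> [N _ H]; rewrite limn_einf_lim; apply: lime_ge; first exact: is_cvg_einfs.
exists N => // n /= Nn; apply: le_ereal_inf_tmp => _ [k /= nk <-].
by apply: H => /=; exact: leq_trans nk.
Qed.

Lemma limn_einf_ge0 (R : realType) (u : (\bar R)^nat) :
  (forall n, 0 <= u n)%E -> (0 <= limn_einf u)%E.
Proof. by move=> u0; apply: limn_einf_ge; exact: nearW. Qed.

Section circle_chord.
Context {R : realType} (L : R).

(** As [lam L 1] is [2 pi / L], this is the chord between [y] and the base point on the circle of
    length [L], zero exactly on the lattice. *)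
Definition circ_chord (y : R) : R := chord (lam L 1 * y).

Lemma continuous_chord : continuous (@chord R).
Proof.
move=> y; rewrite /continuous_at.
have -> : @chord R = fun z => Num.sqrt (2 - 2 * cos z).
  by apply/funext => z; rewrite -chord_sqr sqrtr_sqr ger0_norm// chord_ge0.
apply: (@cvg_comp _ _ _ (fun z => 2 - 2 * cos z) (@Num.sqrt R) _ (nbhs (2 - 2 * cos y))).
  apply: cvgB; first exact: cvg_cst.
  by apply: cvgM; [exact: cvg_cst|exact: continuous_cos].
exact: sqrt_continuous.
Qed.

Lemma continuous_circ_chord : continuous circ_chord.
Proof.
move=> y; apply: (@cvg_comp _ _ _ (fun z => lam L 1 * z) (@chord R) _ (nbhs (lam L 1 * y))).
  by apply: cvgM; [exact: cvg_cst|exact: cvg_id].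
exact: continuous_chord.
Qed.

Lemma circ_chord_ge0 y : 0 <= circ_chord y. Proof. exact: chord_ge0. Qed.

End circle_chord.

(** * The lattice, the clock and the function phi *)

Section lattice.
Context {R : realType}.
Implicit Types (L th y : R).

Lemma cosD_int (n : int) th : cos (th + n%:~R * (pi *+ 2)) = cos th.
Proof.
have H (m : nat) x : cos (x + m%:R * (pi *+ 2)) = cos x :> R.
  by rewrite mulr_natl (periodicn (@cosD2pi R)).
case: n => m; first exact: H.
rewrite NegzE mulrNz mulNr -(H m.+1 (th - _)); congr cos.
by rewrite -!pmulrn subrK.
Qed.

Lemma cos_eq1 th : cos th = 1 -> exists n : int, th = n%:~R * (pi *+ 2).
Proof.
move=> c1; have p2 : 0 < pi *+ 2 :> R by rewrite pmulrn_lgt0// pi_gt0.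
pose n := Num.floor (th / (pi *+ 2)); exists n.
pose r := th - n%:~R * (pi *+ 2).
have cr : cos r = 1 by rewrite /r -mulNr -mulrNz cosD_int.
have r0 : 0 <= r by rewrite subr_ge0 -ler_pdivlMr// ge_floor.
have r2 : r < pi *+ 2.
  rewrite ltrBlDr -[X in X + _]mul1r -mulrDl -ltr_pdivrMr// addrC.
  by have := floorD1_gt (th / (pi *+ 2)); rewrite intrD.
suff : r = 0 by move/eqP; rewrite subr_eq0 => /eqP.
have [rpi|rpi] := leP r pi.
  by apply: cos_inj; rewrite ?in_itv/= ?lexx ?r0 ?pi_ge0// cr cos0.
(* [cos] is injective on [[0, pi]] only; past [pi] the reflected angle is used, and [r = 2 pi]
   contradicts [r < 2 pi]. *)
have : pi *+ 2 - r = 0.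
  apply: cos_inj; rewrite ?in_itv/= ?lexx ?pi_ge0 ?subr_ge0 ?(ltW r2)//=.
    by rewrite mulr2n; have := rpi; lra.
  by rewrite cosB cos2pi sin2pi cr cos0 mul0r addr0 mul1r.
by move/eqP; rewrite subr_eq0 => /eqP h; rewrite h ltxx in r2.
Qed.

Lemma latticeE L : 0 < L -> lattice L = [set y | circ_chord L y = 0].
Proof.
move=> L0; have L0' : L != 0 by rewrite gt_eqF.
have lE : lam L 1 = pi *+ 2 / L by rewrite /lam /dual_point mulr1 mulr_natl.
have cE y : circ_chord L y ^+ 2 = 2 - 2 * cos (pi *+ 2 / L * y).
  by rewrite /circ_chord chord_sqr lE.
apply/seteqP; split => y /=.
- move=> [n _ <-]; apply/eqP; rewrite -sqrf_eq0 cE.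
  have -> : pi *+ 2 / L * (L * n%:~R) = 0 + n%:~R * (pi *+ 2) by field.
  by rewrite cosD_int cos0 mulr1 subrr.
- move=> y0; have := cE y; rewrite y0 expr0n/= => /esym/eqP; rewrite subr_eq0 => /eqP h.
  have /cos_eq1[n hn] : cos (pi *+ 2 / L * y) = 1 by lra.
  exists n => //; have p0 : pi *+ 2 != 0 :> R by rewrite mulrn_eq0/= gt_eqF// pi_gt0.
  apply: (mulfI (mulf_neq0 p0 (invr_neq0 L0'))); rewrite hn.
  by field.
Qed.

End lattice.

Section clock.
Context {R : realType} d (S : measurableType d) (Q : probability S R)
  (e : R -> {RV Q >-> R}).
Hypothesis eE : exponential_clocks e.
Implicit Types q r t : R.

Let eQ q (A : set R) : 0 < q -> measurable A -> Q (e q @^-1` A) = exponential_prob q A.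
Proof. by move=> q0 mA; rewrite -eE. Qed.

Lemma clock_lt0 q : 0 < q -> Q (e q @^-1` `]-oo, 0[) = 0%E.
Proof.
move=> q0; rewrite eQ// /exponential_prob integral0_eq// => x /=.
by rewrite in_itv/= => x0; rewrite lt0_exponential_pdf.
Qed.

Lemma clock_lt_le q r : 0 < q -> Q (e q @^-1` `]-oo, r[) = Q (e q @^-1` `]-oo, r]).
Proof.
move=> q0; rewrite !eQ// /exponential_prob integral_itv_bndo_bndc//.
by apply/measurable_EFinP; apply: measurable_funTS; exact: measurable_exponential_pdf.
Qed.

Lemma clock_le q r : 0 < q -> 0 <= r ->
  Q (e q @^-1` `]-oo, r]) = (1 - expR (- (q * r)))%:E.
Proof.
move=> q0; rewrite le_eqVlt => /predU1P[<-|r0].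
  by rewrite -clock_lt_le// clock_lt0// mulr0 oppr0 expR0 subrr.
have -> : (`]-oo, r] : set R)%classic = `]-oo, 0[ `|` `[0, r].
  apply/seteqP; split => x /=; rewrite !in_itv/=.
    by move=> xr; case: (ltP x 0) => x0; [left|right].
  by move=> [x0|/andP[]//]; exact: le_trans (ltW x0) (ltW r0).
rewrite preimage_setU measureU.
- rewrite [X in (X + _)%E](clock_lt0 q0) add0e [LHS]eQ//.
  by rewrite exponential_prob_itv0c// mulNr -EFinB.
- by rewrite -[X in measurable X]setTI; exact: measurable_funPT.
- by rewrite -[X in measurable X]setTI; exact: measurable_funPT.
- apply/seteqP; split => x //=; rewrite !in_itv/= => -[x0 /andP[]].
  by rewrite leNgt x0.
Qed.

(** Integrates out the clock for a fixed path, [y] being its hitting time; [lapl q +oo = 0] covers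
    the paths that never hit. *)
Lemma clock_between q t (y : \bar R) : 0 < q -> 0 <= t ->
  Q [set s | t < e q s /\ ((e q s)%:E < y)%E] =
  (if (t%:E < y)%E then expR (- (q * t)) - lapl q y else 0)%:E.
Proof.
move=> q0 t0.
have mle r : measurable (e q @^-1` `]-oo, r]).
  by rewrite -[X in measurable X]setTI; exact: measurable_funPT.
have mlt r : measurable (e q @^-1` `]-oo, r[).
  by rewrite -[X in measurable X]setTI; exact: measurable_funPT.
have diff (A B : set S) (a b : R) : measurable A -> measurable B -> A `<=` B ->
    Q A = a%:E -> Q B = b%:E -> Q (B `\` A) = (b - a)%:E.
  move=> mA mB AB QA QB; rewrite measureD//; last by rewrite [X in (X < _)%E]QB ltry.
  by rewrite setIC setIidl// [X in (_ - X)%E]QA [X in (X - _)%E]QB.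
case: y => [r| |] /=.
- rewrite lte_fin; have [tr|rt] := ltP t r; last first.
    rewrite (_ : [set s | _] = set0) ?measure0//; apply/seteqP; split => s //=.
    by move=> [h1]; rewrite lte_fin => h2; have := lt_trans h1 h2; rewrite ltNge rt.
  rewrite (_ : [set s | _] = (e q @^-1` `]-oo, r[) `\` (e q @^-1` `]-oo, t])); last first.
    apply/seteqP; split => s /=; rewrite !in_itv/= lte_fin.
      by move=> [h1 h2]; split => //; apply/negP; rewrite -ltNge.
    by move=> [h1 /negP]; rewrite -ltNge.
  rewrite (@diff _ _ (1 - expR (- (q * t))) (1 - expR (- (q * r))))//.
  + by congr EFin; ring.
  + by move=> s /=; rewrite !in_itv/= => /le_lt_trans; apply.
  + exact: clock_le.
  + by rewrite clock_lt_le// clock_le//; exact: le_trans (ltW tr).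
- rewrite ltry (_ : [set s | _] = setT `\` (e q @^-1` `]-oo, t])); last first.
    apply/seteqP; split => s /=; rewrite !in_itv/=.
      by move=> [h1 h2]; split => //; apply/negP; rewrite -ltNge.
    by move=> [h1 /negP]; rewrite -ltNge ltry.
  rewrite (@diff _ _ (1 - expR (- (q * t))) 1)//.
  + by congr EFin; ring.
  + exact: clock_le.
  + exact: probability_setT.
- by rewrite (_ : [set s | _] = set0) ?measure0//; apply/seteqP; split => s //= -[_].
Qed.

Lemma clock_lt q (y : \bar R) : 0 < q -> (0 <= y)%E ->
  Q [set s | ((e q s)%:E < y)%E] = (1 - lapl q y)%:E.
Proof.
move=> q0; case: y => [r| |] //=.
- rewrite lee_fin => r0; rewrite (_ : [set s | _] = e q @^-1` `]-oo, r[).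
    by rewrite clock_lt_le// clock_le.
  by apply/seteqP; split => s /=; rewrite in_itv/= lte_fin.
- rewrite subr0 (_ : [set s | _] = setT) ?probability_setT//.
  by apply/seteqP; split => s //= _; rewrite ltry.
Qed.

End clock.

Section symmetric_sums.
Context {R : realType}.
Implicit Types (h g : int -> R).

Definition int_neq0 : set int := [set n | n != 0].

Lemma nneseries_EFin (p : R ^nat) : (forall n, 0 <= p n) -> cvgn (series p) ->
  (\sum_(k <oo) (p k)%:E = (tsum p)%:E)%E.
Proof.
move=> p0 cp; rewrite /tsum -EFin_lim//; congr (limn _).
by apply/funext => n; rewrite /series/= sumEFin.
Qed.

Lemma esum_int_even h : (forall n, 0 <= h n) -> (forall n, h (- n) = h n) ->
  (\esum_(n in int_neq0) (h n)%:E =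
   \sum_(k <oo) (2 * h k.+1%:Z)%:E)%E.
Proof.
move=> h0 hN; have h0' n : (0 <= (h n)%:E)%E by rewrite lee_fin.
rewrite (@esumID _ _ (range Posz))//.
have -> : int_neq0 `&` range Posz = [set k.+1%:Z | k in [set: nat]].
  apply/seteqP; split => n /=; last by move=> [k _ <-]; split => //; exists k.+1.
  by move=> [n0 [[|k] _ kn]]; [rewrite /int_neq0/= -kn eqxx in n0|exists k].
have -> : int_neq0 `&` ~` range Posz = [set - k.+1%:Z | k in [set: nat]].
  apply/seteqP; split => n /=.
    move=> [_]; case: n => k nk; first by exfalso; apply: nk; exists k.
    by exists k => //; rewrite NegzE.
  by move=> [k _ <-]; split => // -[m _] /esym/eqP; rewrite -NegzE.
rewrite !esum_image; last 2 first.
  by move=> a b _ _ /oppr_inj[].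
  by move=> a b _ _ [].
rewrite -!nneseries_esumT//.
rewrite -nneseriesD//.
by apply: eq_eseriesr => k _; rewrite hN mulr_natl mulr2n.
Qed.

(** The positive and negative parts are dominated by [|g|], so both sums are finite and may be
    subtracted; evenness folds the nonzero integers onto the positive ones. *)
Lemma csum_part_even g : (forall n, g (- n) = g n) ->
  cvgn (series (fun k => `|2 * g k.+1%:Z|)) ->
  fine (\esum_(n in int_neq0) (Num.max (g n) 0)%:E -
        \esum_(n in int_neq0) (Num.max (- g n) 0)%:E) =
  tsum (fun k => 2 * g k.+1%:Z).
Proof.
move=> gN cg.
have cmax (f : R -> R) : (forall y, 0 <= f y <= `|y|) ->
    cvgn (series (fun k => 2 * f (g k.+1%:Z))).
  move=> fle; apply: (cvg_series_dominated cg) => k.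
  have /andP[f0 f1] := fle (g k.+1%:Z).
  by rewrite !normrM (ger0_norm f0) ler_wpM2l.
have c1 : cvgn (series (fun k => 2 * Num.max (g k.+1%:Z) 0)).
  apply: (cmax (fun y => Num.max y 0)) => y.
  by rewrite le_max lexx orbT ge_max ler_norm normr_ge0.
have c2 : cvgn (series (fun k => 2 * Num.max (- g k.+1%:Z) 0)).
  apply: (cmax (fun y => Num.max (- y) 0)) => y.
  by rewrite le_max lexx orbT ge_max -normrN ler_norm normr_ge0.
rewrite !esum_int_even ?nneseries_EFin//=.
- rewrite /tsum -lim_seriesB//; congr (limn (series _)); apply/funext => k /=.
  rewrite -[LHS]/(2 * Num.max (g k.+1%:Z) 0 - 2 * Num.max (- g k.+1%:Z) 0) -mulrBr.
  congr (_ * _); have [g0|g0] := leP 0 (g k.+1%:Z).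
    by rewrite max_r ?subr0 ?oppr_le0// .
  by rewrite max_l ?oppr_ge0 ?(ltW g0)// sub0r opprK.
- by move=> n; rewrite mulr_ge0// le_max lexx orbT.
- by move=> n; rewrite mulr_ge0// le_max lexx orbT.
- by move=> n; rewrite le_max lexx orbT.
- by move=> n; rewrite gN.
- by move=> n; rewrite le_max lexx orbT.
- by move=> n; rewrite gN.
Qed.

(** The reflection [n -> - n] exchanges the positive and the negative parts, leaving [s - s]; if [s]
    is infinite, [fine] returns 0 as well. *)
Lemma csum_part_odd g : (forall n, g (- n) = - g n) ->
  fine (\esum_(n in int_neq0) (Num.max (g n) 0)%:E -
        \esum_(n in int_neq0) (Num.max (- g n) 0)%:E) = 0.
Proof.
move=> gN.
rewrite (@reindex_esum _ _ _ int_neq0 int_neq0 (fun n => - n)).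
  under eq_esum do rewrite gN.
  by case: (esum _ _) => [r| |] //=; rewrite subrr.
split => [n /=|a b _ _ /oppr_inj//|n /= n0].
- by rewrite /int_neq0/= oppr_eq0.
- by exists (- n); rewrite /int_neq0/= ?oppr_eq0 ?opprK.
Qed.

Lemma cvg_series_shift (a : R ^nat) : cvgn (series a) ->
  series (fun k => a k.+1) n @[n --> \oo] --> tsum a - a 0.
Proof.
move=> ca; rewrite (_ : series _ = fun n => series a n.+1 - a 0).
  apply: cvgB; last exact: cvg_cst.
  by rewrite (cvg_shiftS (series a)).
by apply/funext => n; rewrite /series/= big_nat_recl//= [_ + \sum_(_ <= _ < _) _]addrC addrK.
Qed.

Lemma tsum_shift (a : R ^nat) : cvgn (series a) -> a 0 = 0 ->
  tsum a = tsum (fun k => a k.+1).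
Proof.
by move=> /cvg_series_shift/(@cvg_lim _ _) h a0; rewrite /tsum h// a0 subr0.
Qed.

End symmetric_sums.

Section phi_series.
Context {R : realType} (P : R -> probability (pathspace R) R) (Psi : R -> R[i])
  (L : R).
Hypothesis levyP : levy_process P.
Hypothesis PsiE : characteristic_exponent (P 0) Psi.
Hypothesis sumL : lattice_summable L Psi.

(** By [PsiN] the terms of index [n] and [- n] are conjugate: the imaginary parts cancel and the
    real parts pair up. In particular the function is real. *)
Lemma phi_latticeE y : phi_lattice L Psi y = (phi0 (psi_ Psi L) (lam L 1 * y))%:C.
Proof.
rewrite /phi_lattice; set f := (X in csum _ X).
have dN n : dual_point L (- n) = - dual_point L n.
  by rewrite /dual_point mulrNz mulrN !mulNr.
have fE n : f n = (1 - cis (dual_point L n * y)) / Psi (dual_point L n).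
  by rewrite /f cexp_i.
have fN n : f (- n) = conjc (f n).
  rewrite !fE dN (PsiN levyP PsiE) mulNr.
  case: (Psi _) => a b; rewrite /cis cosN sinN /=.
  by apply/eqP; rewrite eq_complex/=; apply/andP; split; apply/eqP; rewrite !sqrrN; ring.
have ReE (k : nat) : Re (f k) = Re (psi_ Psi L k)^-1 -
    trig (psi_ Psi L k)^-1 (k%:R * (lam L 1 * y)).
  rewrite fE trigE mulrA -lamE -raddfB/= /psi_ /lam; congr Re; ring.
have cM := summable_phi_majorant (summable_psiV levyP PsiE sumL).
rewrite /csum csum_part_even; last 2 first.
- by move=> n; rewrite fN; case: (f n).
- rewrite (_ : (fun k => _) = fun k => `|om k.+1 * (Re (psi_ Psi L k.+1)^-1 -
    trig (psi_ Psi L k.+1)^-1 (k.+1%:R * (lam L 1 * y)))|); last first.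
    by apply/funext => k; rewrite ReE.
  apply/cvg_ex; eexists.
  apply: (cvg_series_shift (a := fun k => `|om k * (Re (psi_ Psi L k)^-1 -
    trig (psi_ Psi L k)^-1 (k%:R * (lam L 1 * y)))|)).
  apply: (cvg_series_dominated cM) => k; rewrite normr_id; exact: phi0_term.
rewrite csum_part_odd; last by move=> n; rewrite fN; case: (f n).
congr (_ +i* _); rewrite /phi0 [RHS]tsum_shift; last 2 first.
- apply: (cvg_series_dominated cM) => k; exact: phi0_term.
- by rewrite mul0r trig0 subrr mulr0.
by congr tsum; apply/funext => k; rewrite ReE.
Qed.

End phi_series.

Lemma X_right_cvg (R : realType) (w : pathspace R) (t : R) (u : R ^nat) : 0 <= t ->
  (forall n, t < u n) -> u n @[n --> \oo] --> t -> X (u n) w @[n --> \oo] --> X t w.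
Proof.
move=> t0 tu ut; have /cvg_at_rightP := cadlag_right (Defs.pathP (w : Defs.path R)) t0.
by apply.
Qed.

Lemma Exp_prod_indic d1 d2 (T1 : measurableType d1) (T2 : measurableType d2)
    (R : realType) (P1 : probability T1 R) (P2 : probability T2 R)
    (F : T1 -> R) (B : set (T1 * T2)) :
  bmfun F -> measurable B ->
  \int[(P1 \x P2)%E]_z (F z.1 * \1_B z) = \int[P1]_w (F w * fine (P2 (xsection B w))).
Proof.
move=> bF mB; pose f (z : T1 * T2) := F z.1 * \1_B z.
have bf : bmfun f.
  apply: bmfunM; last exact: bmfun_indic.
  split; first by apply: measurableT_comp; [exact: bF.1|exact: measurable_fst].
  by case: bF.2 => M FM; exists M.
have intf : (P1 \x P2)%E.-integrable setT (EFin \o f).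
  exact: (bmfun_integrable (P1 \x P2)%E bf).
rewrite /Rintegral -integral12_prod_meas1//; congr fine; apply: eq_integral => w _.
rewrite /fubini_F/=.
rewrite (_ : (fun y => _) = (fun y => (F w * \1_(xsection B w) y)%:E)); last first.
  by apply/funext => y; rewrite /f/= !indicE mem_xsection.
have mx := measurable_xsection w mB.
have b1 : bmfun (\1_(xsection B w) : T2 -> R) by exact: bmfun_indic.
by rewrite -EFin_Exp ?ExpZ ?Exp_indic//; exact: bmfunZ.
Qed.

Lemma cvg_real_complex (R : realType) (T : Type) (G : set_system T) (f : T -> R) (l : R) :
  Filter G -> f z @[z --> G] --> l -> ((f z)%:C : R[i]^o) @[z --> G] --> (l%:C : R[i]^o).
Proof.
move=> FG fl; apply/cvgrPdist_lt => eps eps0.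
(* In the order of [R[i]] a positive element is real. *)
have /andP[/eqP Ieps Reps] : (Im eps == 0) && (0 < Re eps).
  by move: eps0; case: (eps) => a b; rewrite ltcE/= eq_sym.
move/cvgrPdist_lt: fl => /(_ _ Reps); apply: filterS => z h.
rewrite -rmorphB/= normc_def/= expr0n/= addr0 sqrtr_sqr.
by rewrite ltcE/= Ieps eqxx.
Qed.

(** * Stopping the circle process *)

Section circle_process.
Context {R : realType} (P : R -> probability (pathspace R) R) (Psi : R -> R[i])
  (L : R).
Hypothesis levyP : levy_process P.
Hypothesis PsiE : characteristic_exponent (P 0) Psi.
Hypothesis L_gt0 : 0 < L.
Hypothesis sumL : lattice_summable L Psi.
Implicit Types (U F : pathspace R -> R) (q h a r s t th x : R).

Let ps := psi_ Psi L.
Let kap : R := lam L 1.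

Let ps0 : ps 0 = 0. Proof. exact: psi0 levyP PsiE L. Qed.
Let ps_ge0 n : 0 <= Re (ps n). Proof. exact: Psi_ge0 levyP PsiE _. Qed.
Let ps_neq0 n : (0 < n)%N -> ps n != 0.
Proof. exact: psi_neq0 levyP PsiE L sumL n. Qed.
Let summable_ps : cvgn (series (fun n => cmod (ps n)^-1)).
Proof. exact: summable_psiV levyP PsiE L sumL. Qed.

Local Notation chordL := (circ_chord L).
Local Notation level := (level chordL).
Local Notation Tlim := (Tlim chordL).

Let open_lev k : open (level k).
Proof. exact: open_level (@continuous_circ_chord R L) k. Qed.

Lemma measurable_wrt_X_circ a s (f : R -> R) : 0 <= s -> s <= a ->
  measurable_fun setT f ->
  measurable_wrt (natural_filtration a) (fun w => f (kap * X s w)).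
Proof.
move=> s0 sa mf; apply: (@measurable_wrt_X _ _ _ (fun y => f (kap * y))) => //.
by apply: measurableT_comp => //; exact: measurable_funM.
Qed.

Lemma bmfun_X_circ s (f : R -> R) : 0 <= s -> bmfun f -> bmfun (fun w => f (kap * X s w)).
Proof.
move=> s0 [mf [M fM]]; apply: (@bmfunP _ _ _ _ M) => //.
apply: (@measurable_wrt_measurable _ s).
exact: (measurable_wrt_X_circ s0 (lexx s) mf).
Qed.

Lemma bmfun_trig_circ (c : R[i]) n s : 0 <= s ->
  bmfun (fun w => trig c (n%:R * (kap * X s w))).
Proof.
by move=> s0; exact: bmfun_X_circ s0 (bmfun_trig_scale c n%:R).
Qed.

Lemma trig_markov_circ x (c : R[i]) n r h U : 0 <= r -> 0 <= h ->
  bmfun U -> measurable_wrt (natural_filtration r) U ->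
  \int[P x]_w (U w * trig c (n%:R * (kap * X (r + h) w))) =
  \int[P x]_w (U w * trig (c * cexp (- (h%:C * ps n))) (n%:R * (kap * X r w))).
Proof.
move=> r0 h0 bU mU; have E w s : n%:R * (kap * X s w) = lam L n * X s w.
  by rewrite mulrA /kap -lamE.
under eq_Rintegral do rewrite E.
rewrite (trig_markov levyP PsiE)//.
by apply: eq_Rintegral => w _; rewrite E.
Qed.

(* The resolvent [smooth_res] minus its discounted image at time [h], which is close
   to [h] times the Fejer kernel. *)
Definition gen_res q N h th : R :=
  \sum_(n < N) om n * fejer_weight N n *
    trig (rho ps q n * (1 - (expR (- (q * h)))%:C * cexp (- (h%:C * ps n)))) (n%:R * th).

Lemma bmfun_smooth_res q N : bmfun (smooth_res ps q N).
Proof.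
by apply: bmfun_sum => n; apply: bmfunZ; exact: bmfun_trig_scale.
Qed.

Lemma bmfun_gen_res q N h : bmfun (gen_res q N h).
Proof.
by apply: bmfun_sum => n; apply: bmfunZ; exact: bmfun_trig_scale.
Qed.

(** An exact identity: over one step the discounted coefficient of each mode is multiplied by
    [exp (- (q + psi n) h)], and [gen_res] collects the losses. *)
Lemma smooth_res_step x q N r h U : 0 <= r -> 0 <= h ->
  bmfun U -> measurable_wrt (natural_filtration r) U ->
  expR (- (q * h)) * \int[P x]_w (U w * smooth_res ps q N (kap * X (r + h) w)) =
  \int[P x]_w (U w * smooth_res ps q N (kap * X r w)) -
  \int[P x]_w (U w * gen_res q N h (kap * X r w)).
Proof.
move=> r0 h0 bU mU.
have rh0 : 0 <= r + h by exact: addr_ge0.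
have E s (c : nat -> R[i]) : 0 <= s ->
    \int[P x]_w (U w * \sum_(n < N) om n * fejer_weight N n * trig (c n) (n%:R * (kap * X s w))) =
    \sum_(n < N) om n * fejer_weight N n * \int[P x]_w (U w * trig (c n) (n%:R * (kap * X s w))).
  move=> s0.
  transitivity (\int[P x]_w (\sum_(n < N) om n * fejer_weight N n * (U w * trig (c n) (n%:R * (kap * X s w))))).
    by apply: eq_Rintegral => w _; rewrite mulr_sumr; apply: eq_bigr => n _; rewrite mulrCA.
  have b n : bmfun (fun w => U w * trig (c n) (n%:R * (kap * X s w))).
    by apply: bmfunM => //; exact: bmfun_trig_circ.
  rewrite Exp_sum; last by move=> n; exact: bmfunZ.
  by apply: eq_bigr => n _; rewrite ExpZ.
rewrite /smooth_res /gen_res (E _ (rho ps q) rh0) (E _ (rho ps q) r0).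
rewrite (E _ (fun n => rho ps q n * (1 - (expR (- (q * h)))%:C * cexp (- (h%:C * ps n)))) r0).
rewrite -sumrB mulr_sumr; apply: eq_bigr => n _.
rewrite trig_markov_circ// -mulrBr mulrCA; congr (_ * _).
have bU' c : bmfun (fun w => U w * trig c (n%:R * (kap * X r w))).
  by apply: bmfunM => //; exact: bmfun_trig_circ.
rewrite -ExpZ// -ExpB//; apply: eq_Rintegral => w _.
rewrite mulrCA -mulrBr -trigB; congr (_ * _).
set c := rho _ _ _; set z := cexp _; rewrite !trigE.
rewrite (_ : c - c * (1 - (expR (- (q * h)))%:C * z) = (expR (- (q * h)))%:C * (c * z)); last by ring.
by rewrite -(mulrA _ (c * z)) Re_realM.
Qed.

(** Up to [gen_err] every coefficient of [gen_res] equals [h], and equal coefficients reproduce [h]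
    times the Fejer kernel. The factor 2 bounds [om]. *)
Lemma gen_res_le q N h d th : 0 < q -> 0 < h -> (0 < N)%N -> 0 < d -> d <= chord th ->
  `|gen_res q N h th| <= h * (4 / (N%:R * d ^+ 2)) + 2 * \sum_(n < N) gen_err ps q n h.
Proof.
move=> q0 h0 N0 d0 dth.
have -> : gen_res q N h th = h * fejer N th +
    \sum_(n < N) om n * fejer_weight N n * trig (rho ps q n *
      (1 - (expR (- (q * h)))%:C * cexp (- (h%:C * ps n))) - h%:C) (n%:R * th).
  rewrite /fejer mulr_sumr -big_split/=; apply: eq_bigr => n _.
  have -> : cos (n%:R * th) = h^-1 * trig h%:C (n%:R * th).
    by rewrite /trig /= mul0r subr0 mulKf ?gt_eqF.
  rewrite trigB; set T := trig h%:C _; set c := om n * _.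
  by rewrite [h * _]mulrCA mulVKf ?gt_eqF// -mulrDr [T + _]addrC subrK.
apply: le_trans (ler_normD _ _) _; apply: lerD.
  by rewrite normrM (gtr0_norm h0) ler_wpM2l ?(ltW h0)// fejer_le.
apply: le_trans (ler_norm_sum _ _ _) _; rewrite mulr_sumr; apply: ler_sum => n _.
have /andP[f0 f1] := @fejer_weight_itv R N n (ltn_ord n).
rewrite normrM (ger0_norm (mulr_ge0 (om_ge0 n) f0)); apply: ler_pM => //.
- by rewrite mulr_ge0 ?om_ge0.
- by rewrite -[leRHS]mulr1 ler_pM ?om_ge0 ?om_le2.
- exact: trig_norm.
Qed.

Lemma measurable_wrt_avoid A a h j : open A -> 0 <= a -> 0 <= h ->
  measurable_wrt (natural_filtration (a + j%:R * h)) (avoid A a h j.+1).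
Proof.
move=> oA a0 h0; elim: j => [|j ih].
  rewrite (_ : avoid A a h 1 = fun w => \1_(~` A) (X (a + 0%:R * h) w)).
    apply: measurable_wrt_X => //; first by rewrite mul0r addr0.
    by apply: measurable_indic; apply: measurableC; exact: open_measurable.
  by apply/funext => w; rewrite /avoid big_ord1.
rewrite (_ : avoid A a h j.+2 = fun w => avoid A a h j.+1 w * \1_(~` A) (X (a + j.+1%:R * h) w)).
  apply: measurable_wrtM.
    apply: measurable_wrt_sub ih; rewrite lerD2l ler_wpM2r// ler_nat//.
  apply: measurable_wrt_X => //; first by rewrite addr_ge0// mulr_ge0.
  by apply: measurable_indic; apply: measurableC; exact: open_measurable.
by apply/funext => w; rewrite avoidS.
Qed.

Lemma measurable_wrt_enter A a h j : open A -> 0 <= a -> 0 <= h ->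
  measurable_wrt (natural_filtration (a + j%:R * h)) (enter A a h j).
Proof.
move=> oA a0 h0; apply: measurable_wrtM; last first.
  apply: measurable_wrt_X => //; first by rewrite addr_ge0// mulr_ge0.
  by apply: measurable_indic; exact: open_measurable.
case: j => [|j].
  rewrite (_ : avoid A a h 0 = cst 1); first exact: measurable_wrt_cst.
  by apply/funext => w; rewrite /avoid big_ord0.
apply: measurable_wrt_sub (@measurable_wrt_avoid A a h j oA a0 h0).
by rewrite lerD2l ler_wpM2r// ler_nat.
Qed.

Lemma bmfun_avoid A a h j : open A -> 0 <= a -> 0 <= h -> bmfun (avoid A a h j).
Proof.
move=> oA a0 h0; apply: (@bmfunP _ _ _ _ 1); last first.
  by move=> w; have /andP[v0 v1] := avoid_itv A a h j w; rewrite ger0_norm.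
case: j => [|j]; last exact: measurable_wrt_measurable (@measurable_wrt_avoid A a h j oA a0 h0).
rewrite (_ : avoid A a h 0 = cst 1); first exact: measurable_cst.
by apply/funext => w; rewrite /avoid big_ord0.
Qed.

Lemma bmfun_enter A a h j : open A -> 0 <= a -> 0 <= h -> bmfun (enter A a h j).
Proof.
move=> oA a0 h0; apply: (@bmfunP _ _ _ _ 1); last first.
  by move=> w; rewrite ger0_norm ?enter_ge0 ?enter_le1.
exact: measurable_wrt_measurable (@measurable_wrt_enter A a h j oA a0 h0).
Qed.

(** Optional stopping on the grid, by telescoping: at each step the paths still outside [A] split
    into those that enter now, which are frozen, and those that do not, which [smooth_res_step]
    moves one step ahead. *)
Lemma grid_stopping x q N A a h K U : open A -> 0 <= a -> 0 <= h ->
  bmfun U -> measurable_wrt (natural_filtration a) U ->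
  expR (- (q * a)) * \int[P x]_w (U w * smooth_res ps q N (kap * X a w)) =
  \sum_(j < K) expR (- (q * (a + j%:R * h))) *
    \int[P x]_w (U w * enter A a h j w * smooth_res ps q N (kap * X (a + j%:R * h) w)) +
  \sum_(j < K) expR (- (q * (a + j%:R * h))) *
    \int[P x]_w (U w * avoid A a h j.+1 w * gen_res q N h (kap * X (a + j%:R * h) w)) +
  expR (- (q * (a + K%:R * h))) *
    \int[P x]_w (U w * avoid A a h K w * smooth_res ps q N (kap * X (a + K%:R * h) w)).
Proof.
move=> oA a0 h0 bU mU; elim: K => [|K ih].
  rewrite !big_ord0 mul0r !addr0 !add0r; congr (_ * _).
  by apply: eq_Rintegral => w _; rewrite /avoid big_ord0 mulr1.
rewrite {}ih !big_ord_recr/=; set t := a + K%:R * h.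
have t0 : 0 <= t by rewrite addr_ge0// mulr_ge0.
have at_ : a <= t by rewrite lerDl mulr_ge0.
have bs : bmfun (fun w => smooth_res ps q N (kap * X t w)).
  by apply: bmfun_X_circ => //; exact: bmfun_smooth_res.
have bg : bmfun (fun w => gen_res q N h (kap * X t w)).
  by apply: bmfun_X_circ => //; exact: bmfun_gen_res.
have -> : \int[P x]_w (U w * avoid A a h K w * smooth_res ps q N (kap * X t w)) =
    \int[P x]_w (U w * enter A a h K w * smooth_res ps q N (kap * X t w)) +
    \int[P x]_w (U w * avoid A a h K.+1 w * smooth_res ps q N (kap * X t w)).
  rewrite -ExpD; last 2 first.
    by apply: bmfunM => //; apply: bmfunM => //; exact: bmfun_enter.
    by apply: bmfunM => //; apply: bmfunM => //; exact: bmfun_avoid.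
  by apply: eq_Rintegral => w _; rewrite avoid_enter; ring.
have bUv : bmfun (fun w => U w * avoid A a h K.+1 w).
  by apply: bmfunM => //; exact: bmfun_avoid.
have mUv : measurable_wrt (natural_filtration t) (fun w => U w * avoid A a h K.+1 w).
  apply: measurable_wrtM; first exact: measurable_wrt_sub mU.
  exact: measurable_wrt_avoid.
have tS : a + K.+1%:R * h = t + h by rewrite -natr1 mulrDl mul1r addrA.
have -> : expR (- (q * (a + K.+1%:R * h))) *
    \int[P x]_w (U w * avoid A a h K.+1 w * smooth_res ps q N (kap * X (a + K.+1%:R * h) w)) =
  expR (- (q * t)) * (\int[P x]_w (U w * avoid A a h K.+1 w * smooth_res ps q N (kap * X t w)) -
    \int[P x]_w (U w * avoid A a h K.+1 w * gen_res q N h (kap * X t w))).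
  rewrite -(smooth_res_step x q N t0 h0 bUv mUv) mulrA -expRD tS.
  by congr (expR _ * _); ring.
by ring.
Qed.

(** A geometric sum of ratio [exp (- q h) <= 1 / (1 + q h)]; it bounds the discounted number of
    steps. *)
Lemma sum_expR_grid_le q a h K : 0 < q -> 0 <= a -> 0 < h ->
  \sum_(j < K) expR (- (q * (a + j%:R * h))) <= (1 + q * h) / (q * h).
Proof.
move=> q0 a0 h0; have qh0 : 0 < q * h by rewrite mulr_gt0.
apply: (@le_trans _ _ (\sum_(j < K) expR (- (q * h)) ^+ j)).
  apply: ler_sum => j _; rewrite -expRM_natl ler_expR mulrN lerN2 mulrDr.
  by rewrite mulrCA lerDr mulr_ge0// ltW.
have z1 : expR (- (q * h)) <= (1 + q * h)^-1.
  by rewrite expRN lef_pV2 ?posrE ?expR_gt0 ?addr_gt0//; exact: expR_ge1Dx.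
have z0 := expR_ge0 (- (q * h)); move: (expR _) z0 z1 => z z0.
rewrite -[leRHS]mul1r ler_pdivlMr ?addr_gt0// => z1.
have zN : (1 - z) * \sum_(j < K) z ^+ j <= 1.
  by have := subrX1 z K; have := exprn_ge0 K z0; lra.
have S0 : 0 <= \sum_(j < K) z ^+ j by apply: sumr_ge0 => j _; exact: exprn_ge0.
rewrite ler_pdivlMr//; move: (\sum_(j < K) _) (q * h) zN S0 qh0 z1 => S y zN S0 y0 z1.
have h1 : 0 <= S * (1 - z * (1 + y)) by rewrite mulr_ge0// subr_ge0.
have h2 : 0 <= (1 + y) * (1 - (1 - z) * S) by rewrite mulr_ge0 ?subr_ge0// addr_ge0// ltW.
by nra.
Qed.

(** The three errors are the oscillation between the entrance point and the lattice, the generator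
    terms collected outside the neighbourhood, and the paths still running at the horizon. *)
Lemma grid_stopping_le x q N k a h K U (M : R) : 0 < q -> (0 < N)%N -> 0 <= a -> 0 < h ->
  bmfun U -> measurable_wrt (natural_filtration a) U -> (forall w, `|U w| <= M) ->
  `|expR (- (q * a)) * \int[P x]_w (U w * smooth_res ps q N (kap * X a w)) -
    smooth_res ps q N 0 * \int[P x]_w (U w * grid_sum q (level k) a h K (cst 1) w)| <=
  M * (modulus ps q (mesh k) +
    (h * (4 / (N%:R * mesh k ^+ 2)) + 2 * \sum_(n < N) gen_err ps q n h) *
      ((1 + q * h) / (q * h)) +
    expR (- (q * (a + K%:R * h))) * tsum (majorant ps q)).
Proof.
move=> q0 N0 a0 h0 bU mU UM.
have h0' := ltW h0; have oA := @open_lev k.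
have M0 : 0 <= M by have w0 : pathspace R := point; exact: le_trans (UM w0).
have t0 j : 0 <= a + j%:R * h by rewrite addr_ge0// mulr_ge0.
have bs j : bmfun (fun w => smooth_res ps q N (kap * X (a + j%:R * h) w)).
  by apply: bmfun_X_circ => //; exact: bmfun_smooth_res.
have bg j : bmfun (fun w => gen_res q N h (kap * X (a + j%:R * h) w)).
  by apply: bmfun_X_circ => //; exact: bmfun_gen_res.
have be j : bmfun (enter (level k) a h j) by exact: bmfun_enter.
have ba j : bmfun (avoid (level k) a h j) by exact: bmfun_avoid.
rewrite (@grid_stopping x q N (level k) a h K U)//.
have -> : smooth_res ps q N 0 * \int[P x]_w (U w * grid_sum q (level k) a h K (cst 1) w) =
    \sum_(j < K) expR (- (q * (a + j%:R * h))) *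
      \int[P x]_w (U w * enter (level k) a h j w * smooth_res ps q N 0).
  transitivity (\int[P x]_w \sum_(j < K) expR (- (q * (a + j%:R * h))) *
      (U w * enter (level k) a h j w * smooth_res ps q N 0)).
    rewrite -ExpZ; last first.
      apply: bmfunM => //; apply: bmfun_sum => j; apply: bmfunM; last exact: bmfun_cst.
      by apply: bmfunZ.
    apply: eq_Rintegral => w _; rewrite /grid_sum mulrA mulr_sumr.
    by apply: eq_bigr => j _; rewrite /=; ring.
  rewrite Exp_sum; last first.
    by move=> j; apply: bmfunZ; apply: bmfunM; [exact: bmfunM|exact: bmfun_cst].
  by apply: eq_bigr => j _; rewrite ExpZ//; apply: bmfunM; [exact: bmfunM|exact: bmfun_cst].
have regroup (u v y z : R) : u + v + y - z = (u - z) + (v + y) by ring.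
rewrite regroup -sumrB.
apply: le_trans (ler_normD _ _) _; rewrite -(addrA (modulus _ _ _)) [leRHS]mulrDr; apply: lerD.
  have bd j : bmfun (fun w => smooth_res ps q N (kap * X (a + j%:R * h) w) - smooth_res ps q N 0).
    by apply: bmfunB => //; exact: bmfun_cst.
  have bD j : bmfun (fun w => expR (- (q * (a + j%:R * h))) * (U w * enter (level k) a h j w *
      (smooth_res ps q N (kap * X (a + j%:R * h) w) - smooth_res ps q N 0))).
    by apply: bmfunZ; apply: bmfunM => //; exact: bmfunM.
  rewrite (eq_bigr (fun j : 'I_K => \int[P x]_w (expR (- (q * (a + j%:R * h))) *
    (U w * enter (level k) a h j w *
      (smooth_res ps q N (kap * X (a + j%:R * h) w) - smooth_res ps q N 0))))); last first.
    move=> j _; rewrite ExpZ; last by apply: bmfunM => //; exact: bmfunM.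
    rewrite -mulrBr -ExpB; last 2 first.
    - by apply: bmfunM => //; exact: bmfunM.
    - by apply: bmfunM; [exact: bmfunM|exact: bmfun_cst].
    by congr (_ * _); apply: eq_Rintegral => w _; rewrite mulrBr.
  rewrite -Exp_sum//; apply: Exp_norm_le; first exact: bmfun_sum.
  move=> w; apply: le_trans (ler_norm_sum _ _ _) _.
  have m0 : 0 <= modulus ps q (mesh k).
    apply: le_trans (normr_ge0 _) (@smooth_res_modulus _ ps ps0 ps_ge0 ps_neq0 summable_ps q N 0 (mesh k) q0 _).
    by rewrite /chord cis0 subrr /cmod normr0 ltW// mesh_gt0.
  apply: (@le_trans _ _ (\sum_(j < K) M * modulus ps q (mesh k) * enter (level k) a h j w)).
    apply: ler_sum => j _; rewrite normrM (ger0_norm (expR_ge0 _)) -[leRHS]mul1r.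
    apply: ler_pM; [exact: expR_ge0|exact: normr_ge0|by rewrite expR_le1 oppr_le0 mulr_ge0// ltW|].
    rewrite /enter indicE; have [/set_mem Aj|_] := boolP (_ \in _); last first.
      by rewrite !mulr0 mul0r normr0.
    have /andP[v0 v1] := avoid_itv (level k) a h j w.
    rewrite mulr1 !normrM (ger0_norm v0) mulrAC ler_wpM2r// ler_pM//.
    by apply: smooth_res_modulus => //; exact: ltW Aj.
  rewrite -mulr_sumr sum_enter -[leRHS]mulr1 ler_wpM2l ?mulr_ge0//.
  by have /andP[v0 v1] := avoid_itv (level k) a h K w; rewrite gerBl.
apply: le_trans (ler_normD _ _) _; rewrite [leRHS]mulrDr; apply: lerD.
  apply: le_trans (ler_norm_sum _ _ _) _.
  set C := (X in _ * (X * _)); have C0 : 0 <= C.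
    rewrite addr_ge0// mulr_ge0// ?divr_ge0 ?mulr_ge0 ?exprn_ge0 ?(ltW (mesh_gt0 _))//.
    by apply: sumr_ge0 => n _; exact: cmod_ge0.
  apply: (@le_trans _ _ (\sum_(j < K) expR (- (q * (a + j%:R * h))) * (M * C))).
    apply: ler_sum => j _; rewrite normrM (ger0_norm (expR_ge0 _)) ler_wpM2l ?expR_ge0//.
    apply: Exp_norm_le; first by apply: bmfunM => //; exact: bmfunM.
    (* The index [j.+1] includes the current grid point: it lies outside [level k], where the Fejer
       bound holds with [d = mesh k]. *)
    move=> w; rewrite avoidS indicE in_setC.
    have [/set_mem Aj|/negP Aj] /= := boolP (_ \in _); first by rewrite mulr0 mulr0 mul0r normr0 mulr_ge0.
    have /andP[v0 v1] := avoid_itv (level k) a h j w.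
    rewrite mulr1 normrM ler_pM//.
      by rewrite normrM (ger0_norm v0) -[leRHS]mulr1 ler_pM.
    apply: gen_res_le => //; first exact: mesh_gt0.
    by rewrite leNgt; apply/negP => h1; apply: Aj; rewrite inE.
  rewrite -mulr_suml mulrC -mulrA ler_wpM2l// ler_wpM2l//.
  exact: sum_expR_grid_le.
rewrite normrM (ger0_norm (expR_ge0 _)) mulrCA ler_wpM2l ?expR_ge0//.
apply: Exp_norm_le; first by apply: bmfunM => //; exact: bmfunM.
move=> w; have /andP[v0 v1] := avoid_itv (level k) a h K w.
rewrite normrM ler_pM//; last exact: smooth_res_bounded.
by rewrite normrM (ger0_norm v0) -[leRHS]mulr1 ler_pM.
Qed.

Lemma grid_sum_norm_le q A a h K k (B : R) w : 0 < q -> 0 <= a -> 0 <= h -> 0 <= B ->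
  (forall t, `|k t| <= B) -> `|grid_sum q A a h K k w| <= B.
Proof.
move=> q0 a0 h0 B0 kB; apply: le_trans (ler_norm_sum _ _ _) _.
apply: (@le_trans _ _ (\sum_(j < K) enter A a h j w * B)).
  apply: ler_sum => j _; rewrite normrM; apply: ler_pM => //.
  rewrite normrM (ger0_norm (enter_ge0 _ _ _ _ _)) (ger0_norm (expR_ge0 _)).
  rewrite -[leRHS]mul1r ler_wpM2r ?enter_ge0// expR_le1 oppr_le0.
  by rewrite mulr_ge0 ?(ltW q0)// addr_ge0// mulr_ge0.
rewrite -mulr_suml sum_enter -[leRHS]mul1r ler_wpM2r//.
by have /andP[v0 _] := avoid_itv A a h K w; rewrite gerBl.
Qed.

Lemma bmfun_grid_sum q A a h K : 0 <= a -> 0 <= h -> open A ->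
  bmfun (grid_sum q A a h K (cst 1)).
Proof.
move=> a0 h0 oA; apply: bmfun_sum => j; apply: bmfunM; last exact: bmfun_cst.
by apply: bmfunZ; exact: bmfun_enter.
Qed.

Lemma Exp_mul_cvg x U (f_ : nat -> pathspace R -> R) f (M B : R) :
  bmfun U -> (forall w, `|U w| <= M) ->
  (forall n, measurable_fun setT (f_ n)) -> (forall n w, `|f_ n w| <= B) ->
  (forall w, f_ n w @[n --> \oo] --> f w) ->
  \int[P x]_w (U w * f_ n w) @[n --> \oo] --> \int[P x]_w (U w * f w).
Proof.
move=> bU UM mf fB ff.
have := @Exp_cvg _ _ R (P x) (fun n w => U w * f_ n w) (fun w => U w * f w) (M * B).
case=> //.
- by move=> n; apply: measurable_funM => //; exact: bU.1.
- by move=> n w; rewrite normrM ler_pM.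
- by move=> w; apply: cvgM => //; exact: cvg_cst.
Qed.

(** The mesh tends to 0 with [N] and [k] fixed: [gen_err / h] vanishes, while the Fejer term keeps
    the value [C0 / q], its factor [h] being absorbed by the [1 / (q h)] steps. *)
Lemma smooth_res_hit_le x q N k a U (M : R) : 0 < q -> (0 < N)%N -> 0 <= a ->
  bmfun U -> measurable_wrt (natural_filtration a) U -> (forall w, `|U w| <= M) ->
  `|expR (- (q * a)) * \int[P x]_w (U w * smooth_res ps q N (kap * X a w)) -
    smooth_res ps q N 0 * \int[P x]_w (U w * lapl q (hit a (level k) w))| <=
  M * (modulus ps q (mesh k) + 4 / (N%:R * mesh k ^+ 2) / q).
Proof.
move=> q0 N0 a0 bU mU UM.
pose D m := \int[P x]_w (U w * grid q (level k) a m (cst 1) w).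
have cD : D m @[m --> \oo] --> \int[P x]_w (U w * lapl q (hit a (level k) w)).
  apply: (@Exp_mul_cvg _ _ _ _ M 1) => //.
  - by move=> m; apply: (bmfun_grid_sum _ _ _ _ _).1 => //; exact/ltW/mesh_gt0.
  - move=> m w; apply: grid_sum_norm_le => //; first exact/ltW/mesh_gt0.
    by move=> t /=; rewrite normr1.
  - by move=> w; apply: grid_cvg => //; exact: open_lev.
set c := expR _ * _; set v0 := smooth_res _ _ _ _.
pose C0 := 4 / (N%:R * mesh k ^+ 2) : R.
pose ge m := \sum_(n < N) (gen_err ps q n (mesh m) / mesh m).
pose rhs m := M * (modulus ps q (mesh k) + (C0 + 2 * ge m) * ((1 + q * mesh m) / q) +
  mesh m / q * tsum (majorant ps q)).
have m0 := @mesh_cvg0 R.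
have cge : ge m @[m --> \oo] --> 0.
  rewrite [X in _ --> X](_ : _ = \sum_(n < N) 0); last by rewrite big1.
  apply: cvg_big => [|n _]; first exact: add_continuous.
  by apply: gen_err_cvg0 => //; exact: mesh_gt0.
have crhs : rhs m @[m --> \oo] --> M * (modulus ps q (mesh k) + C0 / q).
  rewrite [X in _ --> X](_ : _ = M * (modulus ps q (mesh k) + (C0 + 2 * 0) * ((1 + q * 0) / q) +
    0 / q * tsum (majorant ps q))); last by rewrite !(mulr0, mul0r, addr0) mul1r.
  apply: cvgM; first exact: cvg_cst.
  apply: cvgD; last first.
    by apply: cvgM; last exact: cvg_cst; apply: cvgM; last exact: cvg_cst.
  apply: cvgD; first exact: cvg_cst.
  apply: cvgM.
    apply: cvgD; first exact: cvg_cst.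
    by apply: cvgM => //; exact: cvg_cst.
  apply: cvgM; last exact: cvg_cst.
  apply: cvgD; first exact: cvg_cst.
  by apply: cvgM => //; exact: cvg_cst.
have clhs : `|c - v0 * D m| @[m --> \oo] -->
    `|c - v0 * \int[P x]_w (U w * lapl q (hit a (level k) w))|.
  apply: cvg_norm; apply: cvgB; first exact: cvg_cst.
  by apply: cvgM => //; exact: cvg_cst.
apply: (ler_cvg_to clhs crhs); apply: nearW => m.
have hm := @mesh_gt0 R m; have hm' : mesh m != 0 :> R by rewrite gt_eqF.
have M0 : 0 <= M by have w0 : pathspace R := point; exact: le_trans (UM w0).
have := grid_stopping_le x k (m.+1 ^ 2) q0 N0 a0 hm bU mU UM.
rewrite -/ps -/kap -/c -/v0 -/(D m); move/le_trans; apply.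
rewrite ler_wpM2l// -!addrA lerD2l; apply: lerD.
  rewrite le_eqVlt; apply/orP; left; apply/eqP.
  rewrite /ge -mulr_suml -/C0; field.
  by rewrite hm' gt_eqF.
have t0 : 0 <= tsum (majorant ps q).
  exact: le_trans (normr_ge0 _) (circ_res_bounded ps0 ps_ge0 ps_neq0 summable_ps 0 q0).
(* The horizon is at time [a + (m + 1)], where [1 + y <= exp y] bounds the discount by
   [mesh m / q]. *)
rewrite ler_wpM2r// expRN /mesh -invfM lef_pV2 ?posrE ?expR_gt0 ?mulr_gt0//.
apply: le_trans (expR_ge1Dx _); rewrite natrX expr2 mulfK ?pnatr_eq0//.
by rewrite mulrDr [m.+1%:R * q]mulrC addrA lerDr addr_ge0// mulr_ge0// ltW.
Qed.

Lemma lapl_bounded q y : 0 < q -> (0 <= y)%E -> `|lapl q y| <= 1.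
Proof. by move=> q0 y0; have /andP[? ?] := lapl_itv q0 y0; rewrite ger0_norm. Qed.

Lemma measurable_lapl_hit q A a : 0 < q -> 0 <= a -> open A ->
  measurable_fun setT (fun w => lapl q (hit a A w)).
Proof.
move=> q0 a0 oA; apply: (@measurable_fun_cvg _ _ _ setT (fun m => grid q A a m (cst 1))).
  by move=> m; apply: (bmfun_grid_sum _ _ _ _ _).1 => //; exact/ltW/mesh_gt0.
by move=> w _; exact: grid_cvg.
Qed.

(** Letting [N] tend to infinity removes the Fejer term at fixed [k]; the modulus, uniform in [N],
    is what remains. *)
Lemma circ_res_hit_le x q k a U (M : R) : 0 < q -> 0 <= a ->
  bmfun U -> measurable_wrt (natural_filtration a) U -> (forall w, `|U w| <= M) ->
  `|expR (- (q * a)) * \int[P x]_w (U w * circ_res ps q (kap * X a w)) -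
    circ_res ps q 0 * \int[P x]_w (U w * lapl q (hit a (level k) w))| <=
  M * modulus ps q (mesh k).
Proof.
move=> q0 a0 bU mU UM; set I := \int[P x]_w _.
set J := (X in _ - _ * X).
have cI : \int[P x]_w (U w * smooth_res ps q N (kap * X a w)) @[N --> \oo] --> I.
  apply: (@Exp_mul_cvg _ _ _ _ M (tsum (majorant ps q))) => //.
  - by move=> N; apply: (bmfun_X_circ _ _).1 => //; exact: bmfun_smooth_res.
  - by move=> N w; exact: smooth_res_bounded.
  - by move=> w; exact: smooth_res_cvg.
pose C0 := 4 / mesh k ^+ 2 / q : R.
have crhs : M * (modulus ps q (mesh k) + C0 * mesh N) @[N --> \oo] --> M * (modulus ps q (mesh k)).
  apply: cvgM; first exact: cvg_cst.
  rewrite -[X in _ --> X]addr0; apply: cvgD; first exact: cvg_cst.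
  by rewrite -[X in _ --> X](mulr0 C0); apply: cvgM; [exact: cvg_cst|exact: mesh_cvg0].
have clhs : `|expR (- (q * a)) * \int[P x]_w (U w * smooth_res ps q N.+1 (kap * X a w)) -
    smooth_res ps q N.+1 0 * J| @[N --> \oo] --> `|expR (- (q * a)) * I - circ_res ps q 0 * J|.
  apply: cvg_norm; apply: cvgB; apply: cvgM; try exact: cvg_cst.
    by have := cI; rewrite -(cvg_shiftS (fun N => \int[P x]_w (U w * smooth_res ps q N (kap * X a w)))).
  have := @smooth_res_cvg _ ps ps0 ps_ge0 ps_neq0 summable_ps q 0 q0.
  by rewrite -(cvg_shiftS (fun N => smooth_res ps q N 0)).
apply: (ler_cvg_to clhs crhs); apply: nearW => N.
have := smooth_res_hit_le x k q0 (ltn0Sn N) a0 bU mU UM.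
move/le_trans; apply; rewrite le_eqVlt; apply/orP; left; apply/eqP.
by rewrite /C0 -[mesh N]/(N.+1%:R^-1) (invfM N.+1%:R); ring.
Qed.

Lemma lapl_Tlim_cvg x q a U (M : R) : 0 < q -> 0 <= a ->
  bmfun U -> (forall w, `|U w| <= M) ->
  \int[P x]_w (U w * lapl q (hit a (level k) w)) @[k --> \oo] -->
  \int[P x]_w (U w * lapl q (Tlim a w)).
Proof.
move=> q0 a0 bU UM; apply: (@Exp_mul_cvg _ _ _ _ M 1) => //.
- by move=> k; apply: measurable_lapl_hit => //; exact: open_lev.
- move=> k w; apply: lapl_bounded => //.
  by apply: le_trans (hit_ge _ _ _); rewrite lee_fin.
- by move=> w; exact: lapl_hit_cvg.
Qed.

Lemma circ_res_Tlim x q a U (M : R) : 0 < q -> 0 <= a ->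
  bmfun U -> measurable_wrt (natural_filtration a) U -> (forall w, `|U w| <= M) ->
  expR (- (q * a)) * \int[P x]_w (U w * circ_res ps q (kap * X a w)) =
  circ_res ps q 0 * \int[P x]_w (U w * lapl q (Tlim a w)).
Proof.
move=> q0 a0 bU mU UM; apply/eqP; rewrite -subr_eq0 -normr_le0.
set c := expR _ * _.
have clhs : `|c - circ_res ps q 0 * \int[P x]_w (U w * lapl q (hit a (level k) w))| @[k --> \oo] -->
    `|c - circ_res ps q 0 * \int[P x]_w (U w * lapl q (Tlim a w))|.
  apply: cvg_norm; apply: cvgB; first exact: cvg_cst.
  by apply: cvgM; [exact: cvg_cst|exact: lapl_Tlim_cvg UM].
have crhs : M * modulus ps q (mesh k) @[k --> \oo] --> 0.
  rewrite -(mulr0 M); apply: cvgM; first exact: cvg_cst.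
  by apply: modulus_cvg0 => //; [move=> k; exact/ltW/mesh_gt0|exact: mesh_cvg0].
apply: (ler_cvg_to clhs crhs); apply: nearW => k.
exact: circ_res_hit_le.
Qed.

(** * Quasi-left-continuity at the limit of the entrance times *)

Lemma circ_chord_sqr y : chordL y ^+ 2 = 2 - 2 * trig 1 (1%:R * (kap * y)).
Proof. by rewrite chord_sqr /trig/= !mul1r mul0r subr0. Qed.

Let overshoot_term q k i s (j : nat) : 0 <= s ->
  bmfun (fun w => expR (- (q * (0 + j%:R * mesh i))) *
    enter (level k) 0 (mesh i) j w * chordL (X (0 + j%:R * mesh i + s) w) ^+ 2).
Proof.
move=> s0; have h0 := ltW (@mesh_gt0 R i).
apply: bmfunM; first by apply: bmfunZ; exact: bmfun_enter.
rewrite (_ : (fun w => _) = fun w => 2 - 2 * trig 1 (1%:R * (kap * X (0 + j%:R * mesh i + s) w))); last first.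
  by apply/funext => w; exact: circ_chord_sqr.
apply: bmfunB; [exact: bmfun_cst|apply: bmfunZ; apply: bmfun_trig_circ].
by rewrite add0r addr_ge0// mulr_ge0.
Qed.

(** The squared chord involves only the modes 0 and 1, so its mean a time [s] after a grid time is
    explicit by [trig_markov_circ]. Summing over the first entrance costs no more than one term,
    since the events [enter] are disjoint. *)
Lemma overshoot_le x q k i s : 0 < q -> 0 <= s ->
  \int[P x]_w grid q (level k) 0 i (fun t => chordL (X (t + s) w) ^+ 2) w <=
  2 * mesh k + 2 * cmod (1 - cexp (- (s%:C * ps 1))).
Proof.
move=> q0 s0; set c := cexp _; pose h : R := mesh i; set A := level k.
have h0 : 0 <= h by exact/ltW/mesh_gt0.
have oA : open A by exact: open_lev.
have t0 (j : nat) : 0 <= 0 + j%:R * h by rewrite add0r mulr_ge0.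
have be j : bmfun (enter A 0 h j) by exact: bmfun_enter.
have bT c' t : 0 <= t -> bmfun (fun w => trig c' (1%:R * (kap * @X R t w))).
  by move=> t1; exact: (bmfun_trig_circ c' 1 t1).
rewrite /grid /grid_sum -/h Exp_sum; last by move=> j; exact: overshoot_term.
set B := 2 * _ + _; have B0 : 0 <= B.
  by rewrite addr_ge0// mulr_ge0 ?cmod_ge0// ltW// mesh_gt0.
apply: (@le_trans _ _ (\sum_(j < i.+1 ^ 2) \int[P x]_w (B * enter A 0 h j w))); last first.
  rewrite -Exp_sum; last by move=> j; exact: bmfunZ.
  rewrite -[leRHS](Exp_cst (P x)); apply: le_Exp.
  - by apply: bmfun_sum => j; exact: bmfunZ.
  - exact: bmfun_cst.
  - move=> w; rewrite -mulr_sumr sum_enter -[leRHS]mulr1 ler_wpM2l//.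
    by have /andP[v0 _] := avoid_itv A 0 h (i.+1 ^ 2) w; rewrite gerBl.
apply: ler_sum => j _; set t := 0 + _.
have tt0 : 0 <= t by exact: t0.
pose U w := expR (- (q * t)) * enter A 0 h j w.
have bU : bmfun U by exact: bmfunZ.
have mU : measurable_wrt (natural_filtration t) U.
  apply: measurable_wrtM; first exact: measurable_wrt_cst.
  exact: measurable_wrt_enter.
have bUT c' u : 0 <= u -> bmfun (fun w => U w * trig c' (1%:R * (kap * X u w))).
  by move=> u0; apply: bmfunM => //; exact: bT.
have -> : \int[P x]_w (U w * chordL (X (t + s) w) ^+ 2) =
    \int[P x]_w (2 * U w - 2 * (U w * trig c (1%:R * (kap * X t w)))).
  transitivity (\int[P x]_w (2 * U w - 2 * (U w * trig 1 (1%:R * (kap * X (t + s) w))))).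
    by apply: eq_Rintegral => w _; rewrite circ_chord_sqr; ring.
  have bUs := bUT 1 (t + s) (addr_ge0 tt0 s0); have bUt := bUT c t tt0.
  rewrite !ExpB ?ExpZ//; try exact: bmfunZ.
  by rewrite trig_markov_circ// mul1r.
apply: le_Exp; first by apply: bmfunB; apply: bmfunZ => //; exact: bUT.
  exact: bmfunZ.
move=> w; rewrite /U /enter indicE; have [/set_mem Aj|_] := boolP (_ \in A); last first.
  by rewrite !(mulr0, mul0r) subrr.
have /andP[v0 v1] := avoid_itv A 0 h j w; rewrite mulr1.
set th := 1%:R * _; have cA : chord th <= mesh k.
  by rewrite /th mul1r; exact: ltW Aj.
(* Since [1 - c * cis th = (1 - cis th) + cis th * (1 - c)], the first part is the chord at entrance
   and the second the change of the mode during [s]. *)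
have key : 2 - 2 * trig c th <= B.
  rewrite trigE; have -> : 2 - 2 * Re (c * cis th) = 2 * Re ((1 - cis th) + cis th * (1 - c)).
    by case: (c) (cis th) => c1 c2 [d1 d2] /=; ring.
  rewrite /B -mulrDr ler_wpM2l//; apply: le_trans (ler_norm _) _.
  apply: le_trans (normRe_cmod _) _; apply: le_trans (cmodD _ _) _.
  rewrite cmodM cmod_cis mul1r lerD2r; apply: le_trans cA.
  by rewrite /chord -[leRHS](cmodN) opprB.
set e := expR _; have e0 : 0 <= e by exact: expR_ge0.
have e1 : e <= 1 by rewrite expR_le1 oppr_le0 mulr_ge0// ltW.
rewrite (_ : _ - _ = e * avoid A 0 h j w * (2 - 2 * trig c th)); last by ring.
rewrite mulrC; apply: ler_pM => //.
- have c1 : cmod c <= 1 by apply: cmod_cexp; rewrite Re_realM mulr_ge0.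
  by have := le_trans (ler_norm _) (le_trans (trig_norm c th) c1); lra.
- by rewrite mulr_ge0.
- by rewrite -[leRHS]mul1r ler_pM.
Qed.

Lemma cexp_scale_cvg (z : R[i]) :
  cmod (1 - cexp (- ((mesh m)%:C * z))) @[m --> \oo] --> 0.
Proof.
case: z => a b.
have m0 := @mesh_cvg0 R.
have ma : - (mesh m * a) @[m --> \oo] --> 0.
  by rewrite -[X in _ --> X]oppr0 -[X in - X](mul0r a); apply: cvgN; apply: cvgM => //; exact: cvg_cst.
have mb : mesh m * b @[m --> \oo] --> 0.
  by rewrite -[X in _ --> X](mul0r b); apply: cvgM => //; exact: cvg_cst.
have ce : expR (- (mesh m * a)) @[m --> \oo] --> (1 : R).
  by rewrite -expR0; apply: (@cvg_comp _ _ _ (fun m => - (mesh m * a)) (@expR R) _ (nbhs 0)) => //; exact: continuous_expR.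
have cc : cos (mesh m * b) @[m --> \oo] --> (1 : R).
  by rewrite -cos0; apply: (@cvg_comp _ _ _ (fun m => mesh m * b) (@cos R) _ (nbhs 0)) => //; exact: continuous_cos.
have cs : sin (mesh m * b) @[m --> \oo] --> (0 : R).
  by rewrite -sin0; apply: (@cvg_comp _ _ _ (fun m => mesh m * b) (@sin R) _ (nbhs 0)) => //; exact: continuous_sin.
apply: (@squeeze_cvgr _ _ _ _ (fun=> 0) (fun m => `|1 - expR (- (mesh m * a)) * cos (mesh m * b)| +
   `|expR (- (mesh m * a)) * sin (mesh m * b)|)).
- apply: nearW => m; rewrite cmod_ge0/=; apply: le_trans (cmod_le_ReIm _) _.
  rewrite /cexp/= !(mul0r, subr0, addr0) cosN sinN sub0r mulrN opprK.
  exact: lexx.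
- exact: cvg_cst.
- rewrite -[X in _ --> X]addr0; apply: cvgD; apply/norm_cvg0P.
  + rewrite -[X in _ --> X](subrr 1); apply: cvgB; first exact: cvg_cst.
    by rewrite -[X in _ --> X](mulr1 1); exact: cvgM.
  + by rewrite -[X in _ --> X](mulr0 1); exact: cvgM.
Qed.

(* Quasi-left-continuity: by the Markov property on the grid, the squared distance
   to the lattice at time [mesh m] after the entrance into [level k] has a mean
   that vanishes when first [k] and then [m] tend to infinity. *)
Lemma chord_at_Tlim x : exists N : set (pathspace R),
  [/\ measurable N, P x N = 0%E &
      forall w, ~ N w -> forall r, Tlim 0 w = r%:E -> chordL (X r w) = 0].
Proof.
pose f m k i (w : pathspace R) : \bar R :=
  (grid 1 (level k) 0 i (fun t => chordL (X (t + mesh m) w) ^+ 2) w)%:E.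
have bf m k i : bmfun (fun w => grid 1 (level k) 0 i (fun t => chordL (X (t + mesh m) w) ^+ 2) w).
  by apply: bmfun_sum => j; apply: overshoot_term; exact/ltW/mesh_gt0.
have f0 m k i w : (0 <= f m k i w)%E.
  rewrite lee_fin; apply: sumr_ge0 => j _.
  by apply: mulr_ge0; [apply: mulr_ge0; [exact: expR_ge0|exact: enter_ge0]|exact: sqr_ge0].
have mf m k i : measurable_fun setT (f m k i) by apply/measurable_EFinP; exact: (bf m k i).1.
(* The nesting is that of [Tlim_overshoot], with one use of Fatou's lemma per index. The last lower
   limit has integral 0, but would be positive on any path off the lattice at a finite [Tlim]. *)
pose f1 m k w := limn_einf (fun i => f m k i w).
pose f2 m w := limn_einf (fun k => f1 m k w).
pose f3 w := limn_einf (fun m => f2 m w).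
pose c m := cmod (1 - cexp (- ((mesh m)%:C * ps 1))) : R.
have I1 m k : (\int[P x]_w f1 m k w <= (2 * mesh k + 2 * c m)%:E)%E.
  apply: (@fatou_le _ _ _ (P x) (f m k) (fun=> 2 * mesh k + 2 * c m)) => //; last exact: cvg_cst.
  move=> i; rewrite -EFin_Exp// lee_fin; apply: overshoot_le => //.
  exact/ltW/mesh_gt0.
have I2 m : (\int[P x]_w f2 m w <= (2 * c m)%:E)%E.
  apply: (@fatou_le _ _ _ (P x) (f1 m) (fun k => 2 * mesh k + 2 * c m)) => //.
  - by move=> k; exact: measurable_limn_einf.
  - by move=> k w; exact: limn_einf_ge0.
  - rewrite -[X in _ --> X]add0r; apply: cvgD; last exact: cvg_cst.
    by rewrite -(mulr0 2); apply: cvgM; [exact: cvg_cst|exact: mesh_cvg0].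
have I3 : (\int[P x]_w f3 w <= 0)%E.
  apply: (@fatou_le _ _ _ (P x) f2 (fun m => 2 * c m)) => //.
  - by move=> m; apply: measurable_limn_einf => k; exact: measurable_limn_einf.
  - by move=> m w; apply: limn_einf_ge0 => k; exact: limn_einf_ge0.
  - by rewrite -(mulr0 2); apply: cvgM; [exact: cvg_cst|exact: cexp_scale_cvg].
have f30 w : (0 <= f3 w)%E by do 2 apply: limn_einf_ge0 => ?; exact: limn_einf_ge0.
have mf3 : measurable_fun setT f3.
  by apply: measurable_limn_einf => m; apply: measurable_limn_einf => k; exact: measurable_limn_einf.
have I0 : (\int[P x]_w `|f3 w| = 0)%E.
  apply/eqP; rewrite eq_le integral_ge0// andbT; apply: le_trans I3.
  by rewrite le_eqVlt; apply/orP; left; apply/eqP; apply: eq_integral => w _; rewrite gee0_abs.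
have mN : measurable [set w | f3 w <> 0%E].
  have := mf3 measurableT _ (measurableC (emeasurable_set1 (0%E : \bar R))).
  by rewrite setTI.
exists [set w | f3 w <> 0%E]; split => //.
- apply/negligibleP => //.
  have := (ae_eq_integral_abs (P x) measurableT mf3).1 I0.
  apply: negligibleS => w /= f3w; apply: contra_not f3w => h; exact: h.
- move=> w /= /contrapT f3w r Tr; apply/eqP; apply: contraT => G0.
  have [cc cc0 H] := Tlim_overshoot (@continuous_circ_chord R L) (@circ_chord_ge0 R L) ltr01 Tr G0.
  have : (cc%:E <= f3 w)%E.
    apply: limn_einf_ge; apply: filterS H => m H1.
    apply: limn_einf_ge; apply: filterS H1 => k H2.
    by apply: limn_einf_ge; apply: filterS H2 => i; rewrite lee_fin.
  by rewrite f3w lee_fin leNgt cc0.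
Qed.

Definition alive t (w : pathspace R) : R := \1_[set w | (t%:E < Tlim 0 w)%E] w.

Lemma measurable_Tlim0 : measurable_fun setT (Tlim 0).
Proof. exact: measurable_Tlim (@continuous_circ_chord R L) 0 (lexx 0). Qed.

Lemma bmfun_alive t : bmfun (alive t).
Proof.
apply: bmfun_indic.
rewrite (_ : [set w | _] = setT `&` [set w | (cst t%:E w < Tlim 0 w)%E]); last by rewrite setTI.
by apply: measurable_lte => //; exact: measurable_Tlim0.
Qed.

Lemma bmfun_lapl_Tlim q : 0 < q -> bmfun (fun w => lapl q (Tlim 0 w)).
Proof.
move=> q0; apply: (@bmfunP _ _ _ _ 1).
  apply: (@measurable_fun_cvg _ _ _ setT (fun k w => lapl q (hit 0 (level k) w))).
    by move=> k; apply: measurable_lapl_hit.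
  by move=> w _; exact: lapl_hit_cvg.
by move=> w; apply: lapl_bounded => //; exact: Tlim_ge.
Qed.

Lemma rc_natural_filtration t s F : t < s -> measurable_wrt (rc_filtration t) F ->
  measurable_wrt (natural_filtration s) F.
Proof. by move=> ts mF B mB; exact: mF. Qed.

Lemma bmfun_rc t F (M : R) : (forall w, `|F w| <= M) ->
  measurable_wrt (rc_filtration t) F -> bmfun F.
Proof.
move=> FM mF; apply: (@bmfunP _ _ _ _ M) => //.
apply: (@measurable_wrt_measurable _ (t + 1)).
by apply: rc_natural_filtration mF; rewrite ltrDl.
Qed.

Lemma measurable_circ_res q t : 0 < q -> 0 <= t ->
  measurable_fun setT (fun w => circ_res ps q (kap * X t w)).
Proof.
move=> q0 t0; apply: (@measurable_fun_cvg _ _ _ setT (fun N w => smooth_res ps q N (kap * X t w))).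
  by move=> N; apply: (bmfun_X_circ _ _).1 => //; exact: bmfun_smooth_res.
by move=> w _; exact: smooth_res_cvg.
Qed.

(** Stopping is applied from the times [t + mesh j], where [F] is adapted to the natural filtration,
    on the event that [level j] has not been entered; there [Tlim_shift] replaces the restarted
    limit time by [Tlim 0]. Right continuity of the paths brings the time back to [t]. *)
Lemma circ_res_Tlim_rc x q t F (M : R) : 0 < q -> 0 <= t ->
  (forall w, `|F w| <= M) -> measurable_wrt (rc_filtration t) F ->
  expR (- (q * t)) * \int[P x]_w (F w * alive t w * circ_res ps q (kap * X t w)) =
  circ_res ps q 0 * \int[P x]_w (F w * alive t w * lapl q (Tlim 0 w)).
Proof.
move=> q0 t0 FM mF.
have M0 : 0 <= M by have w0 : pathspace R := point; exact: le_trans (FM w0).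
pose a j : R := t + mesh j.
have ta j : t < a j by rewrite ltrDl mesh_gt0.
have a0 j : 0 <= a j by exact: le_trans (ltW (ta j)).
have at_ : a j @[j --> \oo] --> t.
  by rewrite -[X in _ --> X]addr0; apply: cvgD; [exact: cvg_cst|exact: mesh_cvg0].
pose Z j w : R := \1_[set w | ((a j)%:E <= hit 0 (level j) w)%E] w.
have mZ j : measurable_wrt (natural_filtration (a j)) (Z j).
  exact: measurable_wrt_level.
have Z1 j w : `|Z j w| <= 1 by rewrite ger0_norm /Z indicE; case: (_ \in _).
pose U j w := F w * Z j w.
have mU j : measurable_wrt (natural_filtration (a j)) (U j).
  by apply: measurable_wrtM => //; exact: rc_natural_filtration mF.
have UM j w : `|U j w| <= M by rewrite normrM -[leRHS]mulr1 ler_pM.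
have bU j : bmfun (U j) by apply: (@bmfunP _ _ _ _ M) => //; exact: measurable_wrt_measurable (mU j).
have Uc w : U j w @[j --> \oo] --> F w * alive t w.
  by apply: cvgM; [exact: cvg_cst|exact: indic_level_cvg].
have key j : expR (- (q * a j)) * \int[P x]_w (U j w * circ_res ps q (kap * X (a j) w)) =
    circ_res ps q 0 * \int[P x]_w (U j w * lapl q (Tlim 0 w)).
  rewrite (circ_res_Tlim x q0 (a0 j) (bU j) (mU j) (UM j)).
  congr (_ * _); apply: eq_Rintegral => w _.
  rewrite /U /Z indicE; have [/set_mem/= aw|_] := boolP (w \in _); last by rewrite mulr0 !mul0r.
  by rewrite (Tlim_shift (a0 j) aw).
have cL : expR (- (q * a j)) * \int[P x]_w (U j w * circ_res ps q (kap * X (a j) w)) @[j --> \oo] -->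
    expR (- (q * t)) * \int[P x]_w (F w * alive t w * circ_res ps q (kap * X t w)).
  apply: cvgM.
    apply: (@cvg_comp _ _ _ (fun j => - (q * a j)) (@expR R) _ (nbhs (- (q * t)))).
      by apply: cvgN; apply: cvgM => //; exact: cvg_cst.
    exact: continuous_expR.
  have [|||_ //] := @Exp_cvg _ _ R (P x) (fun j w => U j w * circ_res ps q (kap * X (a j) w))
    (fun w => F w * alive t w * circ_res ps q (kap * X t w)) (M * tsum (majorant ps q)).
  - by move=> j; apply: measurable_funM; [exact: (bU j).1|exact: measurable_circ_res].
  - by move=> j w; rewrite normrM ler_pM// circ_res_bounded.
  - move=> w; apply: cvgM => //; apply: circ_res_cvg => //.
    by apply: cvgM; [exact: cvg_cst|exact: X_right_cvg].
have cR : circ_res ps q 0 * \int[P x]_w (U j w * lapl q (Tlim 0 w)) @[j --> \oo] -->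
    circ_res ps q 0 * \int[P x]_w (F w * alive t w * lapl q (Tlim 0 w)).
  apply: cvgM; first exact: cvg_cst.
  have [|||_ //] := @Exp_cvg _ _ R (P x) (fun j w => U j w * lapl q (Tlim 0 w))
    (fun w => F w * alive t w * lapl q (Tlim 0 w)) (M * 1).
  - by move=> j; exact: (bmfunM (bU j) (bmfun_lapl_Tlim q0)).1.
  - by move=> j w; rewrite normrM ler_pM// lapl_bounded// Tlim_ge.
  - by move=> w; apply: cvgM => //; exact: cvg_cst.
rewrite -(cvg_lim _ cL)// -(cvg_lim _ cR)//; congr (lim _).
by under eq_fun do rewrite key.
Qed.

Lemma Exp_X0 x (f : R -> R) : \int[P x]_w f (X 0 w) = f x.
Proof.
have mX0 : measurable [set w | @X R 0 w = x].
  exact: (measurable_preimageT (measurable_X (lexx 0)) (measurable_set1 x)).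
rewrite (@Rintegral_eq_off_null _ _ _ _ (~` [set w | @X R 0 w = x]) _ (fun=> f x))//.
- exact: Exp_cst.
- exact: measurableC.
- apply: (etrans (probability_setC (P x) mX0)).
  rewrite (levyP.2 x _ mX0) (_ : P 0 _ = 1%E) ?subee//.
  rewrite -(levy_start levyP.1); congr (P 0 _).
  apply/seteqP; split => w /=; rewrite /X/=.
    by move=> h; apply: (addrI x); rewrite addr0.
  by move=> ->; rewrite addr0.
- by move=> w /contrapT /= ->.
Qed.

(** The classical formula [E_x[exp (- q T)] = r_q(x) / r_q(0)]: the stopping identity from time 0
    with [U = 1]. *)
Lemma Exp_lapl_Tlim x q : 0 < q ->
  circ_res ps q 0 * \int[P x]_w lapl q (Tlim 0 w) = circ_res ps q (kap * x).
Proof.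
move=> q0.
have c1 (w : pathspace R) : `|cst 1 w| <= (1 : R) by rewrite normr1.
have := circ_res_Tlim x q0 (lexx 0) (bmfun_cst 1)
  (@measurable_wrt_cst _ _ _) c1.
rewrite mulr0 oppr0 expR0 mul1r => h.
under eq_Rintegral do rewrite -[lapl _ _]mul1r.
rewrite -[LHS]h; under eq_Rintegral do rewrite /= mul1r.
exact: (Exp_X0 x (fun y => circ_res ps q (kap * y))).
Qed.

Lemma bmfun_circ_res q t : 0 < q -> 0 <= t ->
  bmfun (fun w => circ_res ps q (kap * X t w)).
Proof.
move=> q0 t0; apply: (@bmfunP _ _ _ _ (tsum (majorant ps q))).
  exact: measurable_circ_res.
by move=> w; exact: circ_res_bounded.
Qed.

Lemma bmfun_phi_res q t : 0 < q -> 0 <= t ->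
  bmfun (fun w => phi_res ps q (kap * X t w)).
Proof.
by move=> q0 t0; apply: bmfunB; [exact: bmfun_cst|exact: bmfun_circ_res].
Qed.

(** The numerator of the conditional expectation after integrating out the clock, times [r_q(0)];
    the denominator carries the same factor in [Exp_1_lapl_Tlim]. *)
Lemma Exp_alive_phi_res x q t F (M : R) : 0 < q -> 0 <= t ->
  (forall w, `|F w| <= M) -> measurable_wrt (rc_filtration t) F ->
  circ_res ps q 0 *
    \int[P x]_w (F w * (alive t w * (expR (- (q * t)) - lapl q (Tlim 0 w)))) =
  expR (- (q * t)) * \int[P x]_w (F w * alive t w * phi_res ps q (kap * X t w)).
Proof.
move=> q0 t0 FM mF; have h := circ_res_Tlim_rc x q0 t0 FM mF.
have bA := bmfunM (bmfun_rc FM mF) (bmfun_alive t).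
have bl := bmfunM bA (bmfun_lapl_Tlim q0).
have bc := bmfunM bA (bmfun_circ_res q0 t0).
have -> : \int[P x]_w (F w * (alive t w * (expR (- (q * t)) - lapl q (Tlim 0 w)))) =
    expR (- (q * t)) * \int[P x]_w (F w * alive t w) -
    \int[P x]_w (F w * alive t w * lapl q (Tlim 0 w)).
  rewrite -ExpZ// -ExpB//; last exact: bmfunZ.
  by apply: eq_Rintegral => w _; ring.
have -> : \int[P x]_w (F w * alive t w * phi_res ps q (kap * X t w)) =
    circ_res ps q 0 * \int[P x]_w (F w * alive t w) -
    \int[P x]_w (F w * alive t w * circ_res ps q (kap * X t w)).
  rewrite -ExpZ// -ExpB//; last exact: bmfunZ.
  by apply: eq_Rintegral => w _; rewrite /phi_res; ring.
by rewrite mulrBr -h; ring.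
Qed.

Lemma Exp_1_lapl_Tlim x q : 0 < q ->
  circ_res ps q 0 * \int[P x]_w (1 * (1 - lapl q (Tlim 0 w))) = phi_res ps q (kap * x).
Proof.
move=> q0; under eq_Rintegral do rewrite mul1r.
have bl := bmfun_lapl_Tlim q0.
rewrite (@ExpB _ _ _ _ (cst 1))//; last exact: bmfun_cst.
by rewrite Exp_cst mulrBr Exp_lapl_Tlim// mulr1.
Qed.

Lemma hitting_time_Tlim x : exists N : set (pathspace R),
  [/\ measurable N, P x N = 0%E &
      forall w, ~ N w -> hitting_time (lattice L) w = Tlim 0 w].
Proof.
have [N [mN N0 HN]] := chord_at_Tlim x.
exists N; split => // w /HN Hw; rewrite -(Tlim_hit_zero Hw) -latticeE//.
Qed.

Lemma measurable_phi0 t : 0 <= t ->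
  measurable_fun setT (fun w => phi0 ps (kap * X t w)).
Proof.
move=> t0; apply: (@measurable_fun_cvg _ _ _ setT (fun k w => phi_res ps (mesh k) (kap * X t w))).
  by move=> k; exact: (bmfun_phi_res (mesh_gt0 _) t0).1.
by move=> w _; apply: phi_res_cvg => // [k|]; [exact: mesh_gt0|exact: mesh_cvg0].
Qed.

Lemma cexpectation_phi0 x t F (M : R) : 0 <= t ->
  (forall w, `|F w| <= M) -> measurable_wrt (rc_filtration t) F ->
  cexpectation (P x) (fun w =>
    (F w * \1_[set w' | (t%:E < hitting_time (lattice L) w')%E] w)%:C *
    (phi_lattice L Psi (X t w) / phi_lattice L Psi x)) =
  (\int[P x]_w (F w * alive t w * phi0 ps (kap * X t w)) / phi0 ps (kap * x))%:C.
Proof.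
move=> t0 FM mF.
have Ew w : (F w * \1_[set w' | (t%:E < hitting_time (lattice L) w')%E] w)%:C *
    (phi_lattice L Psi (X t w) / phi_lattice L Psi x) =
    ((phi0 ps (kap * x))^-1 * (F w * \1_[set w' | (t%:E < hitting_time (lattice L) w')%E] w *
      phi0 ps (kap * X t w)))%:C.
  by rewrite !(phi_latticeE levyP PsiE sumL) -fmorphV -!rmorphM; congr (_%:C); ring.
have [N [mN N0 HN]] := hitting_time_Tlim x.
rewrite /cexpectation; congr (_ +i* _).
  under eq_Rintegral do rewrite Ew/=.
  rewrite [RHS]mulrC -ExpZ; last first.
    apply: bmfunM; first exact: bmfunM (bmfun_rc FM mF) (bmfun_alive t).
    apply: (@bmfunP _ _ _ _ (tsum (phi_majorant ps))); first exact: measurable_phi0.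
    by move=> w; exact: phi0_bounded.
  apply: (Rintegral_eq_off_null mN N0) => w /HN Hw; rewrite /alive !indicE.
  by congr (_ * (_ * (nat_of_bool _)%:R * _)); apply/idP/idP; rewrite !inE/= Hw.
under eq_Rintegral do rewrite Ew/=.
exact: Exp_cst.
Qed.

(** * The independent clock and the limit in [q] *)

Context (dS : measure_display) (S : measurableType dS) (Q : probability S R)
  (e : R -> {RV Q >-> R}).
Hypothesis eE : exponential_clocks e.

Lemma measurable_before q :
  measurable [set z : pathspace R * S | ((e q z.2)%:E < Tlim 0 z.1)%E].
Proof.
rewrite (_ : [set z | _] = setT `&` [set z | ((e q z.2)%:E < Tlim 0 z.1)%E]); last by rewrite setTI.
apply: measurable_lte => //; last first.
  by apply: measurableT_comp; [exact: measurable_Tlim0|exact: measurable_fst].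
apply: measurableT_comp => //.
by apply: measurableT_comp => //; exact: measurable_snd.
Qed.

Lemma measurable_clock q t : measurable [set z : pathspace R * S | t < e q z.2].
Proof.
rewrite (_ : [set z | _] = (e q \o snd) @^-1` `]t, +oo[).
  rewrite -[X in measurable X]setTI.
  have : measurable_fun setT (e q \o @snd (pathspace R) S).
    by apply: measurableT_comp => //; exact: measurable_snd.
  by apply.
by apply/seteqP; split => z /=; rewrite in_itv/= andbT.
Qed.

Lemma Exp_prod_eq_off_null x (f g : pathspace R * S -> R) :
  (forall z, hitting_time (lattice L) z.1 = Tlim 0 z.1 -> f z = g z) ->
  \int[(P x \x Q)%E]_z f z = \int[(P x \x Q)%E]_z g z.
Proof.
move=> fg; have [N [mN N0 HN]] := hitting_time_Tlim x.
apply: (@Rintegral_eq_off_null _ _ _ _ (N `*` setT)); first exact: measurableX.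
  by apply: (etrans (product_measure1E (P x) Q mN measurableT)); rewrite [X in (X * _)%E]N0 mul0e.
by move=> z Nz; apply/fg/HN => Nz1; apply: Nz; split.
Qed.

(** Off a null set the hitting time is [Tlim 0], which makes the events measurable on the product;
    Fubini then integrates the clock along sections, and the positive factor [circ_res ps q 0]
    cancels. *)
Lemma cond_expectation_phi_res x q t F (M : R) : 0 < q -> 0 <= t ->
  (forall w, `|F w| <= M) -> measurable_wrt (rc_filtration t) F ->
  cond_expectation (P x \x Q)%E (fun z => F z.1 * \1_[set z' | t < e q z'.2] z)
    [set z | ((e q z.2)%:E < hitting_time (lattice L) z.1)%E] =
  expR (- (q * t)) * \int[P x]_w (F w * alive t w * phi_res ps q (kap * X t w)) /
    phi_res ps q (kap * x).
Proof.
move=> q0 t0 FM mF.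
have c0 := circ_res0_gt0 ps0 ps_ge0 ps_neq0 summable_ps q0.
pose B := [set z : pathspace R * S | ((e q z.2)%:E < Tlim 0 z.1)%E].
have mB : measurable B := measurable_before q.
have num : \int[(P x \x Q)%E]_z (F z.1 * \1_[set z' | t < e q z'.2] z *
      \1_[set z | ((e q z.2)%:E < hitting_time (lattice L) z.1)%E] z) =
    \int[P x]_w (F w * (alive t w * (expR (- (q * t)) - lapl q (Tlim 0 w)))).
  rewrite (@Exp_prod_eq_off_null x _
    (fun z => F z.1 * \1_([set z' : pathspace R * S | t < e q z'.2] `&` B) z)); last first.
    move=> z Hz; rewrite indicI/= mulrA; congr (_ * _).
    by rewrite !indicE; congr (nat_of_bool _)%:R; apply/idP/idP; rewrite !inE/= Hz.
  rewrite Exp_prod_indic; [|exact: bmfun_rc FM mF|exact: measurableI (measurable_clock q t) mB].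
  apply: eq_Rintegral => w _; congr (_ * _).
  rewrite (_ : xsection _ _ = [set s | t < e q s /\ ((e q s)%:E < Tlim 0 w)%E]); last first.
    by apply/seteqP; split => s; rewrite /xsection/= ?inE.
  rewrite clock_between// /alive indicE.
  case: ifPn => h; first by rewrite mem_set//= mul1r.
  by rewrite memNset ?mul0r//; exact/negP.
have den : \int[(P x \x Q)%E]_z \1_[set z | ((e q z.2)%:E < hitting_time (lattice L) z.1)%E] z =
    \int[P x]_w (1 * (1 - lapl q (Tlim 0 w))).
  rewrite (@Exp_prod_eq_off_null x _ (fun z => cst 1 z.1 * \1_B z)); last first.
    move=> z Hz; rewrite /= mul1r.
    by rewrite !indicE; congr (nat_of_bool _)%:R; apply/idP/idP; rewrite !inE/= Hz.
  rewrite Exp_prod_indic//; last exact: bmfun_cst.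
  apply: eq_Rintegral => w _; congr (_ * _).
  rewrite (_ : xsection _ _ = [set s | ((e q s)%:E < Tlim 0 w)%E]); last first.
    by apply/seteqP; split => s; rewrite /xsection/= ?inE.
  by rewrite clock_lt//; exact: Tlim_ge.
rewrite /cond_expectation [X in X / _]num [X in _ / X]den.
rewrite -(Exp_1_lapl_Tlim x q0) -(Exp_alive_phi_res x q0 t0 FM mF).
by rewrite -mulf_div divff ?mul1r// gt_eqF.
Qed.

Lemma cvg_cond_expectation x t F (M : R) (q_ : R ^nat) : 0 <= t ->
  (forall w, `|F w| <= M) -> measurable_wrt (rc_filtration t) F ->
  phi0 ps (kap * x) != 0 -> (forall k, 0 < q_ k) -> q_ k @[k --> \oo] --> 0 ->
  cond_expectation (P x \x Q)%E (fun z => F z.1 * \1_[set z' | t < e (q_ k) z'.2] z)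
    [set z | ((e (q_ k) z.2)%:E < hitting_time (lattice L) z.1)%E] @[k --> \oo] -->
  \int[P x]_w (F w * alive t w * phi0 ps (kap * X t w)) / phi0 ps (kap * x).
Proof.
move=> t0 FM mF p0 q0 qk0.
under eq_fun do rewrite (cond_expectation_phi_res x (q0 _) t0 FM mF).
apply: cvgM; last first.
  by apply: cvgV => //; exact: phi_res_cvg.
rewrite -[X in _ --> X]mul1r; apply: cvgM.
  rewrite -expR0 -oppr0 -(mul0r t).
  apply: (@cvg_comp _ _ _ (fun j => - (q_ j * t)) (@expR R) _ (nbhs (- (0 * t)))).
    by apply: cvgN; apply: cvgM => //; exact: cvg_cst.
  exact: continuous_expR.
apply: (@Exp_mul_cvg _ _ _ _ M (tsum (phi_majorant ps))).
- exact: bmfunM (bmfun_rc FM mF) (bmfun_alive t).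
- by move=> w; rewrite normrM -[leRHS]mulr1 ler_pM// /alive indicE; case: (_ \in _); rewrite ?normr1 ?normr0.
- by move=> k; exact: (bmfun_phi_res (q0 k) t0).1.
- by move=> k w; exact: phi_res_bounded.
- by move=> w; exact: phi_res_cvg.
Qed.

End circle_process.

Theorem theorem1p4 (R : realType) (P : R -> probability (pathspace R) R)
    (Psi : R -> R[i]) (dS : measure_display) (S : measurableType dS)
    (Q : probability S R) (e : R -> {RV Q >-> R}) (L : R)
    (levyP : levy_process P)
    (PsiE : characteristic_exponent (P 0) Psi)
    (recP : recurrent P)
    (regP : forall a, regular_for_itself P a)
    (condA : resolvent_integrable Psi)
    (eE : exponential_clocks e)
    (L_gt0 : 0 < L)
    (sumL : lattice_summable L Psi) :
  let T := hitting_time (lattice L) in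
  let phi := phi_lattice L Psi in
  forall (t : R) (F : pathspace R -> R) (x : R),
    0 <= t ->
    (exists M : R, forall w, `|F w| <= M) ->
    measurable_wrt (rc_filtration t) F ->
    phi x != 0 ->
    (cond_expectation (P x \x Q)%E
       (fun z => F z.1 * \1_[set z' | t < e q z'.2] z)
       [set z | ((e q z.2)%:E < T z.1)%E])%:C
      @[q --> 0^'+] -->
    (cexpectation (P x)
      (fun w => (F w * \1_[set w' | (t%:E < T w')%E] w)%:C
                * (phi (X t w) / phi x)) : R[i]^o).
Proof.
move=> T phi t F x t0 [M FM] mF phix.
rewrite (cexpectation_phi0 levyP PsiE L_gt0 sumL x t0 FM mF).
(* Both sides are real, and the limit is taken along sequences because the dominated convergence
   results are sequential. *)
apply: cvg_real_complex; apply/cvg_at_rightP => q_ [q0 qk0].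
apply: (cvg_cond_expectation levyP PsiE L_gt0 sumL eE t0 FM mF) => //.
move: phix; rewrite /phi (phi_latticeE levyP PsiE sumL).
by apply: contraNneq => ->.
Qed.
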